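(* Consider the second order optimal control problem $$\min_{(q,u)}\ \mathcal{J}[q,u]=\int_0^T C(q(t),\dot q(t),u(t))\,dt\quad\text{subject to}\quad \ddot q(t)=f(q(t),\dot q(t),u(t)),\quad (q,\dot q)(0)=(q_0,v_0),\quad (q,\dot q)(T)=(q_T,v_T),$$ and let $$\tilde{\mathcal L}^{\mathcal E}(q,\kappa,v_q,v_\kappa,u)=v_\kappa^\top v_q+\kappa^\top f(q,v_q,u)-C(q,v_q,u).$$ Let $(q,\kappa,u)$ satisfy the first order optimality conditions given in the context, with $(q,u)$ normal and of corank $1$ (see context), and write $y=(q,\kappa)$, $x=(q,\dot q)$. (1) If the control $u(\cdot)$ and the corresponding state $q(\cdot)$ are optimal for the problem, then $(y,\dot y,u)$ satisfies $$\frac{\partial^2\tilde{\mathcal L}^{\mathcal E}}{\partial u^2}(y(t),\dot y(t),u(t))\leq 0\qquad\forall t\in[0,T]$$ (negative semidefinite). (2) If $(y,\dot y,u)$ satisfies the strong Legendre condition $$\frac{\partial^2\tilde{\mathcal L}^{\mathcal E}}{\partial u^2}(y(t),\dot y(t),u(t))<0\qquad\forall t\in[0,T]$$ (negative definite), then there exists a time interval $[0,\varepsilon]$, $\varepsilon>0$, on which $(x,u)$ is locally optimal.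
   Context: Setting. $\mathcal Q$ is a smooth $n$-dimensional configuration manifold and the control space $\mathcal N$ is a finite-dimensional real vector space. Everything is written in local coordinates, so that $q$ takes values in an open subset of $\mathbb R^n$, velocities in $\mathbb R^n$, and $u$ in $\mathcal N=\mathbb R^m$ (no control constraints). The cost $C(q,v,u)\in\mathbb R$ and the map $f(q,v,u)\in\mathbb R^n$ are of class $C^2$. $T>0$ and $q_0,v_0,q_T,v_T$ are fixed. Curves $q,\kappa$ are of class $C^2$ and controls $u$ are continuous on $[0,T]$. A pair $(q,u)$ is admissible if it satisfies $\ddot q=f(q,\dot q,u)$ and the boundary conditions. It is optimal if it minimises $\mathcal J$ among admissible pairs. Local optimality on $[0,\varepsilon]$ is understood in the weak sense: the restriction of $(q,u)$ to $[0,\varepsilon]$ minimises $\int_0^\varepsilon C\,dt$ among all pairs $(\bar q,\bar u)$ on $[0,\varepsilon]$ satisfying $\ddot{\bar q}=f(\bar q,\dot{\bar q},\bar u)$, having the same values of $(\bar q,\dot{\bar q})$ as $(q,\dot q)$ at times $0$ and $\varepsilon$, and such that $(\bar q,\dot{\bar q},\bar u)$ is sufficiently close to $(q,\dot q,u)$ uniformly on $[0,\varepsilon]$. Notation. For $y=(q,\kappa)$, the expression $\tilde{\mathcal L}^{\mathcal E}(y,\dot y,u)$ means $\tilde{\mathcal L}^{\mathcal E}(q,\kappa,\dot q,\dot\kappa,u)$, i.e. $v_q=\dot q$, $v_\kappa=\dot\kappa$. First order optimality conditions for $(q,\kappa,u)$ (all derivatives of $C,f$ evaluated at $(q(t),\dot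 q(t),u(t))$): $$\ddot q=f,\qquad \ddot\kappa=\frac{d}{dt}\Big[\frac{\partial C}{\partial\dot q}-\kappa^\top\frac{\partial f}{\partial\dot q}\Big]-\frac{\partial C}{\partial q}+\kappa^\top\frac{\partial f}{\partial q},\qquad 0=\frac{\partial C}{\partial u}-\kappa^\top\frac{\partial f}{\partial u},$$ together with the boundary conditions on $(q,\dot q)$ at $0$ and $T$. Normality and corank. With $v=\dot q$ and $\lambda=(\lambda_q,\lambda_v)$, set $\mathcal H_{\lambda^0}(q,v,\lambda_q,\lambda_v,u)=\lambda_q^\top v+\lambda_v^\top f(q,v,u)+\lambda^0C(q,v,u)$. Given $(q,u)$, consider all pairs $(\lambda(\cdot),\lambda^0)\ne 0$ with $\lambda$ absolutely continuous and $\lambda^0\le 0$ such that along the curve $\dot\lambda_q=-\partial\mathcal H_{\lambda^0}/\partial q$, $\dot\lambda_v=-\partial\mathcal H_{\lambda^0}/\partial v$, $\partial\mathcal H_{\lambda^0}/\partial u=0$. The corank is the dimension of the vector space spanned by the values $(\lambda(T),\lambda^0)$ over all such pairs. The normal case is $\lambda^0\neq 0$, normalised to $\lambda^0=-1$. The adjoint $\kappa$ corresponds to $\lambda_v$. *)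

(* Defs.v *)
From HB Require Import structures.
From mathcomp Require Import all_boot all_order all_algebra.
From mathcomp Require Import all_classical all_reals all_analysis.

Set Implicit Arguments.
Unset Strict Implicit.
Unset Printing Implicit Defensive.

Import Order.TTheory GRing.Theory Num.Theory.
Import numFieldNormedType.Exports.

Local Open Scope classical_set_scope.
Local Open Scope ring_scope.

(* Vectors of R^n are row vectors, and C and f are functions of the triple
   (q, v, u), seen as a point of the normed space R^n * R^n * R^m. *)
Notation state_ctrl R n m := ('rV[R]_n * 'rV[R]_n * 'rV[R]_m)%type.

Definition dotp (R : realType) (n : nat) (x y : 'rV[R]_n) : R :=
  \sum_(i < n) x 0 i * y 0 i.

Definition grad (R : realType) (n : nat) (g : 'rV[R]_n -> R) (x : 'rV[R]_n)
    : 'rV[R]_n :=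
  \row_i 'D_(delta_mx 0 i) g x.

Definition hessian (R : realType) (n : nat) (g : 'rV[R]_n -> R) (x : 'rV[R]_n)
    : 'M[R]_n :=
  \matrix_(i, j) 'D_(delta_mx 0 j) ('D_(delta_mx 0 i) g) x.

Definition neg_semidefinite (R : realType) (n : nat) (A : 'M[R]_n) : Prop :=
  forall w : 'rV[R]_n, (w *m A *m w^T) 0 0 <= 0.

Definition neg_definite (R : realType) (n : nat) (A : 'M[R]_n) : Prop :=
  forall w : 'rV[R]_n, w != 0 -> (w *m A *m w^T) 0 0 < 0.

(* Class C^k on an open set D.  In finite dimension, continuity of all the
   directional derivatives is continuity of the differential. *)
Fixpoint Ck_on (R : realType) (V W : normedModType R) (k : nat) (D : set V)
    (g : V -> W) : Prop :=
  if k is k'.+1 then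
    (forall x, D x -> differentiable g x) /\
    (forall v, Ck_on k' D ('D_v g))
  else forall x, D x -> {for x, continuous g}.

(* Derivative relative to [a, b]: two-sided in the interior, one-sided at the
   endpoints; only the values of g on [a, b] matter. *)
Definition quot_within (R : realType) (V : normedModType R) (a b : R)
    (g : R -> V) (t : R) : set_system V :=
  (fun s => (s - t)^-1 *: (g s - g t)) @ within `[a, b]%classic t^'.

Definition derivable_within (R : realType) (V : normedModType R) (a b : R)
    (g : R -> V) (t : R) : Prop :=
  cvg (quot_within a b g t).

Definition derive_within (R : realType) (V : normedModType R) (a b : R)
    (g : R -> V) (t : R) : V :=
  lim (quot_within a b g t).

Definition C0_curve (R : realType) (V : normedModType R) (a b : R)
    (g : R -> V) : Prop :=
  {within `[a, b], continuous g}.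

Definition C2_curve (R : realType) (V : normedModType R) (a b : R)
    (g : R -> V) : Prop :=
  [/\ forall t, t \in `[a, b] -> derivable_within a b g t,
      forall t, t \in `[a, b] ->
        derivable_within a b (derive_within a b g) t
    & C0_curve a b (derive_within a b (derive_within a b g))].

Definition abs_continuous (R : realType) (V : normedModType R) (a b : R)
    (g : R -> V) : Prop :=
  forall e : R, 0 < e -> exists2 d : R, 0 < d &
    forall (k : nat) (s t : 'I_k -> R),
      (forall i, a <= s i /\ s i <= t i /\ t i <= b) ->
      trivIset [set: 'I_k] (fun i => `]s i, t i[%classic) ->
      \sum_(i < k) (t i - s i) < d ->
      \sum_(i < k) `|g (t i) - g (s i)| < e.

(* (q, dq/dt, u) at time t, for a curve on [a, b] *)
Definition along (R : realType) (n m : nat) (a b : R)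
    (q : R -> 'rV[R]_n) (u : R -> 'rV[R]_m) (t : R) : state_ctrl R n m :=
  (q t, derive_within a b q t, u t).

Definition trajectory (R : realType) (n m : nat) (Omega : set 'rV[R]_n)
    (f : state_ctrl R n m -> 'rV[R]_n) (a b : R)
    (q : R -> 'rV[R]_n) (u : R -> 'rV[R]_m) : Prop :=
  [/\ C2_curve a b q,
      C0_curve a b u,
      forall t, t \in `[a, b] -> Omega (q t)
    & forall t, t \in `[a, b] ->
        derive_within a b (derive_within a b q) t = f (along a b q u t)].

Definition cost (R : realType) (n m : nat) (C : state_ctrl R n m -> R) (a b : R)
    (q : R -> 'rV[R]_n) (u : R -> 'rV[R]_m) : R :=
  \int[lebesgue_measure]_(t in `[a, b]) C (along a b q u t).

Definition admissible (R : realType) (n m : nat) (Omega : set 'rV[R]_n)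
    (f : state_ctrl R n m -> 'rV[R]_n) (T : R) (q0 v0 qT vT : 'rV[R]_n)
    (q : R -> 'rV[R]_n) (u : R -> 'rV[R]_m) : Prop :=
  [/\ trajectory Omega f 0 T q u,
      q 0 = q0 /\ derive_within 0 T q 0 = v0
    & q T = qT /\ derive_within 0 T q T = vT].

Definition optimal (R : realType) (n m : nat) (Omega : set 'rV[R]_n)
    (C : state_ctrl R n m -> R) (f : state_ctrl R n m -> 'rV[R]_n)
    (T : R) (q0 v0 qT vT : 'rV[R]_n)
    (q : R -> 'rV[R]_n) (u : R -> 'rV[R]_m) : Prop :=
  admissible Omega f T q0 v0 qT vT q u /\
  forall q' u', admissible Omega f T q0 v0 qT vT q' u' ->
    cost C 0 T q u <= cost C 0 T q' u'.

Definition locally_optimal (R : realType) (n m : nat) (Omega : set 'rV[R]_n)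
    (C : state_ctrl R n m -> R) (f : state_ctrl R n m -> 'rV[R]_n) (a b : R)
    (q : R -> 'rV[R]_n) (u : R -> 'rV[R]_m) : Prop :=
  trajectory Omega f a b q u /\
  exists2 r : R, 0 < r & forall q' u',
    trajectory Omega f a b q' u' ->
    q' a = q a /\ derive_within a b q' a = derive_within a b q a ->
    q' b = q b /\ derive_within a b q' b = derive_within a b q b ->
    (forall t, t \in `[a, b] ->
       [/\ `|q' t - q t| < r,
           `|derive_within a b q' t - derive_within a b q t| < r
         & `|u' t - u t| < r]) ->
    cost C a b q u <= cost C a b q' u'.

Definition Ltilde (R : realType) (n m : nat)
    (C : state_ctrl R n m -> R) (f : state_ctrl R n m -> 'rV[R]_n)
    (q kappa vq vkappa : 'rV[R]_n) (u : 'rV[R]_m) : R :=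
  dotp vkappa vq + dotp kappa (f (q, vq, u)) - C (q, vq, u).

(* The library's Jacobian acts on row vectors on the right,
   'd g x h = h *m 'J g x, so the covector kappa^T (dg/dx) is
   kappa *m ('J g x)^T. *)
Definition first_order_conditions (R : realType) (n m : nat)
    (Omega : set 'rV[R]_n)
    (C : state_ctrl R n m -> R) (f : state_ctrl R n m -> 'rV[R]_n)
    (T : R) (q0 v0 qT vT : 'rV[R]_n)
    (q kappa : R -> 'rV[R]_n) (u : R -> 'rV[R]_m) : Prop :=
  let v := derive_within 0 T q in
  let C_q t := grad (fun x => C (x, v t, u t)) (q t) in
  let C_v t := grad (fun x => C (q t, x, u t)) (v t) in
  let C_u t := grad (fun x => C (q t, v t, x)) (u t) in
  let kf_q t := kappa t *m ('J (fun x => f (x, v t, u t)) (q t))^T in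
  let kf_v t := kappa t *m ('J (fun x => f (q t, x, u t)) (v t))^T in
  let kf_u t := kappa t *m ('J (fun x => f (q t, v t, x)) (u t))^T in
  let bracket t := C_v t - kf_v t in
  [/\ admissible Omega f T q0 v0 qT vT q u,
      C2_curve 0 T kappa,
      forall t, t \in `[0, T] -> derivable_within 0 T bracket t,
      forall t, t \in `[0, T] ->
        derive_within 0 T (derive_within 0 T kappa) t =
        derive_within 0 T bracket t - C_q t + kf_q t
    & forall t, t \in `[0, T] -> 0 = C_u t - kf_u t].

Definition hamiltonian (R : realType) (n m : nat)
    (C : state_ctrl R n m -> R) (f : state_ctrl R n m -> 'rV[R]_n)
    (l0 : R) (q v lq lv : 'rV[R]_n) (u : 'rV[R]_m) : R :=
  dotp lq v + dotp lv (f (q, v, u)) + l0 * C (q, v, u).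

Definition multiplier (R : realType) (n m : nat)
    (C : state_ctrl R n m -> R) (f : state_ctrl R n m -> 'rV[R]_n) (T : R)
    (q : R -> 'rV[R]_n) (u : R -> 'rV[R]_m)
    (lq lv : R -> 'rV[R]_n) (l0 : R) : Prop :=
  let v := derive_within 0 T q in
  let H := hamiltonian C f l0 in
  [/\ ~ ((forall t, t \in `[0, T] -> lq t = 0 /\ lv t = 0) /\ l0 = 0),
      l0 <= 0,
      abs_continuous 0 T lq /\ abs_continuous 0 T lv,
      {ae lebesgue_measure, forall t : R, t \in `]0, T[ ->
        is_derive t 1 lq
          (- grad (fun x => H x (v t) (lq t) (lv t) (u t)) (q t)) /\
        is_derive t 1 lv
          (- grad (fun x => H (q t) x (lq t) (lv t) (u t)) (v t))}
    & forall t, t \in `[0, T] ->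
        grad (fun x => H (q t) (v t) (lq t) (lv t) x) (u t) = 0].

Definition normal (R : realType) (n m : nat)
    (C : state_ctrl R n m -> R) (f : state_ctrl R n m -> 'rV[R]_n) (T : R)
    (q : R -> 'rV[R]_n) (u : R -> 'rV[R]_m) : Prop :=
  exists lq lv l0, multiplier C f T q u lq lv l0 /\ l0 != 0.

Definition final_multipliers (R : realType) (n m : nat)
    (C : state_ctrl R n m -> R) (f : state_ctrl R n m -> 'rV[R]_n) (T : R)
    (q : R -> 'rV[R]_n) (u : R -> 'rV[R]_m) : set 'rV[R]_(n + n + 1) :=
  [set z | exists lq lv l0, multiplier C f T q u lq lv l0 /\
     z = row_mx (row_mx (lq T) (lv T)) (const_mx l0)].

(* U is the linear span of the (possibly infinite) set S. *)
Definition is_span (R : realType) (k : nat) (S : set 'rV[R]_k)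
    (U : {vspace 'rV[R]_k}) : Prop :=
  (forall x, S x -> x \in U) /\
  forall W : {vspace 'rV[R]_k}, (forall x, S x -> x \in W) -> (U <= W)%VS.

Definition has_corank (R : realType) (n m : nat)
    (C : state_ctrl R n m -> R) (f : state_ctrl R n m -> 'rV[R]_n) (T : R)
    (q : R -> 'rV[R]_n) (u : R -> 'rV[R]_m) (k : nat) : Prop :=
  exists2 U : {vspace 'rV[R]_(n + n + 1)},
    is_span (final_multipliers C f T q u) U & \dim U = k.

(* Main.v *)
(** Write H = <lambda_q, v> + <kappa, f> - C with lambda_v = kappa.  The first
    order conditions say that the linear part of the cost vanishes along
    variations with fixed endpoints, so that for every competitor
    J(q', u') - J(q, u) = - int rem, where rem is the second order Taylor
    remainder of <kappa, f> - C at (q, v, u); its leading term is half a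
    quadratic form whose control block is L_uu.

    Sufficiency: on a short interval [0, eps], Gronwall's inequality bounds the
    state variation by the integral of the control variation, so that the
    negative control block dominates the quadratic form.

    Necessity: normality and corank 1 exclude abnormal multipliers, hence the
    controllability gramian of the linearised system is invertible.  If L_uu
    were positive in a direction w at time t0, a control bump s eta w supported
    in a window of width h around t0 could be corrected, by a fixed point
    argument, into an admissible variation at distance O(s h) from the bump.
    Then int rem >= c s^2 h - O(s^2 h^2) > 0 for small h, against optimality. *)
Require Import Defs.
From HB Require Import structures.
From mathcomp Require Import all_boot all_order all_algebra.
From mathcomp Require Import all_classical all_reals all_analysis.
From mathcomp Require Import ring lra.
Set Implicit Arguments.
Unset Strict Implicit.
Unset Printing Implicit Defensive.
Import Order.TTheory GRing.Theory Num.Theory.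
Import numFieldNormedType.Exports.
Local Open Scope classical_set_scope.
Local Open Scope ring_scope.

(** The comparison of costs is an exact identity for every competitor, so that all estimates bear on
    a pointwise remainder, in a tube whose radius, given by compactness of [0, T], depends neither
    on t nor on the competitor. The tolerated Taylor error is a fixed fraction of the coercivity
    constant of L_uu; it stays quadratic and is absorbed. For sufficiency, every term of the form
    other than the control block has a state factor, bounded by a constant times the integral of
    |du|. Cauchy-Schwarz, (int |du|)^2 <= eps int |du|^2, supplies the small factor eps. For
    necessity, gain and loss are both homogeneous of degree 2 in s, so h is fixed first, and s only
    has to keep the perturbation in the tube. Competing controls are continuous, which makes the
    bump a tent. Its correction is a fixed point in the pair (state, control): the nonlinear part of
    f is a source term of the linearised system, and a least norm control brings the state back to 0
    at time T. *)

Section real_calculus.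
Context {R : realType}.
Implicit Types (a b t : R) (f g h k F G : R -> R).

(** * Increments, primitives from 0 and their relation to Lebesgue integrals *)

Lemma derive_le_increment F G (f g : R -> R) a b : a <= b ->
  {within `[a, b], continuous F} -> {within `[a, b], continuous G} ->
  (forall t, t \in `]a, b[ -> is_derive t 1 F (f t)) ->
  (forall t, t \in `]a, b[ -> is_derive t 1 G (g t)) ->
  (forall t, t \in `]a, b[ -> f t <= g t) ->
  F b - F a <= G b - G a.
Proof.
move=> ab cF cG dF dG fg.
have cH : {within `[a, b], continuous (G \- F)}.
  by move=> x; apply: continuousB; [exact: cG|exact: cF].
have dH t : t \in `]a, b[ -> is_derive t 1 (G \- F) (g t - f t).
  by move=> tab; have ? := dF _ tab; have ? := dG _ tab; exact: is_deriveB.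
move: ab; rewrite le_eqVlt => /predU1P[<-|ab]; first by rewrite !subrr.
have [c cab /= E] := MVT ab dH cH.
rewrite -subr_ge0 (_ : _ - _ = (G b - F b) - (G a - F a)); last by ring.
by rewrite E mulr_ge0 // subr_ge0 ?fg // ltW.
Qed.

Lemma derive_eq_increment F G (f g : R -> R) a b : a <= b ->
  {within `[a, b], continuous F} -> {within `[a, b], continuous G} ->
  (forall t, t \in `]a, b[ -> is_derive t 1 F (f t)) ->
  (forall t, t \in `]a, b[ -> is_derive t 1 G (g t)) ->
  (forall t, t \in `]a, b[ -> f t = g t) ->
  F b - F a = G b - G a.
Proof.
move=> ab cF cG dF dG fg; apply/eqP; rewrite eq_le.
by rewrite !(derive_le_increment ab cF cG dF dG, derive_le_increment ab cG cF dG dF) // => t /fg ->.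
Qed.

(* Integrating from -1 keeps 0 interior, so that [prim h] has a two-sided
   derivative at 0. *)
Definition prim h t : R :=
  \int[lebesgue_measure]_(s in `[-1, t]) h s
  - \int[lebesgue_measure]_(s in `[-1, 0]) h s.

Lemma prim0 h : prim h 0 = 0. Proof. by rewrite /prim subrr. Qed.

Lemma integrable_continuous h a b : continuous h ->
  lebesgue_measure.-integrable `[a, b] (EFin \o h).
Proof.
move=> ch; apply: continuous_compact_integrable; first exact: segment_compact.
exact: continuous_subspaceT.
Qed.

Lemma is_derive_prim h t : continuous h -> 0 <= t -> is_derive t 1 (prim h) (h t).
Proof.
move=> ch t0.
(* The theorem is applied on [-1, t + 1], which has every t >= 0 in its interior. *)
have [d e] := continuous_FTC1_closed (ltr_pwDr ltr01 (lexx t))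
  (integrable_continuous (-1) (t+1) ch) (lt_le_trans (ltrN10 _) t0) (ch t).
have D : is_derive t 1 (fun x => \int[lebesgue_measure]_(s in `[-1, x]) h s) (h t).
  by split; [exact: d|rewrite -derive1E].
rewrite -[h t]subr0; exact: is_deriveB.
Qed.

Lemma continuous_prim h t : continuous h -> 0 <= t -> {for t, continuous (prim h)}.
Proof.
move=> ch t0; have ? := is_derive_prim ch t0.
by apply/differentiable_continuous/derivable1_diffP; exact: ex_derive.
Qed.

Lemma within_continuous F a b :
  (forall t, t \in `[a, b] -> {for t, continuous F}) -> {within `[a, b], continuous F}.
Proof.
move=> cF; apply: continuous_in_subspaceT => t; rewrite inE => tab; exact: cF.
Qed.

(** Linearity, constants and exponential weights are all computed through this lemma: exhibiting a
    continuous function with the right interior derivative replaces any manipulation of the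
    integrals. *)
Lemma prim_unique h F b : continuous h -> 0 <= b ->
  {within `[0, b], continuous F} ->
  (forall t, t \in `]0, b[ -> is_derive t 1 F (h t)) ->
  prim h b = F b - F 0.
Proof.
move=> ch b0 cF dF; have <- : prim h b - prim h 0 = prim h b by rewrite prim0 subr0.
apply: (@derive_eq_increment _ _ h h) => //.
  by apply: within_continuous => t; rewrite in_itv => /andP[t0 _]; exact: continuous_prim.
by move=> t; rewrite in_itv => /andP[/ltW t0 _]; exact: is_derive_prim.
Qed.

Lemma prim_le h k b : continuous h -> continuous k -> 0 <= b ->
  (forall t, 0 <= t <= b -> h t <= k t) -> prim h b <= prim k b.
Proof.
move=> ch ck b0 hk.
have <- : prim h b - prim h 0 = prim h b by rewrite prim0 subr0.
have <- : prim k b - prim k 0 = prim k b by rewrite prim0 subr0.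
apply: (@derive_le_increment _ _ h k) => //.
- by apply: within_continuous => t; rewrite in_itv => /andP[t0 _]; exact: continuous_prim.
- by apply: within_continuous => t; rewrite in_itv => /andP[t0 _]; exact: continuous_prim.
- by move=> t; rewrite in_itv => /andP[/ltW t0 _]; exact: is_derive_prim.
- by move=> t; rewrite in_itv => /andP[/ltW t0 _]; exact: is_derive_prim.
- by move=> t; rewrite in_itv => /andP[/ltW t0 /ltW t1]; apply: hk; rewrite t0.
Qed.

Lemma primD h k b : continuous h -> continuous k -> 0 <= b ->
  prim (h \+ k) b = prim h b + prim k b.
Proof.
move=> ch ck b0.
suff -> : prim (h \+ k) b = (prim h \+ prim k) b - (prim h \+ prim k) 0.
  by rewrite /= !prim0 addr0 subr0.
apply: prim_unique => //.
- by move=> t; apply: continuousD; [exact: ch|exact: ck].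
- apply: within_continuous => t; rewrite in_itv => /andP[t0 _].
  by apply: continuousD; exact: continuous_prim.
- move=> t; rewrite in_itv => /andP[/ltW t0 _].
  by have ? := is_derive_prim ch t0; have ? := is_derive_prim ck t0; exact: is_deriveD.
Qed.

Lemma primZ c h b : continuous h -> 0 <= b ->
  prim (fun t => c * h t) b = c * prim h b.
Proof.
move=> ch b0.
pose F t := c * prim h t.
suff -> : prim (fun t => c * h t) b = F b - F 0 by rewrite /F !prim0 mulr0 subr0.
apply: prim_unique => //.
- by move=> t; apply: (@continuousM _ _ (fun=> c) h); [exact: cst_continuous|exact: ch].
- apply: within_continuous => t; rewrite in_itv => /andP[t0 _].
  by apply: (@continuousM _ _ (fun=> c) (prim h)); [exact: cst_continuous|exact: continuous_prim].
- move=> t; rewrite in_itv => /andP[/ltW t0 _].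
  have D := is_derive_prim ch t0; exact: is_deriveZ.
Qed.

Lemma prim_cst c b : 0 <= b -> prim (fun=> c) b = c * b.
Proof.
move=> b0; pose F t := c * t.
suff -> : prim (fun=> c) b = F b - F 0 by rewrite /F mulr0 subr0.
apply: prim_unique => //.
- by move=> t; exact: cst_continuous.
- apply: within_continuous => t _.
  by apply: (@continuousM _ _ (fun=> c) id); [exact: cst_continuous|exact: id].
- move=> t _; rewrite -[X in is_derive _ _ _ X]mulr1; exact: is_deriveZ.
Qed.

Lemma ler_norm_prim h k b : continuous h -> continuous k -> 0 <= b ->
  (forall t, 0 <= t <= b -> `|h t| <= k t) -> `|prim h b| <= prim k b.
Proof.
move=> ch ck b0 hk; rewrite ler_norml -[- prim k b]mulN1r -primZ //.
rewrite !prim_le //; first by move=> t /hk; rewrite ler_norml => /andP[].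
- by move=> t; apply: (@continuousM _ _ (fun=> -1) k); [exact: cst_continuous|exact: ck].
- by move=> t /hk; rewrite ler_norml mulN1r => /andP[].
Qed.

(** A cost is meaningful on the segment alone; agreement of [g] with a continuous [h] there turns it
    into a primitive of a clamped extension. The integral from -1 is split at 0 by the fundamental
    theorem with antiderivative [prim h]. *)
Lemma Rintegral_prim g h b : 0 <= b -> continuous h ->
  (forall t, 0 <= t <= b -> g t = h t) ->
  \int[lebesgue_measure]_(t in `[0, b]) g t = prim h b.
Proof.
move=> b0 ch gh.
have -> : \int[lebesgue_measure]_(t in `[0, b]) g t = \int[lebesgue_measure]_(t in `[0, b]) h t.
  apply: eq_Rintegral; by move=> t; rewrite inE /= in_itv; exact: gh.
rewrite /prim; apply/eqP; rewrite eq_sym subr_eq eq_sym; apply/eqP.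
move: b0; rewrite le_eqVlt => /predU1P[<-|b0].
  by rewrite set_itv1 Rintegral_set1 add0r.
have cF : {within `[0, b], continuous (prim h)}.
  by apply: within_continuous => t; rewrite in_itv => /andP[t0 _]; exact: continuous_prim.
have [_ c0 cb] := (continuous_within_itvP _ b0).1 cF.
have := @continuous_FTC2 R h (prim h) 0 b b0; rewrite /Rintegral => ->.
- by rewrite prim0 /= subr0 /prim subrK.
- exact: continuous_subspaceT.
- split => // t; rewrite in_itv => /andP[/ltW t0 _].
  by have ? := is_derive_prim ch t0; exact: ex_derive.
- move=> t; rewrite in_itv => /andP[/ltW t0 _].
  by have ? := is_derive_prim ch t0; rewrite derive1E derive_val.
Qed.

(* Precomposition with [clamp b] extends a curve on [0, b] to the whole line. *)
Definition clamp b t : R := Num.max 0 (Num.min b t).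

Lemma clamp_id b t : 0 <= t <= b -> clamp b t = t.
Proof. by move=> /andP[t0 tb]; rewrite /clamp min_r // max_r. Qed.

Lemma clamp_itv b t : 0 <= b -> 0 <= clamp b t <= b.
Proof. by move=> b0; rewrite /clamp le_max lexx ge_max b0 ge_min lexx. Qed.

Lemma continuous_clamp b : continuous (clamp b).
Proof.
move=> t; rewrite /clamp; apply: (@continuous_max _ _ (fun=> 0) (fun t => Num.min b t)); first exact: cst_continuous.
by apply: (@continuous_min _ _ (fun=> b) id); [exact: cst_continuous|exact: id].
Qed.

End real_calculus.

(** * Derivatives relative to a segment *)

Section derivative_within.
Context {R : realType} {V : normedModType R}.
Implicit Types (a b t : R) (g : R -> V) (d : V).

(** Once multiplied out, the condition also holds at s = t. Derivatives can then be added,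
    restricted and glued by plain estimates, without punctured neighbourhoods. *)
Lemma quot_withinP a b g t d : quot_within a b g t --> d <->
  forall e : R, 0 < e -> exists2 r : R, 0 < r & forall s, a <= s <= b -> `|s - t| < r ->
    `|g s - g t - (s - t) *: d| <= e * `|s - t|.
Proof.
have key e s : s != t ->
    (`|d - (s - t)^-1 *: (g s - g t)| <= e) = (`|g s - g t - (s - t) *: d| <= e * `|s - t|).
  move=> st; have st0 : s - t != 0 by rewrite subr_eq0.
  have -> : g s - g t - (s - t) *: d = - (s - t) *: (d - (s - t)^-1 *: (g s - g t)).
    by rewrite scalerBr scalerA mulNr divff // scaleN1r opprK addrC scaleNr.
  by rewrite normrZ normrN mulrC ler_pM2r // normr_gt0.
split=> [/cvgrPdist_le H e e0|H].
  have /nbhs_ballP[r /= r0 rH] := H _ e0.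
  exists r => // s sab str; have [->|st] := eqVneq s t.
    by rewrite !subrr scale0r subr0 !normr0 mulr0.
  by rewrite -key //; apply: rH => //; rewrite ?in_itv /ball /= distrC.
apply/cvgrPdist_le => e e0; have [r r0 rH] := H _ e0.
apply/nbhs_ballP; exists r => // s; rewrite /ball /= distrC => str st sab.
by rewrite key //; apply: rH => //; rewrite in_itv in sab.
Qed.

(** Same form as [quot_withinP], so that the two notions of derivative differ only in the range of
    [s], and each passes to the other by adjusting the radius. *)
Lemma is_derive_epsP g t d : is_derive t 1 g d <->
  forall e : R, 0 < e -> exists2 r : R, 0 < r & forall s, `|s - t| < r ->
    `|g s - g t - (s - t) *: d| <= e * `|s - t|.
Proof.
have key e h : h != 0 ->
    (`|d - h^-1 *: (g (h + t) - g t)| <= e) = (`|g (h + t) - g t - h *: d| <= e * `|h|).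
  move=> h0.
  have -> : g (h + t) - g t - h *: d = - h *: (d - h^-1 *: (g (h + t) - g t)).
    by rewrite scalerBr scalerA mulNr divff // scaleN1r opprK addrC scaleNr.
  by rewrite normrZ normrN mulrC ler_pM2r // normr_gt0.
have E : is_derive t 1 g d <-> (fun h : R => h^-1 *: (g (h + t) - g t)) @ 0^' --> d.
  have -> : (fun h : R => h^-1 *: (g (h + t) - g t))
          = (fun h : R => h^-1 *: ((g \o shift t) (h *: 1) - g t)).
    by apply: funext => h /=; rewrite -[h *: 1]/(h * 1) mulr1.
  split=> [[dg <-]|H]; first exact: dg.
  by split; [apply: cvgP H|apply: cvg_lim H].
rewrite E; split=> [/cvgrPdist_le H e e0|H].
  have /nbhs_ballP[r /= r0 rH] := H _ e0.
  exists r => // s str; have [->|st] := eqVneq s t.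
    by rewrite !subrr scale0r subr0 !normr0 mulr0.
  have st0 : s - t != 0 by rewrite subr_eq0.
  have := rH (s - t); rewrite /ball /= sub0r normrN => /(_ str st0).
  by rewrite key // subrK.
apply/cvgrPdist_le => e e0; have [r r0 rH] := H _ e0.
apply/nbhs_ballP; exists r => // h; rewrite /ball /= sub0r normrN => hr h0.
by rewrite key //; have := rH (h + t); rewrite addrK; exact.
Qed.

(** A limit is determined only if t is an accumulation point of [a, b]. As a < b, there are nearby
    points of the segment to the right of t when t < b, and to the left when t = b. *)
Lemma quot_within_unique a b g t d : a < b -> a <= t <= b ->
  quot_within a b g t --> d -> derive_within a b g t = d.
Proof.
move=> ab /andP[at_ tb] H; apply: cvg_lim => //.
split; last exact: within_filter.
move=> /nbhs_ballP[r /= r0 rH].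
have [tb'|bt] := ltP t b.
  pose s := Num.min (t + r / 2) b.
  have st : t < s by rewrite lt_min tb' andbT ltrDl divr_gt0.
  apply: (rH s); rewrite ?in_itv /= ?gt_eqF //.
    rewrite /ball /= distrC gtr0_norm ?subr_gt0 // ltrBlDl.
    by rewrite (@le_lt_trans _ _ (t + r / 2)) ?ge_min ?lexx // ltrD2l; lra.
  by rewrite ge_min lexx orbT andbT (le_trans at_) // ltW.
have tE : t = b by apply/eqP; rewrite eq_le tb bt.
pose s := Num.max (t - r / 2) a.
have st : s < t by rewrite gt_max tE ab andbT; lra.
apply: (rH s); rewrite ?in_itv /= ?lt_eqF //.
  rewrite /ball /= gtr0_norm ?subr_gt0 // ltrBlDl -ltrBlDr.
  by rewrite (@lt_le_trans _ _ (t - r / 2)) ?le_max ?lexx //; lra.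
by rewrite le_max lexx orbT /= -tE ltW.
Qed.

Lemma derivable_withinE a b g t : derivable_within a b g t ->
  quot_within a b g t --> derive_within a b g t.
Proof. by []. Qed.

Lemma quot_withinS a b c g t d : c <= b ->
  quot_within a b g t --> d -> quot_within a c g t --> d.
Proof.
move=> cb /quot_withinP H; apply/quot_withinP => e /H[r r0 rH].
exists r => // s /andP[as_ sc]; apply: rH; rewrite as_ /=; exact: le_trans cb.
Qed.

Lemma eq_quot_within a b g g' t d : a <= t <= b ->
  (forall s, a <= s <= b -> g s = g' s) ->
  quot_within a b g t --> d -> quot_within a b g' t --> d.
Proof.
move=> tab gg' /quot_withinP H; apply/quot_withinP => e /H[r r0 rH].
by exists r => // s sab; rewrite -!gg' //; apply: rH.
Qed.

Lemma quot_withinD a b g g' t d d' :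
  quot_within a b g t --> d -> quot_within a b g' t --> d' ->
  quot_within a b (fun s => g s + g' s) t --> d + d'.
Proof.
move=> /quot_withinP H /quot_withinP H'; apply/quot_withinP => e e0.
have e2 : 0 < e / 2 by rewrite divr_gt0.
have [r r0 rH] := H _ e2; have [r' r'0 rH'] := H' _ e2.
exists (Num.min r r'); first by rewrite lt_min r0.
move=> s sab; rewrite lt_min => /andP[sr sr'].
have -> : g s + g' s - (g t + g' t) - (s - t) *: (d + d')
  = (g s - g t - (s - t) *: d) + (g' s - g' t - (s - t) *: d').
  by rewrite scalerDr (opprD (g t)) (addrACA (g s)) (opprD (_ *: d)) (addrACA (g s - g t)).
rewrite (le_trans (ler_normD _ _)) // [leRHS](_ : _ = e / 2 * `|s - t| + e / 2 * `|s - t|).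
  by rewrite lerD ?rH ?rH'.
by rewrite -mulrDl -splitr.
Qed.

Lemma quot_withinN a b g t d :
  quot_within a b g t --> d -> quot_within a b (fun s => - g s) t --> - d.
Proof.
move=> /quot_withinP H; apply/quot_withinP => e /H[r r0 rH].
exists r => // s sab sr; rewrite scalerN -!opprD normrN; exact: rH.
Qed.

Lemma is_derive_quot_within a b g t d : is_derive t 1 g d -> quot_within a b g t --> d.
Proof.
move=> /is_derive_epsP H; apply/quot_withinP => e /H[r r0 rH].
by exists r => // s _; exact: rH.
Qed.

Lemma quot_within_is_derive a b g t d : t \in `]a, b[ ->
  quot_within a b g t --> d -> is_derive t 1 g d.
Proof.
rewrite in_itv /= => /andP[at_ tb] /quot_withinP H; apply/is_derive_epsP => e /H[r r0 rH].
exists (Num.min r (Num.min (t - a) (b - t))); first by rewrite !lt_min r0 !subr_gt0 at_.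
move=> s; rewrite !lt_min => /and3P[sr sa sb]; apply: rH => //.
move: sa sb; rewrite !ltr_norml => /andP[sa _] /andP[_ sb]; apply/andP; split; lra.
Qed.

Lemma derivable_within_C0 a b g :
  (forall t, t \in `[a, b] -> derivable_within a b g t) -> C0_curve a b g.
Proof.
move=> H; apply/subspace_continuousP => t tab.
have tab' : t \in `[a, b] by rewrite in_itv; rewrite /= in_itv in tab.
have /derivable_withinE/quot_withinP/(_ 1 ltr01)[r r0 rH] := H _ tab'.
apply/cvgrPdist_lt => e e0.
set d := derive_within a b g t in rH.
have K0 : 0 < 1 + `|d| by rewrite ltr_pwDl.
apply/nbhs_ballP; exists (Num.min r (e / (1 + `|d|))); first by rewrite /= lt_min r0 divr_gt0.
move=> s; rewrite /ball /= distrC lt_min => /andP[sr se] sab.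
have sab' : a <= s <= b by move: sab; rewrite in_itv.
rewrite distrC; have {}rH := rH s sab' sr.
rewrite -[g s - g t](subrK ((s - t) *: d)) (le_lt_trans (ler_normD _ _)) //.
rewrite (le_lt_trans (lerD rH (lexx _))) //.
by rewrite normrZ mul1r -[X in X + _]mulr1 -mulrDr -ltr_pdivlMr.
Qed.

(** Since [clamp b] maps the line into [0, b], continuity relative to the segment becomes continuity
    on the whole line, which is the form that primitives and fixed points use. *)
Lemma C0_curve_clamp b g : 0 <= b -> C0_curve 0 b g -> continuous (g \o clamp b).
Proof.
move=> b0 /subspace_continuousP H t.
have cb : `[0, b]%classic (clamp b t) by rewrite /= in_itv /= clamp_itv.
have := H _ cb; rewrite /continuous_at /= => {}H; apply: cvg_trans H.
move=> A; rewrite /= /fmap /= => HA.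
have := continuous_clamp (HA : nbhs (clamp b t) _).
apply: (@filterS _ (nbhs t)) => s; apply.
by rewrite /= in_itv /= clamp_itv.
Qed.

Lemma clamp_C0_curve b g h : 0 <= b -> continuous h ->
  (forall t, 0 <= t <= b -> g t = h t) -> C0_curve 0 b g.
Proof.
move=> b0 ch gh; apply: (@subspace_eq_continuous _ _ _ h).
  by move=> t; rewrite inE /= in_itv => /gh.
exact: continuous_subspaceT.
Qed.

End derivative_within.

(** * Uniform Taylor expansions along a compact curve *)

Section matrix_norm.
Context {R : realType}.

Lemma mx_normP p q (M : 'M[R]_(p, q)) (e : R) : 0 <= e ->
  (`|M| <= e) <-> (forall i j, `|M i j| <= e).
Proof.
move=> e0; split=> [H i j|H].
  apply: le_trans H; rewrite [leRHS]/Num.Def.normr /= mx_normrE.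
  exact: (le_bigmax _ (fun ij : 'I_p * 'I_q => `|M ij.1 ij.2|) (i, j)).
rewrite [leLHS]/Num.Def.normr /= mx_normrE; apply/bigmax_leP; split => // -[i j] _; exact: H.
Qed.

Lemma ler_norm_entry p q (M : 'M[R]_(p, q)) i j : `|M i j| <= `|M|.
Proof. by move: i j; apply/mx_normP. Qed.

Lemma ler_norm_mulmx p q s (M : 'M[R]_(p, q)) (M' : 'M[R]_(q, s)) :
  `|M *m M'| <= q%:R * (`|M| * `|M'|).
Proof.
apply/mx_normP; first by rewrite mulr_ge0 // mulr_ge0.
move=> i j; rewrite mxE (le_trans (ler_norm_sum _ _ _)) //.
rewrite (le_trans (ler_sum _ (G := fun=> `|M| * `|M'|) _)) //.
  by move=> k _; rewrite normrM ler_pM ?ler_norm_entry.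
by rewrite sumr_const card_ord mulr_natl.
Qed.

Lemma ler_norm_tr p q (M : 'M[R]_(p, q)) : `|M^T| <= `|M|.
Proof. by apply/mx_normP => // i j; rewrite mxE ler_norm_entry. Qed.

Lemma continuous_mxP p q (T : topologicalType) (M : T -> 'M[R]_(p, q)) t :
  {for t, continuous M} <-> (forall i j, {for t, continuous (fun x => M x i j)}).
Proof.
split=> [cM i j|cM].
  apply: (@continuous_comp _ _ _ M (fun N : 'M[R]_(p, q) => N i j)) => //.
  exact: coord_continuous.
apply/cvgrPdist_le => /= e e0; near=> x.
apply/mx_normP => [|i j]; first exact: ltW.
rewrite !mxE; move: i j; suff: forall ij : 'I_p * 'I_q, `|M t ij.1 ij.2 - M x ij.1 ij.2| <= e.
  by move=> + i j => /(_ (i, j)).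
near: x; apply: filter_forall => -[i j] /=.
by have /cvgrPdist_le := cM i j; exact.
Unshelve. all: by end_near. Qed.

Lemma is_derive_mxP p q (M : R -> 'M[R]_(p, q)) (t : R) (d : 'M[R]_(p, q)) :
  is_derive t 1 M d <-> (forall i j, is_derive t 1 (fun x => M x i j) (d i j)).
Proof.
split=> [[dM <-] i j|H].
  split; first by move: i j; apply/derivable_mxP.
  by rewrite derive_mx // mxE.
have dM : derivable M t 1 by apply/derivable_mxP => i j; exact: ex_derive.
by split => //; rewrite derive_mx //; apply/matrixP => i j; rewrite mxE derive_val.
Qed.

Lemma continuous_bigsum (T : topologicalType) (W : normedModType R) (I : Type) (r : seq I)
    (F : I -> T -> W) t : (forall i, {for t, continuous (F i)}) ->
  {for t, continuous (fun x => \sum_(i <- r) F i x)}.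
Proof.
move=> cF; elim: r => [|i r IH].
  rewrite (_ : (fun x => _) = (fun=> 0)); first exact: cvg_cst.
  by apply: funext => x; rewrite big_nil.
rewrite (_ : (fun x => _) = (fun x => F i x + \sum_(i <- r) F i x)).
  by apply: cvgD; [exact: cF|exact: IH].
by apply: funext => x; rewrite big_cons.
Qed.

Lemma is_derive_mulmx p q s (M : R -> 'M[R]_(p, q)) (M' : R -> 'M[R]_(q, s)) (t : R) d d' :
  is_derive t 1 M d -> is_derive t 1 M' d' ->
  is_derive t 1 (fun x => M x *m M' x) (d *m M' t + M t *m d').
Proof.
move=> /is_derive_mxP dM /is_derive_mxP dM'; apply/is_derive_mxP => i j.
have -> : (fun x => (M x *m M' x) i j) = \sum_(k < q) (fun x => M x i k * M' x k j).
  by apply: funext => x; rewrite mxE fct_sumE.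
rewrite !mxE -big_split /=; apply: is_derive_sum => k.
have ? := dM i k; have ? := dM' k j.
apply: (is_derive_eq (is_deriveM (f := fun x => M x i k) (g := fun x => M' x k j) _ _)).
rewrite addrC -[_ *: d i k]/(M' t k j * d i k) -[_ *: d' k j]/(M t i k * d' k j).
by rewrite [M' t k j * _]mulrC.
Qed.

Lemma continuous_mulmx p q s (T : topologicalType) (M : T -> 'M[R]_(p, q))
    (M' : T -> 'M[R]_(q, s)) t :
  {for t, continuous M} -> {for t, continuous M'} -> {for t, continuous (fun x => M x *m M' x)}.
Proof.
move=> /continuous_mxP cM /continuous_mxP cM'; apply/continuous_mxP => i j.
have -> : (fun x => (M x *m M' x) i j) = (fun x => \sum_(k < q) M x i k * M' x k j).
  by apply: funext => x; rewrite mxE.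
apply: (continuous_bigsum (W := R^o)) => k; apply: cvgM; [exact: cM|exact: cM'].
Qed.

End matrix_norm.

Section uniform_taylor.
Context {R : realType} {V : normedModType R} {N : nat} (E : 'I_N -> V).

(** Increments are parametrised by coordinate rows because [V], in the application a product of
    spaces of row vectors, is not itself a space of rows. *)
Definition lincomb (d : 'rV[R]_N) : V := \sum_k d 0 k *: E k.

Lemma lincomb0 : lincomb 0 = 0.
Proof. by rewrite /lincomb big1 // => k _; rewrite mxE scale0r. Qed.

Lemma lincombD d d' : lincomb (d + d') = lincomb d + lincomb d'.
Proof. by rewrite /lincomb -big_split; apply: eq_bigr => k _; rewrite mxE scalerDl. Qed.

Lemma lincombZ c d : lincomb (c *: d) = c *: lincomb d.
Proof. by rewrite /lincomb scaler_sumr; apply: eq_bigr => k _; rewrite mxE scalerA. Qed.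

Lemma derive_lincomb (g : V -> R) x d : differentiable g x ->
  'D_(lincomb d) g x = \sum_k d 0 k * 'D_(E k) g x.
Proof.
move=> dg; rewrite deriveE // linear_sum; apply: eq_bigr => k _.
by rewrite linearZ deriveE.
Qed.

Lemma is_derive_line (g : V -> R) x v (s : R) : differentiable g (x + s *: v) ->
  is_derive s 1 (fun r : R => g (x + r *: v)) ('D_v g (x + s *: v)).
Proof.
move=> dg; have H : (fun h : R => h^-1 *: (((fun r : R => g (x + r *: v)) \o shift s) (h *: 1) - g (x + s *: v)))
  = (fun h : R => h^-1 *: ((g \o shift (x + s *: v)) (h *: v) - g (x + s *: v))).
  by apply: funext => h /=; rewrite -[h *: 1]/(h * 1) mulr1 scalerDl addrCA addrA.
by split; rewrite /derivable /derive H; [exact: diff_derivable|].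
Qed.

Context (D : set V) (oD : open D) (T : R) (z : R -> V) (cz : continuous z)
  (zD : forall t, D (z t)) (normE : forall d, `|lincomb d| <= `|d|).

(** Compactness of [0, T], as a covering property for the filter of small radii, gives one radius
    for all t, although [x] need not lie on the curve. Stating it with [\near] lets several such
    conditions be met by a single r. *)
Lemma near_uniform_continuous (W : normedModType R) (g : V -> W) :
  (forall x, D x -> {for x, continuous g}) -> forall e : R, 0 < e ->
  \forall r \near 0^'+, forall t, 0 <= t <= T -> forall x, `|x - z t| <= r ->
    D x /\ `|g x - g (z t)| <= e.
Proof.
move=> cg e e0.
have := (compact_near_coveringP `[0, T]%classic).1 (@segment_compact _ 0 T).
move=> /(_ R (0^'+) (fun r t => forall x, `|x - z t| <= r -> D x /\ `|g x - g (z t)| <= e) _).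
move=> /(_ _)[|r /= r0 rH].
  move=> t0 _.
  have e2 : 0 < e / 2 by rewrite divr_gt0.
  have D1 : \forall x \near z t0, D x /\ `|g (z t0) - g x| < e / 2.
    apply: filterI; first exact: open_nbhs_nbhs.
    by have /cvgrPdist_lt := cg _ (zD t0); exact.
  have /nbhs_ballP[p /= p0 pH] := D1.
  (* Half of the radius is spent on moving t, the other half on the distance from [x] to [z t]. *)
  have p2 : 0 < p / 2 by rewrite divr_gt0.
  have zt : \forall t \near t0, `|z t0 - z t| < p / 2.
    by have /cvgrPdist_lt := @cz t0; exact.
  near=> t r => x xt.
  have zt0 : `|z t0 - z t| < p / 2 by near: t; exact: zt.
  have rp : r < p / 2 by near: r; exact: nbhs_right_lt.
  have bx : ball (z t0) p x.
    rewrite -ball_normE /= -(subrKA (z t)) (splitr p) (le_lt_trans (ler_normD _ _)) //.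
    by rewrite ltrD // distrC (le_lt_trans xt).
  have bz : ball (z t0) p (z t).
    by rewrite -ball_normE /= (lt_trans zt0) // ltr_pdivrMr // ltr_pMr // ltr1n.
  have [Dx gx] := pH _ bx; have [_ gz] := pH _ bz; split => //.
  rewrite -(subrKA (g (z t0))) (splitr e) (le_trans (ler_normD _ _)) //.
  by rewrite lerD // ltW // distrC.
by exists r => // s sr s0 t /andP[t0 tT]; apply: rH; rewrite //= in_itv /= t0.
Unshelve. all: by end_near. Qed.

Lemma near_uniform_domain :
  \forall r \near 0^'+, forall t, 0 <= t <= T -> forall x, `|x - z t| <= r -> D x.
Proof.
have cst0 : forall x : V, D x -> {for x, continuous (fun=> 0 : R^o)}.
  by move=> x _; exact: cst_continuous.
have := near_uniform_continuous cst0 ltr01.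
by apply: filterS => r H t tT x /(H t tT)[].
Qed.

Lemma Ck_on_differentiable (W : normedModType R) k (g : V -> W) : Ck_on k.+1 D g ->
  forall x, D x -> differentiable g x.
Proof. by case. Qed.

Lemma Ck_onW (W : normedModType R) k (g : V -> W) : Ck_on k.+1 D g -> Ck_on k D g.
Proof.
elim: k g => [|k IH] g [dg Dg].
  by move=> x Dx; apply: differentiable_continuous; exact: dg.
by split=> // v; apply: IH.
Qed.

(** Mean value theorem on the segment from d' to d, where each partial derivative is within e' of
    its value on the curve. The error is proportional to |d - d'|, not to |d|: this makes the
    nonlinear part of f a contraction later. *)
Lemma near_uniform_diff (g : V -> R) : Ck_on 1 D g -> forall e : R, 0 < e ->
  \forall r \near 0^'+, forall t, 0 <= t <= T -> forall d d' : 'rV[R]_N,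
    `|d| <= r -> `|d'| <= r ->
    `|g (z t + lincomb d) - g (z t + lincomb d') -
      \sum_k (d 0 k - d' 0 k) * 'D_(E k) g (z t)| <= e * `|d - d'|.
Proof.
move=> [dg Dg] e e0.
(* One share of the error per coordinate; [N.+1] keeps the quotient meaningful for N = 0. *)
pose e' := e / N.+1%:R.
have e'0 : 0 < e' by rewrite divr_gt0 // ltr0n.
have H : \forall r \near 0^'+, forall k : 'I_N, forall t, 0 <= t <= T -> forall x, `|x - z t| <= r ->
    D x /\ `|'D_(E k) g x - 'D_(E k) g (z t)| <= e'.
  by apply: filter_forall => k; apply: near_uniform_continuous e'0 => x; exact: Dg.
have H0 := near_uniform_domain.
near=> r => t tT d d' dr dr'.
pose v := lincomb (d - d').
have near_pt s : 0 <= s <= 1 -> `|z t + lincomb d' + s *: v - z t| <= r.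
  move=> /andP[s0 s1].
  rewrite addrAC [z t + _]addrC addrK /v -lincombZ -lincombD (le_trans (normE _)) //.
  have -> : d' + s *: (d - d') = s *: d + (1 - s) *: d'.
    by apply/rowP => i; rewrite !mxE; ring.
  rewrite (le_trans (ler_normD _ _)) // !normrZ ger0_norm // ger0_norm ?subr_ge0 //.
  rewrite [leRHS](_ : _ = s * r + (1 - s) * r); last by ring.
  by rewrite lerD // ler_wpM2l // subr_ge0.
have D0 x : `|x - z t| <= r -> D x.
  have H0r : forall t, 0 <= t <= T -> forall x, `|x - z t| <= r -> D x by near: r.
  exact: H0r.
have dphi (s : R) : 0 <= s <= 1 ->
    is_derive s 1 (fun r : R => g (z t + lincomb d' + r *: v)) ('D_v g (z t + lincomb d' + s *: v)).
  by move=> s01; apply: is_derive_line; apply: dg; apply: D0; exact: near_pt.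
have [||c] := @MVT _ (fun r : R => g (z t + lincomb d' + r *: v))
   (fun s => 'D_v g (z t + lincomb d' + s *: v)) 0 1 ltr01.
- by move=> s; rewrite in_itv => /andP[/ltW s0 /ltW s1]; apply: dphi; rewrite s0.
- apply: within_continuous => s; rewrite in_itv => s01.
  by apply/differentiable_continuous/derivable1_diffP; have ? := dphi _ s01; exact: ex_derive.
rewrite in_itv => /andP[/ltW c0 /ltW c1].
have -> : z t + lincomb d' + 1 *: v = z t + lincomb d.
  by rewrite scale1r /v -addrA -lincombD [d' + _]addrC subrK.
rewrite scale0r addr0 subr0 mulr1 => ->.
have c01 : 0 <= c <= 1 by rewrite c0.
rewrite derive_lincomb; last by apply: dg; apply: D0; exact: near_pt.
rewrite -sumrB (le_trans (ler_norm_sum _ _ _)) //.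
rewrite (le_trans (ler_sum _ (G := fun=> `|d - d'| * e') _)) //.
  move=> k _; rewrite mxE [(- d') 0 k]mxE -mulrBr normrM ler_pM //.
    by have := ler_norm_entry (d - d') 0 k; rewrite mxE [(- d') 0 k]mxE.
  have Hk : forall k : 'I_N, forall t, 0 <= t <= T -> forall x, `|x - z t| <= r ->
    D x /\ `|'D_(E k) g x - 'D_(E k) g (z t)| <= e' by near: r.
  by have [] := Hk k t tT _ (near_pt c c01).
rewrite sumr_const card_ord -mulr_natr [leLHS](_ : _ = (e' * N%:R) * `|d - d'|); last by ring.
by rewrite ler_wpM2r // mulrAC ler_pdivrMr ?ltr0n // ler_wpM2l ?ler_nat // ltW.
Unshelve. all: by end_near. Qed.

(** Subtracting the Taylor polynomial along the ray and applying the mean value theorem once leaves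
    the first order remainders of the partial derivatives, already bounded by [near_uniform_diff].
    Class C^2 thus suffices for an o(|d|^2) error. *)
Lemma near_uniform_diff2 (g : V -> R) : Ck_on 2 D g -> forall e : R, 0 < e ->
  \forall r \near 0^'+, forall t, 0 <= t <= T -> forall d : 'rV[R]_N, `|d| <= r ->
    `|g (z t + lincomb d) - g (z t) - \sum_k d 0 k * 'D_(E k) g (z t)
     - 2^-1 * \sum_k d 0 k * (\sum_l d 0 l * 'D_(E l) ('D_(E k) g) (z t))| <= e * `|d| ^+ 2.
Proof.
move=> [dg Dg] e e0.
pose e' := e / N.+1%:R.
have e'0 : 0 < e' by rewrite divr_gt0 // ltr0n.
have H : \forall r \near 0^'+, forall k : 'I_N, forall t, 0 <= t <= T -> forall d d' : 'rV[R]_N,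
    `|d| <= r -> `|d'| <= r ->
    `|'D_(E k) g (z t + lincomb d) - 'D_(E k) g (z t + lincomb d') -
      \sum_l (d 0 l - d' 0 l) * 'D_(E l) ('D_(E k) g) (z t)| <= e' * `|d - d'|.
  by apply: filter_forall => k; apply: near_uniform_diff e'0.
have H0 := near_uniform_domain.
near=> r => t tT d dr.
have D0 x : `|x - z t| <= r -> D x.
  have H0r : forall t, 0 <= t <= T -> forall x, `|x - z t| <= r -> D x by near: r.
  exact: H0r.
have Dpt s : 0 <= s <= 1 -> D (z t + s *: lincomb d).
  move=> /andP[s0 s1]; apply: D0; rewrite addrAC subrr add0r normrZ ger0_norm //.
  by rewrite (le_trans _ dr) // (le_trans _ (normE _)) // ler_piMl.
set S1 := \sum_k d 0 k * 'D_(E k) g (z t).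
set S2 := \sum_k d 0 k * _.
(* [phi 1 - phi 0] is the quantity to be bounded, and [dphi c] is a sum of first order remainders at
   the point c d. *)
pose phi (s : R) := g (z t + s *: lincomb d) - s * S1 - s * (s * (2^-1 * S2)).
pose dphi (s : R) := 'D_(lincomb d) g (z t + s *: lincomb d) - S1 - s * S2.
have dphiP (s : R) : 0 <= s <= 1 -> is_derive s 1 phi (dphi s).
  move=> s01; have ? := is_derive_line (dg _ (Dpt s s01)).
  have D1 c : is_derive s 1 (fun s => s * c) c.
    apply: (is_derive_eq (is_deriveM (f := id) (g := cst c) _ _)).
    by rewrite scaler0 add0r -[_ *: _]/(c * 1) mulr1.
  have D2 c : is_derive s 1 (fun s => s * (s * c)) (s * (2 * c)).
    have ? := D1 c.
    apply: (is_derive_eq (is_deriveM (f := id) (g := fun s => s * c) _ _)).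
    by rewrite -[_ *: c]/(s * c) -[_ *: _]/((s * c) * 1); ring.
  have -> : dphi s = 'D_(lincomb d) g (z t + s *: lincomb d) - S1 - s * (2 * (2^-1 * S2)).
    by rewrite mulVKf.
  by apply: is_deriveB; apply: is_deriveB.
have [||c] := @MVT _ phi dphi 0 1 ltr01.
- by move=> s; rewrite in_itv => /andP[/ltW s0 /ltW s1]; apply: dphiP; rewrite s0.
- apply: within_continuous => s; rewrite in_itv => s01.
  by apply/differentiable_continuous/derivable1_diffP; have ? := dphiP _ s01; exact: ex_derive.
rewrite in_itv => /andP[/ltW c0 /ltW c1].
have c01 : 0 <= c <= 1 by rewrite c0.
rewrite subr0 mulr1 /phi !mul0r scale0r addr0 !subr0 scale1r !mul1r => Ec.
rewrite [X in `|X|](_ : _ = dphi c); last by rewrite -Ec; ring.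
rewrite /dphi derive_lincomb; last by apply: dg; exact: Dpt.
rewrite /S1 /S2 -sumrB mulr_sumr -sumrB (le_trans (ler_norm_sum _ _ _)) //.
rewrite (le_trans (ler_sum _ (G := fun=> `|d| * (e' * `|d|)) _)) //.
  move=> k _; rewrite -mulrBr [c * _]mulrCA -mulrBr normrM ler_pM ?ler_norm_entry //.
  have Hk : forall k : 'I_N, forall t, 0 <= t <= T -> forall d d' : 'rV[R]_N,
    `|d| <= r -> `|d'| <= r ->
    `|'D_(E k) g (z t + lincomb d) - 'D_(E k) g (z t + lincomb d') -
      \sum_l (d 0 l - d' 0 l) * 'D_(E l) ('D_(E k) g) (z t)| <= e' * `|d - d'| by near: r.
  have r0 : 0 <= r by exact: le_trans dr.
  have cd : `|c *: d| <= `|d| by rewrite normrZ ger0_norm // ler_piMl.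
  have := Hk k t tT (c *: d) 0 (le_trans cd dr); rewrite normr0 => /(_ r0).
  rewrite subr0 lincombZ lincomb0 addr0.
  move=> Hc; rewrite mulr_sumr.
  rewrite (eq_bigr (fun l => ((c *: d) 0 l - (0 : 'rV[R]_N) 0 l) * 'D_(E l) ('D_(E k) g) (z t))).
    by rewrite (le_trans Hc) // ler_wpM2l // ltW.
  by move=> l _; rewrite !mxE subr0 mulrA.
rewrite sumr_const card_ord -mulr_natr expr2 [leLHS](_ : _ = (e' * N%:R) * (`|d| * `|d|)); last by ring.
by rewrite ler_wpM2r ?mulr_ge0 // mulrAC ler_pdivrMr ?ltr0n // ler_wpM2l ?ler_nat // ltW.
Unshelve. all: by end_near. Qed.

End uniform_taylor.

(** * Fixed points and linear differential equations *)

Section matrix_primitive.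
Context {R : realType}.

Definition mprim p q (h : R -> 'M[R]_(p, q)) (t : R) : 'M[R]_(p, q) :=
  \matrix_(i, j) prim (fun s => h s i j) t.

Lemma mprim0 p q (h : R -> 'M[R]_(p, q)) : mprim h 0 = 0.
Proof. by apply/matrixP => i j; rewrite !mxE prim0. Qed.

Lemma continuous_entry p q (h : R -> 'M[R]_(p, q)) i j : continuous h -> continuous (fun s => h s i j).
Proof. by move=> ch t; move: i j; apply/continuous_mxP; exact: ch. Qed.

Lemma is_derive_mprim p q (h : R -> 'M[R]_(p, q)) (t : R) : continuous h -> 0 <= t ->
  is_derive t 1 (mprim h) (h t).
Proof.
move=> ch t0; apply/is_derive_mxP => i j.
have -> : (fun x => mprim h x i j) = prim (fun s => h s i j).
  by apply: funext => x; rewrite mxE.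
apply: (@is_derive_prim _ (fun s => h s i j)) => //; exact: continuous_entry.
Qed.

Lemma continuous_mprim p q (h : R -> 'M[R]_(p, q)) (t : R) : continuous h -> 0 <= t ->
  {for t, continuous (mprim h)}.
Proof.
move=> ch t0; have ? := is_derive_mprim ch t0.
by apply/differentiable_continuous/derivable1_diffP; exact: ex_derive.
Qed.

Lemma ler_norm_mprim p q (h : R -> 'M[R]_(p, q)) (k : R -> R) b : continuous h ->
  continuous k -> 0 <= b -> (forall t, 0 <= t <= b -> `|h t| <= k t) ->
  `|mprim h b| <= prim k b.
Proof.
move=> ch ck b0 hk.
have k0 : 0 <= prim k b.
  rewrite -(mul0r b) -(prim_cst 0 b0) prim_le //; first by move=> t; exact: cst_continuous.
  by move=> t /hk; apply: le_trans.
apply/mx_normP => // i j; rewrite mxE ler_norm_prim //; first exact: continuous_entry.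
by move=> t /hk; apply: le_trans; exact: ler_norm_entry.
Qed.

Lemma mprim_unique p q (h F : R -> 'M[R]_(p, q)) b : continuous h -> 0 <= b ->
  {within `[0, b], continuous F} ->
  (forall t, t \in `]0, b[ -> is_derive t 1 F (h t)) ->
  F b = F 0 + mprim h b.
Proof.
move=> ch b0 cF dF; apply/matrixP => i j; rewrite !mxE.
suff -> : prim (fun s => h s i j) b = F b i j - F 0 i j by rewrite addrC subrK.
apply: (@prim_unique _ _ (fun t => F t i j)) => //.
- exact: continuous_entry.
- by move=> x; move: i j; apply/continuous_mxP; exact: cF.
- by move=> t /dF /is_derive_mxP.
Qed.

Lemma interior_quot_within p q (h F : R -> 'M[R]_(p, q)) b t : continuous h ->
  {within `[0, b], continuous F} ->
  (forall t, t \in `]0, b[ -> is_derive t 1 F (h t)) -> 0 <= t <= b ->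
  quot_within 0 b F t --> h t.
Proof.
move=> ch cF dF tb.
apply: (eq_quot_within (g := fun s => F 0 + mprim h s)) => // [s /andP[s0 sb]|].
  have cFs : {within `[0, s], continuous F}.
    by apply: continuous_subspaceW cF; apply: subset_itvl; rewrite bnd_simp.
  have dFs r : r \in `]0, s[ -> is_derive r 1 F (h r).
    rewrite in_itv /= => /andP[r0 rs]; apply: dF.
    by rewrite in_itv /= r0 (lt_le_trans rs).
  exact: (esym (mprim_unique ch s0 cFs dFs)).
apply: is_derive_quot_within; rewrite -[h t]add0r; apply: is_deriveD.
by apply: is_derive_mprim => //; case/andP: tb.
Qed.

Lemma mprimB p q (h k : R -> 'M[R]_(p, q)) t : continuous h -> continuous k -> 0 <= t ->
  mprim (fun s => h s - k s) t = mprim h t - mprim k t.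
Proof.
move=> ch ck t0; apply/matrixP => i j; rewrite !mxE.
have -> : prim (fun s => h s i j) t = prim (fun s => (h s - k s) i j) t + prim (fun s => k s i j) t.
  rewrite -primD //.
  - by congr (prim _ t); apply: funext => s /=; rewrite !mxE subrK.
  - by apply: continuous_entry => s; apply: cvgB; [exact: ch|exact: ck].
  - exact: continuous_entry.
by rewrite addrK.
Qed.

Lemma continuous_bounded p q (M : R -> 'M[R]_(p, q)) (T : R) : 0 < T -> continuous M ->
  exists2 K : R, 0 <= K & forall t, 0 <= t <= T -> `|M t| <= K.
Proof.
move=> T0 cM; have cn : {within `[0, T], continuous (fun t => `|M t|)}.
  by apply: within_continuous => t _; apply: cvg_norm; exact: cM.
have [t0 _ H] := EVT_max (ltW T0) cn.
by exists `|M t0| => // t tT; apply: H; rewrite in_itv.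
Qed.

End matrix_primitive.

Section fixed_point.
Context {R : realType} {p q : nat}.
Implicit Types y : R -> 'M[R]_(p, q).

Lemma uniform_limit_continuous y :
  (forall e : R, 0 < e -> exists2 y' : R -> 'M[R]_(p, q), continuous y' & forall t, `|y t - y' t| <= e) ->
  continuous y.
Proof.
move=> H t; apply/cvgrPdist_le => e e0.
have e3 : 0 < e / 3 by rewrite divr_gt0.
have [y' cy' yy'] := H _ e3.
have /cvgrPdist_le/(_ _ e3) := cy' t; apply: filterS => s ys.
rewrite -(subrKA (y' t)) (le_trans (ler_normD _ _)) //.
rewrite -[y' t - y s](subrKA (y' s)).
rewrite (le_trans (lerD (yy' t) (ler_normD _ _))) //.
rewrite [leRHS](_ : _ = e / 3 + (e / 3 + e / 3)); last by field.
by rewrite lerD // lerD // distrC.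
Qed.

(* A contraction for the norm [sup |y| / w]: an exponential weight makes the
   integral operator of a linear equation contract on any interval. *)
Lemma weighted_fixed_point (P : set (R -> 'M[R]_(p, q)))
    (G : (R -> 'M[R]_(p, q)) -> R -> 'M[R]_(p, q)) (w : R -> R) (W M0 : R) y0 :
  (forall t, 0 <= w t <= W) ->
  P y0 -> (forall y, P y -> P (G y)) ->
  (forall y, (forall e : R, 0 < e -> exists2 y', P y' & forall t, `|y t - y' t| <= e) -> P y) ->
  0 <= M0 -> (forall t, `|G y0 t - y0 t| <= M0 * w t) ->
  (forall y y', P y -> P y' -> forall M : R, 0 <= M ->
    (forall t, `|y t - y' t| <= M * w t) -> forall t, `|G y t - G y' t| <= M / 2 * w t) ->
  exists2 y, P y & forall t, G y t = y t.
Proof.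
move=> wW Py0 PG Pcl M00 H0 H.
pose Y k := iter k G y0.
have PY k : P (Y k) by elim: k => //= k; exact: PG.
pose M k : R := M0 / 2 ^+ k.
have Mge k : 0 <= M k by rewrite divr_ge0 // exprn_ge0.
have step k t : `|Y k.+1 t - Y k t| <= M k * w t.
  elim: k t => [t|k IH t]; first by rewrite /M expr0 divr1; exact: H0.
  rewrite /M exprSr invfM mulrA; exact: (H _ _ (PY k.+1) (PY k) _ (Mge k) IH).
(* Geometric series: the sum of M i over k <= i < k + j is 2 M k - 2 M (k + j). *)
have dist k j t : `|Y (k + j)%N t - Y k t| <= (2 * M k - 2 * M (k + j)%N) * w t.
  elim: j => [|j IH]; first by rewrite addn0 !subrr normr0 mul0r.
  rewrite addnS -(subrKA (Y (k + j)%N t)) (le_trans (ler_normD _ _)) //.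
  rewrite (le_trans (lerD (step _ _) IH)) // -mulrDl.
  apply: ler_wpM2r; first by case/andP: (wW t).
  have -> : M (k + j).+1 = M (k + j)%N / 2 by rewrite /M exprSr invfM mulrA.
  lra.
have bound k j t : `|Y (k + j)%N t - Y k t| <= 2 * M k * W.
  rewrite (le_trans (dist _ _ _)) //; have /andP[w0 wW'] := wW t.
  apply: ler_pM => //; last by rewrite gerBl mulr_ge0.
  have : `|Y (k + j)%N t - Y k t| <= _ := dist k j t.
  by rewrite -mulrBr mulr_ge0 // subr_ge0 /M exprD invfM mulrA ler_piMr ?Mge // invf_le1 ?exprn_gt0 // exprn_ege1 // ler1n.
have W0 : 0 <= W by have /andP[w0 ww] := wW 0; exact: le_trans ww.
have small (e : R) : 0 < e -> exists k, forall j, (k <= j)%N -> 2 * M j * W <= e.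
  move=> e0.
  have : (fun k => 2 * W * M0 * (2^-1) ^+ k) @ \oo --> (2 * W * M0 * 0 : R).
    apply: cvgMr; apply: cvg_expr; rewrite ger0_norm //; lra.
  rewrite mulr0 => /cvgrPdist_le/(_ _ e0)[k _ kH]; exists k => j kj.
  have := kH j kj; rewrite sub0r normrN; apply: le_trans.
  rewrite (le_trans _ (ler_norm _)) // /M exprVn; lra.
have cv t i j : cvgn (fun k => Y k t i j).
  apply/cauchy_cvgP/cauchy_exP => e e0.
  have e2 : 0 < e / 2 by rewrite divr_gt0.
  have [k kH] := small _ e2; exists (Y k t i j); exists k => // l /= kl.
  rewrite -ball_normE /= distrC.
  have := ler_norm_entry (Y l t - Y k t) i j; rewrite !mxE => /le_lt_trans; apply.
  rewrite -(subnKC kl) (le_lt_trans (bound _ _ _)) // (le_lt_trans (kH _ (leqnn _))) //.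
  by rewrite ltr_pdivrMr // ltr_pMr // ltr1n.
(* The limit is taken entry by entry, where completeness of R applies. *)
pose y t : 'M[R]_(p, q) := \matrix_(i, j) limn (fun k => Y k t i j).
have lim k t : `|y t - Y k t| <= 2 * M k * w t.
  have w0 : 0 <= w t by case/andP: (wW t).
  apply/mx_normP; first by rewrite !mulr_ge0.
  move=> i j; rewrite !mxE.
  have C : (fun l => `|Y l t i j - Y k t i j|) @ \oo --> `|limn (fun k => Y k t i j) - Y k t i j|.
    by apply: cvg_norm; apply: cvgB; [exact: cv|exact: cvg_cst].
  rewrite -(cvg_lim _ C) //; apply: limr_le; first exact: cvgP C.
  exists k => // l /= kl; have := dist k (l - k)%N t; rewrite subnKC // => Dl.
  have := ler_norm_entry (Y l t - Y k t) i j; rewrite !mxE => /le_trans; apply.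
  rewrite (le_trans Dl) // ler_wpM2r // gerBl mulr_ge0 //.
have limW k t : `|y t - Y k t| <= 2 * M k * W.
  rewrite (le_trans (lim k t)) // ler_wpM2l ?mulr_ge0 //; by case/andP: (wW t).
have Py : P y.
  apply: Pcl => e /small[k kH]; exists (Y k) => // t.
  exact: le_trans (limW k t) (kH _ (leqnn _)).
exists y => // t; apply/eqP; rewrite -subr_eq0 -normr_le0; apply/ler_addgt0Pr => e e0; rewrite add0r.
(* Since [Y k.+1 = G (Y k)], both [G y] and [y] are within e / 2 of [Y k.+1]. *)
have e2 : 0 < e / 2 by rewrite divr_gt0.
have [k kH] := small _ e2.
rewrite -(subrKA (Y k.+1 t)) (le_trans (ler_normD _ _)) // (splitr e) lerD //.
  have := H _ _ Py (PY k) (2 * M k) _ (lim k) t; rewrite mulr_ge0 // => /(_ isT) /le_trans; apply.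
  rewrite (le_trans _ (kH k (leqnn _))) // ler_pM // ?divr_ge0 ?mulr_ge0 //.
  - by case/andP: (wW t).
  - by rewrite ler_pdivrMr // ler_peMr ?mulr_ge0 // ler1n.
  - by case/andP: (wW t).
rewrite distrC (le_trans (limW _ _)) // kH //.
Qed.

End fixed_point.

Section linear_ode.
Context {R : realType}.

Lemma linear_ode p N (A : R -> 'M[R]_N) (Y0 : 'M[R]_(p, N)) (T KA : R) :
  0 <= T -> continuous A -> (forall t, `|A t| <= KA) ->
  exists Y : R -> 'M[R]_(p, N), [/\ continuous Y, Y 0 = Y0 &
    forall t, t \in `]0, T[ -> is_derive t 1 Y (Y t *m A t)].
Proof.
move=> T0 cA AK.
have KA0 : 0 <= KA by exact: le_trans (AK 0).
pose K := N%:R * KA + 1.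
have K0 : 0 < K by rewrite ltr_wpDl // mulr_ge0.
(* With rate 2 K the integral of K M w0 from 0 to t is M / 2 times w0 t - 1, whence the contraction
   factor 1 / 2 whatever the length T. *)
pose w0 (s : R) := expR (2 * K * s).
have cw0 : continuous w0.
  move=> s; apply: (@continuous_comp _ _ _ (fun s => 2 * K * s) expR); last exact: continuous_expR.
  by apply: (@continuousM _ _ (fun=> 2 * K) id); [exact: cst_continuous|exact: id].
pose w t := w0 (clamp T t).
have ci t : 0 <= clamp T t <= T by exact: clamp_itv.
have c0 t : 0 <= clamp T t by case/andP: (ci t).
(* Integrating up to [clamp T t] freezes the iterates outside [0, T], so that all bounds hold on the
   whole line. *)
pose G (y : R -> 'M[R]_(p, N)) t := Y0 + mprim (fun s => y s *m A s) (clamp T t).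
have cyA (y : R -> 'M[R]_(p, N)) : continuous y -> continuous (fun s => y s *m A s).
  by move=> cy t; apply: continuous_mulmx; [exact: cy|exact: cA].
have cG (y : R -> 'M[R]_(p, N)) : continuous y -> continuous (G y).
  move=> cy t; apply: (@continuousD _ _ _ (fun=> Y0) (fun t => mprim (fun s => y s *m A s) (clamp T t))).
    exact: cst_continuous.
  apply: (@continuous_comp _ _ _ (clamp T) (mprim (fun s => y s *m A s))).
    exact: continuous_clamp.
  by apply: continuous_mprim => //; exact: cyA.
have contr (y y' : R -> 'M[R]_(p, N)) : continuous y -> continuous y' -> forall M : R, 0 <= M ->
    (forall t, `|y t - y' t| <= M * w t) -> forall t, `|G y t - G y' t| <= M / 2 * w t.
  move=> cy cy' M M0 H t.
  have cD : continuous (fun s => (y s - y' s) *m A s).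
    by apply: (cyA (fun s => y s - y' s)) => s; apply: continuousB; [exact: cy|exact: cy'].
  have -> : G y t - G y' t = mprim (fun s => (y s - y' s) *m A s) (clamp T t).
    rewrite /G opprD addrACA subrr add0r -(mprimB (cyA y cy) (cyA y' cy') (c0 t)).
    by congr (mprim _ _); apply: funext => s; rewrite mulmxBl.
  have cMw (c : R) : continuous (fun s => c * w0 s).
    by move=> s; apply: (@continuousM _ _ (fun=> c) w0); [exact: cst_continuous|exact: cw0].
  apply: (@le_trans _ _ (prim (fun s => K * M * w0 s) (clamp T t))).
    apply: ler_norm_mprim => //.
    move=> s /andP[s0 st].
    have sT : 0 <= s <= T by rewrite s0 (le_trans st) //; case/andP: (ci t).
    rewrite (le_trans (ler_norm_mulmx _ _)) //.
    have := H s; rewrite /w clamp_id // => Hs.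
    rewrite [leRHS](_ : _ = (M * w0 s) * K); last by ring.
    rewrite mulrCA ler_pM ?mulr_ge0 // /K (@le_trans _ _ (N%:R * KA)) ?lerDl //.
    by rewrite ler_wpM2l.
  pose F s := M / 2 * w0 s.
  have -> : prim (fun s => K * M * w0 s) (clamp T t) = F (clamp T t) - F 0.
    apply: prim_unique => //.
      by apply: within_continuous => s _; exact: cMw.
    move=> s _.
    have D1 : is_derive s 1 (fun s => 2 * K * s) (2 * K).
      by rewrite -[X in is_derive _ _ _ X]mulr1; exact: is_deriveZ.
    have D2 := is_derive1_comp (is_derive_expR (2 * K * s)) D1.
    have -> : K * M * w0 s = (M / 2) *: (expR (2 * K * s) * (2 * K)).
      by rewrite -[_ *: _]/(M / 2 * _) /w0; field.
    exact: is_deriveZ.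
  by rewrite /F gerBl mulr_ge0 ?divr_ge0 // expR_ge0.
have [| | | | | | |y cy Gy] := @weighted_fixed_point R p N (fun y => continuous y) G w
   (expR (2 * K * T)) (prim (fun s => N%:R * (`|Y0| * KA)) T) (fun=> Y0).
- move=> t; rewrite expR_ge0 ler_expR ler_wpM2l ?mulr_ge0 //; first exact: ltW.
  by case/andP: (ci t).
- by move=> t; exact: cst_continuous.
- exact: cG.
- by move=> y H; apply: uniform_limit_continuous.
- by rewrite prim_cst // !mulr_ge0.
- move=> t; rewrite /G addrC addKr.
  apply: (@le_trans _ _ (prim (fun s => N%:R * (`|Y0| * KA)) (clamp T t))).
    apply: ler_norm_mprim => //; first by apply: cyA => s; exact: cst_continuous.
      by move=> s; exact: cst_continuous.
    by move=> s _; rewrite (le_trans (ler_norm_mulmx _ _)) // ler_wpM2l // ler_wpM2l.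
  rewrite !prim_cst // (@le_trans _ _ (N%:R * (`|Y0| * KA) * T)) //.
    by rewrite ler_wpM2l ?mulr_ge0 //; case/andP: (ci t).
  by rewrite ler_peMr ?mulr_ge0 // -expR0 ler_expR !mulr_ge0 // ltW.
- exact: contr.
exists y; split => //.
  by rewrite -Gy /G clamp_id ?lexx // mprim0 addr0.
move=> t tT; have /andP[t0 t1] : 0 <= t <= T by move: tT; rewrite in_itv /= => /andP[/ltW -> /ltW].
apply: (quot_within_is_derive tT).
apply: (eq_quot_within (g := fun s => Y0 + mprim (fun s => y s *m A s) s)).
- by rewrite t0.
- by move=> s sT; rewrite -Gy /G clamp_id.
- apply: is_derive_quot_within; rewrite -[y t *m A t]add0r; apply: is_deriveD.
  by apply: is_derive_mprim => //; exact: cyA.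
Qed.

End linear_ode.

(** * The second variation *)

Section state_ctrl_coordinates.
Context {R : realType} {n m : nat}.
Local Notation N := (n + n + m)%N.

Definition to_state_ctrl (d : 'rV[R]_N) : state_ctrl R n m :=
  (lsubmx (lsubmx d), rsubmx (lsubmx d), rsubmx d).

Definition of_state_ctrl (z : state_ctrl R n m) : 'rV[R]_N :=
  row_mx (row_mx z.1.1 z.1.2) z.2.

Lemma of_state_ctrlK z : to_state_ctrl (of_state_ctrl z) = z.
Proof. by case: z => -[x v] w; rewrite /to_state_ctrl /of_state_ctrl !(row_mxKl, row_mxKr). Qed.

Definition state_ctrl_basis (k : 'I_N) : state_ctrl R n m := to_state_ctrl (delta_mx 0 k).
Local Notation E := state_ctrl_basis.

Lemma to_state_ctrlD d d' : to_state_ctrl (d + d') = to_state_ctrl d + to_state_ctrl d'.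
Proof. by rewrite /to_state_ctrl !linearD. Qed.

Lemma to_state_ctrlZ c d : to_state_ctrl (c *: d) = c *: to_state_ctrl d.
Proof. by rewrite /to_state_ctrl !linearZ. Qed.

Lemma to_state_ctrl0 : to_state_ctrl 0 = 0.
Proof. by rewrite /to_state_ctrl !linear0. Qed.

Lemma lincomb_basis d : lincomb E d = to_state_ctrl d.
Proof.
rewrite {2}(row_sum_delta d) (big_morph _ to_state_ctrlD to_state_ctrl0).
by apply: eq_bigr => k _; rewrite to_state_ctrlZ.
Qed.

Lemma ler_norm_lsubmx p1 p2 (d : 'rV[R]_(p1 + p2)) : `|lsubmx d| <= `|d|.
Proof. by apply/mx_normP => // i j; rewrite mxE ler_norm_entry. Qed.

Lemma ler_norm_rsubmx p1 p2 (d : 'rV[R]_(p1 + p2)) : `|rsubmx d| <= `|d|.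
Proof. by apply/mx_normP => // i j; rewrite mxE ler_norm_entry. Qed.

Lemma ler_norm_row_mx p1 p2 (d1 : 'rV[R]_p1) (d2 : 'rV[R]_p2) e : 0 <= e ->
  `|d1| <= e -> `|d2| <= e -> `|row_mx d1 d2| <= e.
Proof.
move=> e0 d1e d2e; apply/mx_normP => // i j.
by rewrite mxE; case: splitP => k _; rewrite (le_trans (ler_norm_entry _ _ _)).
Qed.

Lemma ler_norm_lincomb_basis d : `|lincomb E d| <= `|d|.
Proof.
rewrite lincomb_basis prod_normE ge_max prod_normE ge_max /= ler_norm_rsubmx andbT.
by rewrite !(le_trans _ (ler_norm_lsubmx d)) ?ler_norm_lsubmx ?ler_norm_rsubmx.
Qed.

Lemma state_ctrl_qB (z z' : state_ctrl R n m) : (z - z').1.1 = z.1.1 - z'.1.1.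
Proof. by []. Qed.

Lemma state_ctrl_vB (z z' : state_ctrl R n m) : (z - z').1.2 = z.1.2 - z'.1.2.
Proof. by []. Qed.

Lemma of_state_ctrlB z z' : of_state_ctrl (z - z') = of_state_ctrl z - of_state_ctrl z'.
Proof. by rewrite /of_state_ctrl !opp_row_mx !add_row_mx. Qed.

Lemma ler_norm_of_state_ctrl z : `|of_state_ctrl z| <= `|z|.
Proof.
by do 2?apply: ler_norm_row_mx => //; rewrite prod_normE le_max ?prod_normE ?le_max /= lexx ?orbT.
Qed.

Lemma continuous_of_state_ctrl : continuous of_state_ctrl.
Proof.
move=> z; apply/cvgrPdist_lt => e e0.
have /cvgrPdist_lt/(_ e e0) : (fun y => y) @ z --> z by [].
by apply: filterS => y; rewrite -of_state_ctrlB; apply: le_lt_trans; exact: ler_norm_of_state_ctrl.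
Qed.

Lemma basis_q i : E (lshift m (lshift n i)) = (delta_mx 0 i, 0, 0).
Proof.
rewrite /state_ctrl_basis /to_state_ctrl; congr (_, _, _); apply/rowP => j;
  by rewrite !mxE ?(eq_lshift, eq_rshift, eq_lrshift, eq_rlshift).
Qed.

Lemma basis_v i : E (lshift m (rshift n i)) = (0, delta_mx 0 i, 0).
Proof.
rewrite /state_ctrl_basis /to_state_ctrl; congr (_, _, _); apply/rowP => j;
  by rewrite !mxE ?(eq_lshift, eq_rshift, eq_lrshift, eq_rlshift).
Qed.

Lemma basis_u i : E (rshift (n + n) i) = (0, 0, delta_mx 0 i).
Proof.
rewrite /state_ctrl_basis /to_state_ctrl; congr (_, _, _); apply/rowP => j;
  by rewrite !mxE ?(eq_lshift, eq_rshift, eq_lrshift, eq_rlshift).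
Qed.

(** Along an affine map the two difference quotients are the same function of [s], so the
    derivatives agree whether or not the limits exist. *)
Lemma derive_comp_affine (U V W : normedModType R) (g : V -> W) (h : U -> V) x d e :
  (forall s : R, h (s *: d + x) = s *: e + h x) -> 'D_d (g \o h) x = 'D_e g (h x).
Proof.
move=> H; rewrite /derive.
have -> : (fun s : R => s^-1 *: (((g \o h) \o shift x) (s *: d) - (g \o h) x))
  = (fun s => s^-1 *: ((g \o shift (h x)) (s *: e) - g (h x))).
  by apply: funext => s /=; rewrite H.
by [].
Qed.

Section partial_derivatives.
Context (W : normedModType R) (g : state_ctrl R n m -> W) (q v : 'rV[R]_n) (w : 'rV[R]_m).

Lemma derive_partial_q i :
  'D_(delta_mx 0 i) (fun x => g (x, v, w)) q = 'D_(E (lshift m (lshift n i))) g (q, v, w).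
Proof.
rewrite (derive_comp_affine g (h := fun x => (x, v, w)) (e := E (lshift m (lshift n i)))) //.
by move=> s; rewrite basis_q; congr (_, _, _); rewrite /= scaler0 add0r.
Qed.

Lemma derive_partial_v i :
  'D_(delta_mx 0 i) (fun x => g (q, x, w)) v = 'D_(E (lshift m (rshift n i))) g (q, v, w).
Proof.
rewrite (derive_comp_affine g (h := fun x => (q, x, w)) (e := E (lshift m (rshift n i)))) //.
by move=> s; rewrite basis_v; congr (_, _, _); rewrite /= scaler0 add0r.
Qed.

Lemma derive_partial_u i :
  'D_(delta_mx 0 i) (fun x => g (q, v, x)) w = 'D_(E (rshift (n + n) i)) g (q, v, w).
Proof.
rewrite (derive_comp_affine g (h := fun x => (q, v, x)) (e := E (rshift (n + n) i))) //.
by move=> s; rewrite basis_u; congr (_, _, _); rewrite /= scaler0 add0r.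
Qed.

End partial_derivatives.

Section partial_jacobians.
Context (g : state_ctrl R n m -> 'rV[R]_n) (q v : 'rV[R]_n) (w : 'rV[R]_m)
  (dg : differentiable g (q, v, w)).

Lemma jacobian_derive p (h : 'rV[R]_p -> 'rV[R]_n) x i j : differentiable h x ->
  ('J h x) i j = ('D_(delta_mx 0 i) h x) 0 j.
Proof. by move=> dh; rewrite deriveEjacobian // -rowE [RHS]mxE. Qed.

Lemma derive_entry (z : state_ctrl R n m) e j : differentiable g z ->
  ('D_e g z) 0 j = 'D_e (fun z => g z 0 j) z.
Proof. by move=> dgz; rewrite derive_mx ?mxE //; exact: diff_derivable. Qed.

Lemma jacobian_q i j : ('J (fun x => g (x, v, w)) q) i j
  = 'D_(E (lshift m (lshift n i))) (fun z => g z 0 j) (q, v, w).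
Proof.
rewrite jacobian_derive ?derive_partial_q ?derive_entry //.
apply: (@differentiable_comp _ _ _ _ (fun x => (x, v, w)) g) => //;
  apply: differentiable_pair => //; exact: differentiable_pair.
Qed.

Lemma jacobian_v i j : ('J (fun x => g (q, x, w)) v) i j
  = 'D_(E (lshift m (rshift n i))) (fun z => g z 0 j) (q, v, w).
Proof.
rewrite jacobian_derive ?derive_partial_v ?derive_entry //.
apply: (@differentiable_comp _ _ _ _ (fun x => (q, x, w)) g) => //;
  apply: differentiable_pair => //; exact: differentiable_pair.
Qed.

Lemma jacobian_u i j : ('J (fun x => g (q, v, x)) w) i j
  = 'D_(E (rshift (n + n) i)) (fun z => g z 0 j) (q, v, w).
Proof.
rewrite jacobian_derive ?derive_partial_u ?derive_entry //.
apply: (@differentiable_comp _ _ _ _ (fun x => (q, v, x)) g) => //;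
  apply: differentiable_pair => //; exact: differentiable_pair.
Qed.

End partial_jacobians.

End state_ctrl_coordinates.

Section Ck_components.
Context {R : realType} {V : normedModType R}.

Lemma near_eq_differentiable (W : normedModType R) (g g' : V -> W) x :
  (\near x, g x = g' x) -> differentiable g x -> differentiable g' x.
Proof.
move=> gg' dg; have gx : g x = g' x := nbhs_singleton gg'.
have [cd /eqaddoP H] := (diff_locallyP x g).1 dg.
have H' : g' \o shift x = cst (g' x) + 'd g x +o_ 0 id.
  apply/eqaddoP => e e0.
  have gg0 : \forall y \near (0 : V), g (y + x) = g' (y + x).
    by move: gg'; rewrite (near_shift 0) /= subr0.
  apply: filterS2 gg0 (H e e0) => y; rewrite !fctE /= -gx => -> //.
have E := diff_unique cd H'.
by apply/diff_locallyP; rewrite E.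
Qed.

(** The derivative of an entry and the entry of the derivative are known to agree only on [D]. As
    [D] is open, each condition of [Ck_on] depends only on the values there. *)
Lemma eq_Ck_on (W : normedModType R) (D : set V) k (g g' : V -> W) : open D ->
  (forall x, D x -> g x = g' x) -> Ck_on k D g -> Ck_on k D g'.
Proof.
move=> oD; elim: k g g' => [|k IH] g g' gg'.
  move=> cg x Dx; have cx := cg x Dx.
  have nx : \near x, g x = g' x by apply: filterS (open_nbhs_nbhs (conj oD Dx)).
  rewrite /prop_for /continuous_at -(gg' x Dx).
  apply: cvg_trans cx; apply: near_eq_cvg; exact: nx.
move=> [dg Dg]; split=> [x Dx|v].
  apply: near_eq_differentiable (dg x Dx).
  exact: filterS (open_nbhs_nbhs (conj oD Dx)).
apply: IH (Dg v) => x Dx.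
apply: near_eq_derive.
exact: filterS (open_nbhs_nbhs (conj oD Dx)).
Qed.

Lemma Ck_on_entry p (D : set V) k (g : V -> 'rV[R]_p) j : open D ->
  Ck_on k D g -> Ck_on k D (fun x => g x 0 j).
Proof.
move=> oD; elim: k g => [|k IH] g.
  by move=> cg x Dx; move: (0 : 'I_1) j; apply/continuous_mxP; exact: cg.
move=> [dg Dg]; split=> [x Dx|v].
  apply: (@differentiable_comp _ _ _ _ g (fun M : 'rV[R]_p => M 0 j)); first exact: dg.
  exact: differentiable_coord.
apply: (eq_Ck_on oD _ (IH _ (Dg v))) => x Dx.
by rewrite derive_mx ?mxE //; apply: diff_derivable; exact: dg.
Qed.

End Ck_components.

(** * Trajectories and their restriction to shorter intervals *)

Section problem.
Context {R : realType} {n m : nat} (Omega : set 'rV[R]_n)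
  (C : state_ctrl R n m -> R) (f : state_ctrl R n m -> 'rV[R]_n).
Context (oOmega : open Omega).
Local Notation N := (n + n + m)%N.
Local Notation E := state_ctrl_basis.
Local Notation D := [set z : state_ctrl R n m | Omega z.1.1].
Local Notation f_ j := (fun z => f z 0 j).

Lemma open_domain : open D.
Proof.
apply: (@open_comp _ _ (fun z : state_ctrl R n m => z.1.1) Omega) => // z _.
by apply: (@continuous_comp _ _ _ fst fst); exact: cvg_fst.
Qed.

Lemma continuous_pair3 (T : topologicalType) (x v : T -> 'rV[R]_n) (w : T -> 'rV[R]_m) t :
  {for t, continuous x} -> {for t, continuous v} -> {for t, continuous w} ->
  {for t, continuous (fun s => (x s, v s, w s) : state_ctrl R n m)}.
Proof.
move=> cx cv cw; have cxv : (fun s => (x s, v s)) @ t --> (x t, v t) by exact: cvg_pair cx cv.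
exact: cvg_pair cxv cw.
Qed.

Lemma dotpE p (x y : 'rV[R]_p) : dotp x y = (x *m y^T) 0 0.
Proof. by rewrite mxE; apply: eq_bigr => i _; rewrite mxE. Qed.

Lemma dotpBl p (x y z : 'rV[R]_p) : dotp (x - y) z = dotp x z - dotp y z.
Proof. by rewrite !dotpE mulmxBl mxE [X in _ + X = _]mxE. Qed.

Lemma is_derive_dotp p (x y : R -> 'rV[R]_p) (t : R) dx dy :
  is_derive t 1 x dx -> is_derive t 1 y dy ->
  is_derive t 1 (fun s => dotp (x s) (y s)) (dotp dx (y t) + dotp (x t) dy).
Proof.
move=> Dx Dy; have Dyt : is_derive t 1 (fun s => (y s)^T) dy^T.
  apply/is_derive_mxP => i j; have /is_derive_mxP/(_ j i) := Dy.
  by rewrite mxE (_ : (fun s => (y s)^T i j) = (fun s => y s j i)) //; apply: funext => s; rewrite mxE.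
have /is_derive_mxP/(_ 0 0) := is_derive_mulmx Dx Dyt; rewrite mxE -!dotpE.
by rewrite (_ : (fun s => (x s *m (y s)^T) 0 0) = (fun s => dotp (x s) (y s))) //; apply: funext => s; rewrite dotpE.
Qed.

Lemma continuous_dotp p (T : topologicalType) (x y : T -> 'rV[R]_p) t :
  {for t, continuous x} -> {for t, continuous y} -> {for t, continuous (fun s => dotp (x s) (y s))}.
Proof.
move=> /continuous_mxP cx /continuous_mxP cy.
by apply: (continuous_bigsum (W := R^o)) => i; apply: cvgM; [exact: cx|exact: cy].
Qed.

Section trajectory.
Context (b : R) (q : R -> 'rV[R]_n) (u : R -> 'rV[R]_m)
  (tr : trajectory Omega f 0 b q u) (b0 : 0 < b).
Local Notation v := (derive_within 0 b q).

Lemma trajectory_q t : 0 <= t <= b -> quot_within 0 b q t --> v t.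
Proof. by case: tr => -[H _ _] _ _ _ tb; apply: derivable_withinE; apply: H; rewrite in_itv. Qed.

Lemma trajectory_v t : 0 <= t <= b -> quot_within 0 b v t --> f (along 0 b q u t).
Proof.
case: tr => -[_ H _] _ _ F tb; rewrite -F ?in_itv //.
by apply: derivable_withinE; apply: H; rewrite in_itv.
Qed.

Lemma trajectory_cq : C0_curve 0 b q.
Proof. by case: tr => -[H _ _] _ _ _; exact: derivable_within_C0. Qed.

Lemma trajectory_cv : C0_curve 0 b v.
Proof. by case: tr => -[_ H _] _ _ _; exact: derivable_within_C0. Qed.

Lemma trajectory_clamp t : D (along 0 b q u (clamp b t)).
Proof. by case: tr => _ _ H _; apply: H; rewrite in_itv /= clamp_itv // ltW. Qed.

Lemma continuous_along_clamp : continuous (along 0 b q u \o clamp b).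
Proof.
move=> t; apply: (@continuous_pair3 _ (q \o clamp b) (v \o clamp b) (u \o clamp b)).
- exact: (C0_curve_clamp (ltW b0) trajectory_cq).
- exact: (C0_curve_clamp (ltW b0) trajectory_cv).
- by case: tr => _ cu _ _; exact: (C0_curve_clamp (ltW b0) cu).
Qed.

End trajectory.

(** [derive_within 0 c] and [derive_within 0 b] are different limits at t = c when c < b, where the
    first is one-sided; existence of the second makes them equal. *)
Lemma derive_within_restrict (W : normedModType R) (g : R -> W) (d : R -> W) (b c t : R) :
  0 < c <= b -> (forall s, 0 <= s <= b -> quot_within 0 b g s --> d s) -> 0 <= t <= c ->
  derive_within 0 c g t = d t.
Proof.
move=> /andP[c0 cb] H tc; apply: quot_within_unique => //.
apply: (quot_withinS cb); apply: H; case/andP: tc => -> tc /=; exact: le_trans cb.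
Qed.

Lemma along_restrict b c q u t : trajectory Omega f 0 b q u -> 0 < c <= b -> 0 <= t <= c ->
  along 0 c q u t = along 0 b q u t.
Proof.
move=> tr cb tc; rewrite /along; congr (_, _, _).
by apply: (derive_within_restrict cb) => // s; exact: (trajectory_q tr).
Qed.

Lemma trajectory_restrict b c q u : trajectory Omega f 0 b q u -> 0 < c <= b ->
  trajectory Omega f 0 c q u.
Proof.
move=> tr cb; have /andP[c0 cb'] := cb.
have [C2 cu Oq Ef] := tr.
have sub t : 0 <= t <= c -> 0 <= t <= b by by case/andP=> -> tc /=; exact: le_trans cb'.
have Ev t : 0 <= t <= c -> derive_within 0 c q t = derive_within 0 b q t.
  by apply: (derive_within_restrict cb) => s; exact: (trajectory_q tr).
have qv t : 0 <= t <= c ->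
    quot_within 0 c (derive_within 0 c q) t --> f (along 0 b q u t).
  move=> tc; apply: (eq_quot_within (g := derive_within 0 b q)) => //; first by move=> s /Ev.
  by apply: quot_withinS cb' _; apply: trajectory_v => //; exact: sub.
have Ew t : 0 <= t <= c -> derive_within 0 c (derive_within 0 c q) t = f (along 0 b q u t).
  by move=> tc; apply: quot_within_unique => //; exact: qv.
split.
- split=> [t|t|]; rewrite ?in_itv /=.
  + by move=> tc; apply: cvgP; apply: quot_withinS cb' _; apply: trajectory_q tr _ _; exact: sub.
  + by move=> tc; apply: cvgP; exact: qv.
  + case: C2 => _ _ c2; have cc := continuous_subspaceW (subset_itvl _ : `[0, c] `<=` `[0, b]) c2.
    apply: (subspace_eq_continuous _ (cc _)); last by rewrite bnd_simp.
    move=> t; rewrite inE /= in_itv /= => tc; rewrite /from_subspace Ew // Ef // in_itv /=; exact: sub.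
- by apply: continuous_subspaceW cu; apply: subset_itvl; rewrite bnd_simp.
- by move=> t; rewrite in_itv /= => tc; apply: Oq; rewrite in_itv /=; exact: sub.
- by move=> t; rewrite in_itv /= => tc; rewrite Ew // (along_restrict tr).
Qed.

End problem.

(** * The exact cost difference and its Taylor remainder *)

Section second_variation.
Context {R : realType} {n m : nat} (Omega : set 'rV[R]_n)
  (C : state_ctrl R n m -> R) (f : state_ctrl R n m -> 'rV[R]_n)
  (T : R) (q0 v0 qT vT : 'rV[R]_n) (q kappa : R -> 'rV[R]_n) (u : R -> 'rV[R]_m).
Local Notation N := (n + n + m)%N.
Local Notation E := state_ctrl_basis.
Local Notation D := [set z : state_ctrl R n m | Omega z.1.1].
Local Notation f_ j := (fun z => f z 0 j).
Context (oOmega : open Omega) (hC : Ck_on 2 D C) (hf : Ck_on 2 D f) (T0 : 0 < T)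
  (foc : first_order_conditions Omega C f T q0 v0 qT vT q kappa u).

Let oD : open D := @open_domain R n m Omega oOmega.
Let hfi i : Ck_on 2 D (f_ i). Proof. exact: Ck_on_entry. Qed.

Definition base_curve t : state_ctrl R n m := along 0 T q u (clamp T t).
Local Notation z := base_curve.
Local Notation v := (derive_within 0 T q).
Local Notation kap t := (kappa (clamp T t)).

Let tr : trajectory Omega f 0 T q u. Proof. by case: foc => -[]. Qed.

Lemma base_curveD t : D (z t). Proof. exact: (trajectory_clamp tr). Qed.

Lemma continuous_base_curve : continuous z. Proof. exact: (continuous_along_clamp tr). Qed.

Lemma base_curve_id t : 0 <= t <= T -> z t = along 0 T q u t.
Proof. by move=> tT; rewrite /base_curve clamp_id. Qed.

(** Minus the gradient of <kappa, f> - C in all the coordinates (q, v, u), with kappa frozen. The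
    first order conditions make its u block vanish and its q block the derivative of [costate_q]. *)
Definition costate_residual t : 'rV[R]_N :=
  \row_k ('D_(E k) C (z t) - \sum_i kap t 0 i * 'D_(E k) (f_ i) (z t)).
Local Notation c := costate_residual.

Definition hessian_mx t : 'M[R]_N :=
  \matrix_(k, l) (\sum_i kap t 0 i * 'D_(E l) ('D_(E k) (f_ i)) (z t)
                  - 'D_(E l) ('D_(E k) C) (z t)).

Lemma foc_u t : 0 <= t <= T -> rsubmx (c t) = 0.
Proof.
move=> tT; have [_ _ _ _ Hu] := foc; apply/rowP => j.
have tT' : t \in `[0, T] by rewrite in_itv.
have H := congr1 (fun M : 'rV_m => M 0 j) (Hu t tT').
rewrite /= mxE in H; rewrite [RHS]mxE [RHS]H !mxE base_curve_id // clamp_id // derive_partial_u; congr (_ - _).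
apply: eq_bigr => i _; rewrite mxE jacobian_u //.
by apply: Ck_on_differentiable hf _ _; have := base_curveD t; rewrite base_curve_id.
Qed.

(* The costate [lambda_q] determined by [lambda_v = kappa] through the equation
   [lambda_v' = - dH/dv]. *)
Definition costate_q t : 'rV[R]_n := rsubmx (lsubmx (c t)) - derive_within 0 T kappa t.

Lemma kappaP t : 0 <= t <= T -> quot_within 0 T kappa t --> derive_within 0 T kappa t.
Proof. by case: foc => _ [H _ _] _ _ _ tT; apply: derivable_withinE; apply: H; rewrite in_itv. Qed.

(** Only the bracket C_v - kappa^T f_v is assumed differentiable, not its two terms. On [0, T]
    [costate_q] is this bracket minus kappa', and substituting the equation for kappa'' leaves C_q -
    kappa^T f_q. *)
Lemma costate_qP t : 0 <= t <= T -> quot_within 0 T costate_q t --> lsubmx (lsubmx (c t)).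
Proof.
move=> tT; have [_ [_ dk2 _] dbr Hq _] := foc.
have tT' : t \in `[0, T] by rewrite in_itv.
have dfz s : 0 <= s <= T -> differentiable f (along 0 T q u s).
  by move=> sT; apply: Ck_on_differentiable hf _ _; have := base_curveD s; rewrite base_curve_id.
have := quot_withinD (derivable_withinE (dbr _ tT')) (quot_withinN (derivable_withinE (dk2 _ tT'))).
rewrite (Hq t tT'); set X := (X in _ --> X).
have -> : X = lsubmx (lsubmx (c t)).
  apply/rowP => j; rewrite !mxE base_curve_id // clamp_id // derive_partial_q.
  have arith (x y w : R) : x - (x - y + w) = y - w by ring.
  rewrite arith; congr (_ - _).
  by apply: eq_bigr => i _; rewrite mxE jacobian_q //; exact: dfz.
apply: eq_quot_within => // s sT; congr (_ - _); apply/rowP => j; rewrite !mxE.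
rewrite base_curve_id // clamp_id // derive_partial_v; congr (_ - _).
by apply: eq_bigr => i _; rewrite mxE jacobian_v //; exact: dfz.
Qed.

Lemma continuous_kap : continuous (fun t => kap t).
Proof.
apply: (C0_curve_clamp (ltW T0)); apply: derivable_within_C0.
by have [_ [dk _ _] _ _ _] := foc.
Qed.

Lemma continuous_comp_domain (W : normedModType R) (g : state_ctrl R n m -> W)
    (y : R -> state_ctrl R n m) :
  Ck_on 0 D g -> continuous y -> (forall t, D (y t)) -> continuous (g \o y).
Proof. by move=> cg cy yD t; apply: continuous_comp; [exact: cy|exact: cg]. Qed.

Section competitor.
Context (b : R) (b0 : 0 < b) (bT : b <= T) (q' : R -> 'rV[R]_n) (u' : R -> 'rV[R]_m)
  (tr' : trajectory Omega f 0 b q' u').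
Local Notation v' := (derive_within 0 b q').

Definition competitor_curve t : state_ctrl R n m := along 0 b q' u' (clamp b t).
Local Notation z' := competitor_curve.

Definition variation t : 'rV[R]_N := of_state_ctrl (z' t - z (clamp b t)).
Local Notation d := variation.

Definition taylor_remainder (g : state_ctrl R n m -> R) t : R :=
  g (z' t) - g (z (clamp b t)) - \sum_k d t 0 k * 'D_(E k) g (z (clamp b t)).

Definition hamiltonian_remainder t : R :=
  \sum_i kap (clamp b t) 0 i * taylor_remainder (f_ i) t - taylor_remainder C t.
Local Notation rem := hamiltonian_remainder.

Lemma competitorE t : z' t = z (clamp b t) + lincomb E (d t).
Proof. by rewrite lincomb_basis /variation of_state_ctrlK addrC subrK. Qed.

Lemma continuous_competitor : continuous z'.
Proof. exact: (continuous_along_clamp tr'). Qed.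

Lemma continuous_base_clamp : continuous (fun t => z (clamp b t)).
Proof.
move=> t; apply: (@continuous_comp _ _ _ (clamp b) z); first exact: continuous_clamp.
exact: continuous_base_curve.
Qed.

Lemma continuous_variation : continuous d.
Proof.
move=> t; have cB : {for t, continuous (fun t => z' t - z (clamp b t))}.
  by apply: continuousB; [exact: continuous_competitor|exact: continuous_base_clamp].
apply: (@continuous_comp _ _ _ (fun t => z' t - z (clamp b t)) (@of_state_ctrl R n m)) => //.
exact: continuous_of_state_ctrl.
Qed.

Lemma continuous_taylor_remainder g : Ck_on 2 D g -> continuous (taylor_remainder g).
Proof.
move=> hg.
have cg : Ck_on 0 D g by do 2!apply: Ck_onW.
have cg' k : Ck_on 0 D ('D_(E k) g) by have [_ Dg] := hg; apply: Ck_onW; exact: Dg.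
have zD' t : D (z' t) by exact: (trajectory_clamp tr').
have zD t : D (z (clamp b t)) by exact: base_curveD.
move=> t; apply: cvgB; first apply: cvgB.
- exact: (continuous_comp_domain cg continuous_competitor zD').
- exact: (continuous_comp_domain cg continuous_base_clamp zD).
apply: (continuous_bigsum (W := R^o)) => k; apply: cvgM.
  exact: (@continuous_entry R 1 N d 0 k continuous_variation t).
exact: (continuous_comp_domain (cg' k) continuous_base_clamp zD).
Qed.

Lemma continuous_hamiltonian_remainder : continuous rem.
Proof.
move=> t; apply: continuousB; last exact: (continuous_taylor_remainder hC).
apply: (continuous_bigsum (W := R^o)) => i; apply: cvgM; last exact: (continuous_taylor_remainder (hfi i)).
have ck : continuous (fun t => kap (clamp b t)).
  by move=> s; apply: (@continuous_comp _ _ _ (clamp b) (fun t => kap t)); [exact: continuous_clamp|exact: continuous_kap].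
exact: (@continuous_entry R 1 n (fun t => kap (clamp b t)) 0 i ck t).
Qed.

Lemma sum_variation (h : 'rV[R]_N) t :
  \sum_k d t 0 k * h 0 k =
  dotp (lsubmx (lsubmx h)) (z' t - z (clamp b t)).1.1
  + dotp (rsubmx (lsubmx h)) (z' t - z (clamp b t)).1.2
  + dotp (rsubmx h) (z' t - z (clamp b t)).2.
Proof.
rewrite /dotp !big_split_ord /=; congr (_ + _ + _); apply: eq_bigr => i _.
- by rewrite [lsubmx _ _ _]mxE [lsubmx _ _ _]mxE /variation /of_state_ctrl !row_mxEl mulrC.
- by rewrite [rsubmx _ _ _]mxE [lsubmx _ _ _]mxE /variation /of_state_ctrl row_mxEl row_mxEr mulrC.
- by rewrite [rsubmx _ _ _]mxE /variation /of_state_ctrl row_mxEr mulrC.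
Qed.

(** The linear terms of all the Taylor remainders regroup into a pairing of the variation with
    [costate_residual], whose blocks the first order conditions identify. *)
Lemma hamiltonian_remainderE t :
  rem t = dotp (kap (clamp b t)) (f (z' t) - f (z (clamp b t)))
          - (C (z' t) - C (z (clamp b t))) + \sum_k d t 0 k * c (clamp b t) 0 k.
Proof.
rewrite /hamiltonian_remainder /taylor_remainder.
have -> : \sum_k d t 0 k * c (clamp b t) 0 k =
   \sum_k d t 0 k * 'D_(E k) C (z (clamp b t))
   - \sum_i kap (clamp b t) 0 i * (\sum_k d t 0 k * 'D_(E k) (f_ i) (z (clamp b t))).
  under [X in _ - X]eq_bigr do rewrite mulr_sumr.
  rewrite exchange_big -sumrB; apply: eq_bigr => k _.
  rewrite [c _ _ _]mxE mulrBr mulr_sumr; congr (_ - _); apply: eq_bigr => i _.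
  by rewrite mulrCA.
have -> : dotp (kap (clamp b t)) (f (z' t) - f (z (clamp b t))) =
  \sum_i kap (clamp b t) 0 i * (f (z' t) 0 i - f (z (clamp b t)) 0 i).
  by apply: eq_bigr => i _; rewrite !mxE.
under eq_bigr do rewrite mulrBr.
rewrite sumrB; lra.
Qed.

(* The function [lambda_q dq + kappa dv] vanishes at both endpoints, and its
   derivative cancels the first order part of [C - kappa^T f]. *)
Lemma cost_difference :
  q' 0 = q 0 /\ v' 0 = v 0 -> q' b = q b /\ v' b = v b ->
  cost C 0 b q' u' - cost C 0 b q u = - prim rem b.
Proof.
move=> [q'0 v'0] [q'b v'b].
have cC : Ck_on 0 D C by do 2!apply: Ck_onW.
have zD' t : D (z' t) by exact: (trajectory_clamp tr').
have zD t : D (z (clamp b t)) by exact: base_curveD.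
have cCz' := continuous_comp_domain cC continuous_competitor zD'.
have cCz := continuous_comp_domain cC continuous_base_clamp zD.
have crem := continuous_hamiltonian_remainder.
have sub t : 0 <= t <= b -> 0 <= t <= T by case/andP => -> tb /=; exact: le_trans bT.
have -> : cost C 0 b q' u' = prim (C \o z') b.
  by apply: Rintegral_prim (ltW b0) cCz' _ => t tb; rewrite /= /competitor_curve clamp_id.
have -> : cost C 0 b q u = prim (C \o (fun t => z (clamp b t))) b.
  apply: Rintegral_prim (ltW b0) cCz _ => t tb; rewrite /= clamp_id // base_curve_id ?sub //.
  by rewrite (along_restrict tr) // b0.
have cc (F : R -> R) : (forall t, 0 <= t -> {for t, continuous F}) -> {within `[0, b], continuous F}.
  by move=> cF; apply: within_continuous => t; rewrite in_itv => /andP[t0 _]; exact: cF.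
have wc (W : normedModType R) (g : R -> W) : C0_curve 0 T g -> {within `[0, b], continuous g}.
  by move=> cg; apply: continuous_subspaceW cg; apply: subset_itvl; rewrite bnd_simp.
have cF : {within `[0, b], continuous
    (prim (C \o z') \- prim (C \o (fun t => z (clamp b t))) \+ prim rem)}.
  apply: cc => t t0; apply: continuousD; last exact: continuous_prim.
  by apply: continuousB; exact: continuous_prim.
have cl : C0_curve 0 T costate_q.
  by apply: derivable_within_C0 => t; rewrite in_itv => tT; apply: cvgP; exact: costate_qP.
have ck : C0_curve 0 T kappa by have [_ [dk _ _] _ _ _] := foc; exact: derivable_within_C0.
have cG : {within `[0, b], continuous (fun t =>
    dotp (costate_q t) (q' t - q t) + dotp (kappa t) (v' t - v t))}.
  have wB (g h : R -> 'rV[R]_n) : {within `[0, b], continuous g} -> {within `[0, b], continuous h} ->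
      {within `[0, b], continuous (fun t => g t - h t)}.
    by move=> cg ch t; apply: continuousB; [exact: cg|exact: ch].
  have wdot (g h : R -> 'rV[R]_n) : {within `[0, b], continuous g} -> {within `[0, b], continuous h} ->
      {within `[0, b], continuous (fun t => dotp (g t) (h t))}.
    by move=> cg ch t; exact: continuous_dotp (cg t) (ch t).
  have cG1 := wdot _ _ (wc _ _ cl) (wB _ _ (trajectory_cq tr') (wc _ _ (trajectory_cq tr))).
  have cG2 := wdot _ _ (wc _ _ ck) (wB _ _ (trajectory_cv tr') (wc _ _ (trajectory_cv tr))).
  by move=> t; apply: cvgD; [exact: cG1|exact: cG2].
pose dF t := C (z' t) - C (z (clamp b t)) + rem t.
pose dG t := (dotp (lsubmx (lsubmx (c t))) (q' t - q t) + dotp (costate_q t) (v' t - v t))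
   + (dotp (derive_within 0 T kappa t) (v' t - v t) + dotp (kappa t) (f (z' t) - f (z t))).
have dp0 p (x : 'rV[R]_p) : dotp x 0 = 0 by rewrite /dotp big1 // => i _; rewrite mxE mulr0.
pose G t := dotp (costate_q t) (q' t - q t) + dotp (kappa t) (v' t - v t).
have G0 : G 0 = 0 by rewrite /G q'0 v'0 !subrr !dp0 addr0.
have Gb : G b = 0 by rewrite /G q'b v'b !subrr !dp0 addr0.
pose F := prim (C \o z') \- prim (C \o (fun t => z (clamp b t))) \+ prim rem.
have F0 : F 0 = 0 by rewrite /F /= !prim0 subrr addr0.
suff Eb : F b - F 0 = G b - G 0.
  by apply/eqP; rewrite -addr_eq0 -[X in X == 0]/(F b) -[F b]subr0 -{1}F0 Eb Gb G0 subrr.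
apply: (@derive_eq_increment R F G dF dG 0 b (ltW b0) cF cG).
- move=> t; rewrite in_itv => /andP[/ltW t0 _].
  have ? := is_derive_prim cCz' t0; have ? := is_derive_prim cCz t0; have ? := is_derive_prim crem t0.
  exact: is_deriveD.
- move=> t tb.
  have tb' : 0 <= t <= b by move: tb; rewrite in_itv /= => /andP[/ltW -> /ltW].
  have tT : t \in `]0, T[ by move: tb; rewrite !in_itv /= => /andP[-> tb]; exact: lt_le_trans bT.
  have tT' := sub _ tb'.
  have dq := quot_within_is_derive tT (trajectory_q tr tT').
  have dv := quot_within_is_derive tT (trajectory_v tr tT').
  have dq' := quot_within_is_derive tb (trajectory_q tr' tb').
  have dv' := quot_within_is_derive tb (trajectory_v tr' tb').
  have dk := quot_within_is_derive tT (kappaP tT').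
  have dl := quot_within_is_derive tT (costate_qP tT').
  rewrite /dG /competitor_curve clamp_id // base_curve_id //.
  by apply: is_deriveD; apply: is_derive_dotp => //; exact: is_deriveB.
- move=> t tb.
  have tb' : 0 <= t <= b by move: tb; rewrite in_itv /= => /andP[/ltW -> /ltW].
  have tT' := sub _ tb'.
  (* Block by block: the u part of the residual is 0, its q part is the derivative of [costate_q],
     and its v part is [costate_q] + kappa'. *)
  rewrite /dF /dG hamiltonian_remainderE sum_variation !clamp_id // foc_u //.
  have Ez' : z' t = along 0 b q' u' t by rewrite /competitor_curve clamp_id.
  rewrite state_ctrl_qB state_ctrl_vB Ez' base_curve_id //.
  have aq b1 q1 u1 : (along 0 b1 q1 u1 t : state_ctrl R n m).1.1 = q1 t by [].
  have av b1 q1 u1 : (along 0 b1 q1 u1 t : state_ctrl R n m).1.2 = derive_within 0 b1 q1 t by [].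
  rewrite !aq !av.
  have -> x : dotp (0 : 'rV[R]_m) x = 0 by rewrite /dotp big1 // => i _; rewrite mxE mul0r.
  have arith (x y a e k : R) : x + (y - x + (a + e + 0)) = a + (e - k) + (k + y) by ring.
  rewrite /costate_q dotpBl; exact: arith.
Qed.

End competitor.

Definition f_jacobian t : 'M[R]_(N, n) := \matrix_(k, i) 'D_(E k) (f_ i) (z t).

Lemma continuous_f_jacobian : continuous f_jacobian.
Proof.
move=> t; apply/continuous_mxP => k i.
have cg : Ck_on 0 D ('D_(E k) (f_ i)) by have [_ Dg] := hfi i; apply: Ck_onW; exact: Dg.
rewrite (_ : (fun s => f_jacobian s k i) = 'D_(E k) (f_ i) \o z).
  exact: (continuous_comp_domain cg continuous_base_curve base_curveD).
by apply: funext => s; rewrite mxE.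
Qed.

Lemma continuous_hessian_mx : continuous hessian_mx.
Proof.
move=> t; apply/continuous_mxP => k l.
have cg (g : state_ctrl R n m -> R) : Ck_on 2 D g -> continuous ('D_(E l) ('D_(E k) g) \o z).
  move=> [_ Dg]; have [_ Dg'] := Dg (E k).
  exact: (continuous_comp_domain (Dg' (E l)) continuous_base_curve base_curveD).
rewrite (_ : (fun s => hessian_mx s k l) = (fun s =>
   \sum_i kap s 0 i * ('D_(E l) ('D_(E k) (f_ i)) \o z) s - ('D_(E l) ('D_(E k) C) \o z) s)).
  apply: cvgB; last exact: cg.
  apply: (continuous_bigsum (W := R^o)) => i; apply: cvgM; last exact: (cg _ (hfi i)).
  exact: (@continuous_entry R 1 n (fun t => kap t) 0 i continuous_kap t).
by apply: funext => s; rewrite mxE.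
Qed.

Lemma near_f_jacobian (e : R) : 0 < e ->
  \forall r \near 0^'+, forall t, 0 <= t <= T -> forall d d' : 'rV[R]_N,
    `|d| <= r -> `|d'| <= r ->
    `|f (z t + lincomb E d) - f (z t + lincomb E d') - (d - d') *m f_jacobian t|
      <= e * `|d - d'|.
Proof.
move=> e0.
have H : \forall r \near 0^'+, forall i : 'I_n, forall t, 0 <= t <= T -> forall d d' : 'rV[R]_N,
    `|d| <= r -> `|d'| <= r ->
    `|f_ i (z t + lincomb E d) - f_ i (z t + lincomb E d') -
      \sum_k (d 0 k - d' 0 k) * 'D_(E k) (f_ i) (z t)| <= e * `|d - d'|.
  apply: filter_forall => i; apply: (near_uniform_diff oD T continuous_base_curve base_curveD) => //.
    exact: ler_norm_lincomb_basis.
  exact: Ck_onW (hfi i).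
apply: filterS H => r H t tT d d' dr dr'; apply/mx_normP; first by rewrite mulr_ge0 // ltW.
move=> i0 i; rewrite (ord1 i0) 4!mxE.
have := H i t tT d d' dr dr'; congr (`|_ - _| <= _).
by rewrite [RHS]mxE; apply: eq_bigr => k _; rewrite !mxE.
Qed.

Lemma f_lipschitz : exists2 L : R, 0 < L &
  \forall r \near 0^'+, forall t, 0 <= t <= T -> forall d : 'rV[R]_N, `|d| <= r ->
    `|f (z t + lincomb E d) - f (z t)| <= L * `|d|.
Proof.
have [K K0 HK] := continuous_bounded T0 continuous_f_jacobian.
(* K bounds the Jacobian; the 1 is the linearisation error, taken with e = 1. *)
exists (1 + N%:R * K); first by rewrite ltr_pwDl // mulr_ge0.
have := near_f_jacobian ltr01; apply: filterS => r H t tT d dr.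
have r0 : 0 <= r by exact: le_trans dr.
have := H t tT d 0 dr; rewrite normr0 lincomb0 addr0 subr0 => /(_ r0) {}H.
rewrite -[f _ - _](subrK (d *m f_jacobian t)) (le_trans (ler_normD _ _)) //.
rewrite mulrDl lerD // (le_trans (ler_norm_mulmx _ _)) // -mulrA ler_wpM2l //.
by rewrite mulrC ler_wpM2r // HK.
Qed.

(** The second order bound only involves the value of the variation at t, so one radius serves every
    interval [0, b] and every competitor. *)
Lemma near_hamiltonian_remainder (e : R) : 0 < e ->
  \forall r \near 0^'+, forall b q' u', 0 < b -> b <= T -> forall t, 0 <= t <= b ->
    `|variation b q' u' t| <= r ->
    `|hamiltonian_remainder b q' u' t
      - 2^-1 * (variation b q' u' t *m hessian_mx t *m (variation b q' u' t)^T) 0 0|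
    <= e * `|variation b q' u' t| ^+ 2.
Proof.
move=> e0; have [K K0 HK] := continuous_bounded T0 continuous_kap.
(* The remainder collects one Taylor error from C and n errors from the entries of f, each weighted
   by at most K. *)
pose e' := e / (1 + n%:R * K).
have den0 : 0 < 1 + n%:R * K by rewrite ltr_pwDl // mulr_ge0.
have e'0 : 0 < e' by rewrite divr_gt0.
pose rho (g : state_ctrl R n m -> R) t d := g (z t + lincomb E d) - g (z t)
  - \sum_k d 0 k * 'D_(E k) g (z t)
  - 2^-1 * \sum_k d 0 k * (\sum_l d 0 l * 'D_(E l) ('D_(E k) g) (z t)).
have HC := near_uniform_diff2 oD T continuous_base_curve base_curveD
   (@ler_norm_lincomb_basis R n m) hC e'0.
have Hi i := near_uniform_diff2 oD T continuous_base_curve base_curveD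
   (@ler_norm_lincomb_basis R n m) (hfi i) e'0.
have Hf : \forall r \near 0^'+, forall i : 'I_n, forall t, 0 <= t <= T -> forall d : 'rV[R]_N, `|d| <= r ->
    `|f_ i (z t + lincomb E d) - f_ i (z t) - \sum_k d 0 k * 'D_(E k) (f_ i) (z t)
     - 2^-1 * \sum_k d 0 k * (\sum_l d 0 l * 'D_(E l) ('D_(E k) (f_ i)) (z t))| <= e' * `|d| ^+ 2.
  by apply: filter_forall => i; exact: Hi.
move: HC Hf; apply: filterS2 => r HC Hf b q' u' b0 bT t tb dr.
have tT : 0 <= t <= T by case/andP: tb => -> tb /=; exact: le_trans bT.
set d := variation b q' u' t in dr *.
have Ez : competitor_curve b q' u' t = z t + lincomb E d.
  by rewrite competitorE clamp_id.
have -> : hamiltonian_remainder b q' u' t - 2^-1 * (d *m hessian_mx t *m d^T) 0 0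
   = \sum_i kap t 0 i * rho (f_ i) t d - rho C t d.
  have -> : (d *m hessian_mx t *m d^T) 0 0 =
     \sum_i kap t 0 i * (\sum_k d 0 k * (\sum_l d 0 l * 'D_(E l) ('D_(E k) (f_ i)) (z t)))
     - \sum_k d 0 k * (\sum_l d 0 l * 'D_(E l) ('D_(E k) C) (z t)).
    transitivity (\sum_k d 0 k * (\sum_l d 0 l * hessian_mx t k l)).
      rewrite -mulmxA mxE; apply: eq_bigr => k _; congr (_ * _).
      by rewrite [LHS]mxE; apply: eq_bigr => l _; rewrite [d^T _ _]mxE mulrC.
    transitivity (\sum_k d 0 k * (\sum_i kap t 0 i * (\sum_l d 0 l * 'D_(E l) ('D_(E k) (f_ i)) (z t))
        - \sum_l d 0 l * 'D_(E l) ('D_(E k) C) (z t))).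
      apply: eq_bigr => k _; congr (_ * _).
      under [X in _ = X - _]eq_bigr do rewrite mulr_sumr.
      rewrite exchange_big -sumrB; apply: eq_bigr => l _.
      rewrite [hessian_mx _ _ _]mxE mulrBr mulr_sumr; congr (_ - _).
      by apply: eq_bigr => i _; rewrite mulrCA.
    under eq_bigr do rewrite mulrBr.
    rewrite sumrB; congr (_ - _).
    under [RHS]eq_bigr do rewrite mulr_sumr.
    rewrite [RHS]exchange_big; apply: eq_bigr => k _; rewrite mulr_sumr.
    by apply: eq_bigr => i _; rewrite mulrCA.
  rewrite /hamiltonian_remainder /taylor_remainder -/d !Ez !clamp_id //.
  have arith (a b1 a' b' : R) : a - b1 - 2^-1 * (a' - b') = (a - 2^-1 * a') - (b1 - 2^-1 * b').
    by ring.
  rewrite arith; congr (_ - _).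
  rewrite mulr_sumr -sumrB; apply: eq_bigr => i _.
  by rewrite /rho [RHS]mulrBr; congr (_ - _); rewrite mulrCA.
rewrite (le_trans (ler_normB _ _)) //.
apply: (@le_trans _ _ (\sum_(i < n) K * (e' * `|d| ^+ 2) + e' * `|d| ^+ 2)).
  rewrite lerD //; last exact: HC.
  rewrite (le_trans (ler_norm_sum _ _ _)) // ler_sum // => i _; rewrite normrM.
  apply: ler_pM => //; first exact: le_trans (ler_norm_entry _ _ _) (HK _ tT).
  exact: Hf.
rewrite sumr_const card_ord -mulr_natl.
rewrite [leLHS](_ : _ = e' * (1 + n%:R * K) * `|d| ^+ 2); last by ring.
by rewrite /e' divfK // gt_eqF.
Qed.

Definition control_hessian t : 'M[R]_m :=
  hessian (Ltilde C f (q t) (kappa t) (v t) (derive_within 0 T kappa t)) (u t).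

(** The term <v_kappa, v_q> of [Ltilde] does not depend on u, so the control block only sees <kappa,
    f> - C. *)
Lemma control_hessianE t : 0 <= t <= T -> drsubmx (hessian_mx t) = control_hessian t.
Proof.
move=> tT; apply/matrixP => i j; rewrite !mxE /Ltilde base_curve_id // clamp_id //.
have Dz w : D (q t, v t, w) by have := base_curveD t; rewrite base_curve_id.
have dfi k w : differentiable (f_ k) (q t, v t, w) by apply: Ck_on_differentiable (hfi k) _ (Dz w).
have dC w : differentiable C (q t, v t, w) by apply: Ck_on_differentiable hC _ (Dz w).
have dpt w : differentiable (fun x : 'rV[R]_m => (q t, v t, x)) w.
  by apply: differentiable_pair => //; apply: differentiable_pair.
(* Differentiation in u sends an expression of this shape to another one of the same shape, so [DG]
   computes both the first and the second derivative. *)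
pose G (F : 'I_n -> state_ctrl R n m -> R) (g : state_ctrl R n m -> R) (w : 'rV[R]_m) :=
  \sum_k kappa t 0 k * F k (q t, v t, w) - g (q t, v t, w).
have DG F g e c w : (forall k, differentiable (F k) (q t, v t, w)) -> differentiable g (q t, v t, w) ->
    'D_(delta_mx 0 e) (fun x => c + G F g x) w
    = G (fun k => 'D_(E (rshift (n + n) e)) (F k)) ('D_(E (rshift (n + n) e)) g) w.
  move=> dF dg.
  have dF' k : is_derive w (delta_mx 0 e) (fun x => F k (q t, v t, x))
      ('D_(E (rshift (n + n) e)) (F k) (q t, v t, w)).
    rewrite -derive_partial_u; apply: derivableP; apply: diff_derivable.
    exact: (differentiable_comp (dpt w)).
  have dg' : is_derive w (delta_mx 0 e) (fun x => g (q t, v t, x))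
      ('D_(E (rshift (n + n) e)) g (q t, v t, w)).
    rewrite -derive_partial_u; apply: derivableP; apply: diff_derivable.
    exact: (differentiable_comp (dpt w)).
  have dS : is_derive w (delta_mx 0 e) (\sum_(k < n) (fun x => kappa t 0 k * F k (q t, v t, x)))
     (\sum_k kappa t 0 k * 'D_(E (rshift (n + n) e)) (F k) (q t, v t, w)).
    by apply: is_derive_sum => k; have ? := dF' k; exact: is_deriveZ.
  rewrite (_ : (fun x => c + G F g x) = cst c + (\sum_(k < n) (fun x => kappa t 0 k * F k (q t, v t, x))
      - (fun x => g (q t, v t, x)))).
    by have [_ ->] := is_deriveD (is_derive_cst c w (delta_mx 0 e)) (is_deriveB dS dg'); rewrite add0r.
  by apply: funext => x; rewrite /G !fctE fct_sumE.
pose c := dotp (derive_within 0 T kappa t) (v t).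
have -> : (fun w => dotp (derive_within 0 T kappa t) (v t) + dotp (kappa t) (f (q t, v t, w))
   - C (q t, v t, w)) = (fun x => c + G (fun k => f_ k) C x).
  by apply: funext => x; rewrite -addrA.
have -> : 'D_(delta_mx 0 i) (fun x => c + G (fun k => f_ k) C x) =
   (fun x => 0 + G (fun k => 'D_(E (rshift (n + n) i)) (f_ k)) ('D_(E (rshift (n + n) i)) C) x).
  by apply: funext => x; rewrite DG // add0r.
rewrite DG //.
- by move=> k; have [_ /(_ (E (rshift (n + n) i)))[dD _]] := hfi k; exact: dD (Dz _).
- by have [_ /(_ (E (rshift (n + n) i)))[dD _]] := hC; exact: dD (Dz _).
Qed.

Lemma hessian_mx_control t (w : 'rV[R]_m) : 0 <= t <= T ->
  row_mx 0 w *m hessian_mx t *m (row_mx 0 w)^T = w *m control_hessian t *m w^T.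
Proof.
move=> tT; rewrite -control_hessianE // -[hessian_mx t]submxK mul_row_block.
by rewrite tr_row_mx mul_row_col !mul0mx !add0r trmx0 mulmx0 add0r block_mxKdr.
Qed.

End second_variation.

(** * Sufficiency *)

Section integral_inequalities.
Context {R : realType}.

Lemma prim_nondecreasing (h : R -> R) a b : continuous h -> 0 <= a <= b ->
  (forall t, a <= t <= b -> 0 <= h t) -> prim h a <= prim h b.
Proof.
move=> ch /andP[a0 ab] h0; rewrite -subr_ge0.
have <- : (fun=> 0 : R) b - (fun=> 0 : R) a = 0 by rewrite subrr.
apply: (@derive_le_increment _ (fun=> 0) _ (fun=> 0) h) => //.
- by apply: within_continuous => t _; exact: cst_continuous.
- apply: within_continuous => t; rewrite in_itv => /andP[at_ _].
  by apply: continuous_prim => //; exact: le_trans at_.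
- by move=> t; rewrite in_itv => /andP[/ltW at_ _]; apply: is_derive_prim => //; exact: le_trans at_.
- by move=> t; rewrite in_itv => /andP[/ltW at_ /ltW tb]; apply: h0; rewrite at_.
Qed.

(** Cauchy-Schwarz against the constant 1, obtained by integrating (h - a)^2 >= 0 where a is the
    mean of h. *)
Lemma prim_square_le (h : R -> R) b : continuous h -> 0 < b ->
  prim h b ^+ 2 <= b * prim (fun t => h t ^+ 2) b.
Proof.
move=> ch b0; have b0' := ltW b0.
pose a := prim h b / b.
have ch2 : continuous (fun t => h t ^+ 2).
  by move=> t; rewrite (_ : (fun t => h t ^+ 2) = (fun t => h t * h t)) //; apply: cvgM; exact: ch.
have c1 : continuous (fun t => (2 * a) * h t).
  by move=> t; apply: cvgM; [exact: cst_continuous|exact: ch].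
have c2 : continuous (fun t : R => - a ^+ 2) by move=> t; exact: cst_continuous.
have : prim ((fun t => (2 * a) * h t) \+ (fun=> - a ^+ 2)) b <= prim (fun t => h t ^+ 2) b.
  apply: prim_le => //; first by move=> t; apply: cvgD; [exact: c1|exact: c2].
  move=> t _ /=; rewrite -subr_ge0 (_ : _ - _ = (h t - a) ^+ 2) ?sqr_ge0 //; ring.
rewrite primD // primZ // prim_cst // => H.
rewrite -ler_pdivrMl //; apply: le_trans H.
rewrite (_ : _ + _ = b^-1 * prim h b ^+ 2) // /a; field; exact: lt0r_neq0.
Qed.

Lemma quadratic_scale N (A : 'M[R]_N) (w : 'rV[R]_N) c :
  ((c *: w) *m A *m (c *: w)^T) 0 0 = c ^+ 2 * (w *m A *m w^T) 0 0.
Proof. by rewrite linearZ /= -scalemxAl -scalemxAr -scalemxAl scalerA mxE expr2. Qed.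

(** The constant is minus the maximum of the form on the unit sphere, which is compact; homogeneity
    extends the bound to all vectors. *)
Lemma neg_definite_bound m (A : 'M[R]_m) : neg_definite A ->
  exists2 a : R, 0 < a & forall w : 'rV[R]_m, (w *m A *m w^T) 0 0 <= - a * `|w| ^+ 2.
Proof.
move=> nA; pose S := [set w : 'rV[R]_m | `|w| = 1].
have [S0|/set0P/negP/negPn/eqP S0] := pselect (S !=set0); last first.
  (* An empty sphere means that 0 is the only vector, and any constant works. *)
  exists 1 => // w; suff -> : w = 0 by rewrite !mul0mx mxE normr0 expr0n mulr0.
  apply/eqP; apply: contraT => w0; have : S (`|w|^-1 *: w).
    by rewrite /S /= normrZ normfV normr_id mulVf // normr_eq0.
  by rewrite S0.
have cS : compact S.
  apply: bounded_closed_compact.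
    by exists 1; split => // x x1 w /= ->; exact: ltW.
  rewrite (_ : S = (fun w : 'rV[R]_m => `|w|) @^-1` [set 1 : R]) //.
  by apply: closed_comp; [move=> w _; exact: norm_continuous|exact: closed_eq].
have cQ : {within S, continuous (fun w : 'rV[R]_m => (w *m A *m w^T) 0 0)}.
  apply: continuous_subspaceT => w.
  have -> : (fun w : 'rV[R]_m => (w *m A *m w^T) 0 0) = (fun w => dotp (w *m A) w).
    by apply: funext => y; rewrite dotpE.
  have c2 : {for w, continuous (id : 'rV[R]_m -> 'rV[R]_m)} by exact: cvg_id.
  have c1 : {for w, continuous (fun y : 'rV[R]_m => y *m A)}.
    by apply: (continuous_mulmx c2); exact: cst_continuous.
  exact: (continuous_dotp c1 c2).
have [w0 w0S Hw0] := compact_EVT_max S0 cS cQ.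
move: w0S; rewrite inE => w0S.
exists (- (w0 *m A *m w0^T) 0 0).
  rewrite oppr_gt0; apply: nA; rewrite -normr_eq0; move: w0S; rewrite /S /= => ->; exact: oner_neq0.
move=> w; rewrite opprK; have [->|wN0] := eqVneq w 0.
  by rewrite !mul0mx mxE normr0 expr0n mulr0.
have nw : `|w| != 0 by rewrite normr_eq0.
have wS : (`|w|^-1 *: w) \in S by rewrite inE /S /= normrZ normfV normr_id mulVf.
have := Hw0 _ wS; rewrite quadratic_scale exprVn => H.
by rewrite mulrC -ler_pdivrMl ?exprn_gt0 ?normr_gt0.
Qed.

Lemma near_right_ex (P Q : R -> Prop) : (\forall r \near 0^'+, P r) ->
  (\forall r \near 0^'+, Q r) -> exists2 r : R, 0 < r & P r /\ Q r.
Proof.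
move=> nP nQ; have F := at_right_proper_filter (0 : R).
have [r [[r0 Pr] Qr]] := @filter_ex _ _ F _ (filterI (filterI (nbhs_right_gt 0) nP) nQ).
by exists r.
Qed.

(** Dividing by 1 + c instead of c covers the case c = 0. *)
Lemma scaled_dist_le (V : normedModType R) (x y : V) (a c : R) : 0 <= c ->
  `|x - y| <= a / (1 + c) -> c * `|y - x| <= a.
Proof.
move=> c0; rewrite ler_pdivlMr ?ltr_pwDl // distrC.
by move: `|_| (normr_ge0 (y - x)) => r r0; lra.
Qed.

Lemma bilinear_bound N (A : 'M[R]_N) (a b : 'rV[R]_N) :
  `|(a *m A *m b^T) 0 0| <= N%:R ^+ 2 * `|A| * (`|a| * `|b|).
Proof.
rewrite (le_trans (ler_norm_entry _ _ _)) // (le_trans (ler_norm_mulmx _ _)) //.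
have := ler_norm_mulmx a A => H.
rewrite (@le_trans _ _ (N%:R * ((N%:R * (`|a| * `|A|)) * `|b|))) //.
  by rewrite ler_wpM2l // ler_pM // ler_norm_tr.
by rewrite (_ : N%:R * _ = N%:R ^+ 2 * `|A| * (`|a| * `|b|)) //; ring.
Qed.

Lemma quadratic_perturbation N (A : 'M[R]_N) (a b : 'rV[R]_N) :
  `|((a + b) *m A *m (a + b)^T) 0 0 - (b *m A *m b^T) 0 0|
  <= N%:R ^+ 2 * `|A| * (2 * `|a| * `|b| + `|a| ^+ 2).
Proof.
have -> : ((a + b) *m A *m (a + b)^T) 0 0 - (b *m A *m b^T) 0 0 =
   (a *m A *m b^T) 0 0 + (b *m A *m a^T) 0 0 + (a *m A *m a^T) 0 0.
  rewrite linearD /= !mulmxDl !mulmxDr !mxE; ring.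
rewrite (le_trans (ler_normD _ _)) // (le_trans (lerD (ler_normD _ _) (lexx _))) //.
rewrite (le_trans (lerD (lerD (bilinear_bound A a b) (bilinear_bound A b a)) (bilinear_bound A a a))) //.
rewrite le_eqVlt; apply/orP; left; apply/eqP; ring.
Qed.

(** Isolates the control block: every term of the error has at least one state factor |x|, which is
    the small quantity on a short interval. *)
Lemma quadratic_split p1 p2 (A : 'M[R]_(p1 + p2)) (x : 'rV[R]_p1) (w : 'rV[R]_p2) :
  `|(row_mx x w *m A *m (row_mx x w)^T) 0 0 - (row_mx 0 w *m A *m (row_mx 0 w)^T) 0 0|
  <= (p1 + p2)%:R ^+ 2 * `|A| * (2 * `|x| * `|w| + `|x| ^+ 2).
Proof.
have -> : row_mx x w = row_mx x 0 + row_mx 0 w by rewrite add_row_mx addr0 add0r.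
rewrite (le_trans (quadratic_perturbation _ _ _)) // ler_wpM2l ?mulr_ge0 ?exprn_ge0 //.
have nx : `|row_mx x (0 : 'rV[R]_p2)| <= `|x| by apply: ler_norm_row_mx => //; rewrite normr0.
have nw : `|row_mx (0 : 'rV[R]_p1) w| <= `|w| by apply: ler_norm_row_mx => //; rewrite normr0.
apply: lerD; last by rewrite lerXn2r ?nnegrE.
by apply: ler_pM => //; rewrite ?mulr_ge0 ?ler_wpM2l.
Qed.

End integral_inequalities.

Section local_sufficiency.
Context {R : realType} {n m : nat} (Omega : set 'rV[R]_n)
  (C : state_ctrl R n m -> R) (f : state_ctrl R n m -> 'rV[R]_n)
  (T : R) (q0 v0 qT vT : 'rV[R]_n) (q kappa : R -> 'rV[R]_n) (u : R -> 'rV[R]_m).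
Local Notation N := (n + n + m)%N.
Local Notation E := state_ctrl_basis.
Local Notation D := [set z : state_ctrl R n m | Omega z.1.1].
Context (oOmega : open Omega) (hC : Ck_on 2 D C) (hf : Ck_on 2 D f) (T0 : 0 < T)
  (foc : first_order_conditions Omega C f T q0 v0 qT vT q kappa u).
Local Notation z := (base_curve T q u).
Local Notation v := (derive_within 0 T q).
Local Notation H := (hessian_mx C f T q kappa u).

Let tr : trajectory Omega f 0 T q u. Proof. by case: foc => -[]. Qed.

Section competitor.
Context (b : R) (b0 : 0 < b) (bT : b <= T) (q' : R -> 'rV[R]_n) (u' : R -> 'rV[R]_m)
  (tr' : trajectory Omega f 0 b q' u').
Local Notation v' := (derive_within 0 b q').
Local Notation d := (variation T q u b q' u').
Local Notation z' := (competitor_curve b q' u').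

Lemma variationE t : 0 <= t <= b ->
  d t = row_mx (row_mx (q' t - q t) (v' t - v t)) (u' t - u t).
Proof.
move=> tb; have tT : 0 <= t <= T by case/andP: tb => -> tb /=; exact: le_trans bT.
by rewrite /variation /competitor_curve /base_curve !clamp_id.
Qed.

Lemma is_derive_row_mx p1 p2 (x : R -> 'rV[R]_p1) (y : R -> 'rV[R]_p2) (t : R) dx dy :
  is_derive t 1 x dx -> is_derive t 1 y dy ->
  is_derive t 1 (fun s => row_mx (x s) (y s)) (row_mx dx dy).
Proof.
move=> /is_derive_mxP Dx /is_derive_mxP Dy; apply/is_derive_mxP => i j.
case: (splitP j) => k jk.
  have -> : j = lshift p2 k by apply/val_inj.
  rewrite row_mxEl (_ : (fun s => _) = (fun s => x s i k)) //; apply: funext => s; exact: row_mxEl.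
have -> : j = rshift p1 k by apply/val_inj.
rewrite row_mxEr (_ : (fun s => _) = (fun s => y s i k)) //; apply: funext => s; exact: row_mxEr.
Qed.

Lemma continuous_row_mx (S : topologicalType) p1 p2 (x : S -> 'rV[R]_p1) (y : S -> 'rV[R]_p2) (t : S) :
  {for t, continuous x} -> {for t, continuous y} -> {for t, continuous (fun s => row_mx (x s) (y s))}.
Proof.
move=> /continuous_mxP Dx /continuous_mxP Dy; apply/continuous_mxP => i j.
case: (splitP j) => k jk.
  have -> : j = lshift p2 k by apply/val_inj.
  rewrite (_ : (fun s => _) = (fun s => x s i k)) //; apply: funext => s; exact: row_mxEl.
have -> : j = rshift p1 k by apply/val_inj.
rewrite (_ : (fun s => _) = (fun s => y s i k)) //; apply: funext => s; exact: row_mxEr.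
Qed.

Definition state_velocity t : 'rV[R]_(n + n) :=
  row_mx (rsubmx (lsubmx (d t))) (f (z' t) - f (z (clamp b t))).

Lemma continuous_state_velocity : continuous state_velocity.
Proof.
have cf : Ck_on 0 D f by do 2!apply: Ck_onW.
move=> t; suff : {for t, continuous
    (fun s => row_mx (rsubmx (lsubmx (d s))) (f (z' s) - f (z (clamp b s))))} by [].
apply: continuous_row_mx.
  apply: (continuous_comp (f := fun s => lsubmx (d s))); last exact: continuous_rsubmx.
  apply: (continuous_comp (f := d)); last exact: continuous_lsubmx.
  exact: (continuous_variation T0 foc b0 tr').
apply: cvgB.
  apply: (continuous_comp_domain cf (continuous_competitor b0 tr')) => s.
  exact: (trajectory_clamp tr' b0).
apply: (continuous_comp_domain cf (continuous_base_clamp T0 foc (b := b))) => s.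
exact: (base_curveD T0 foc).
Qed.

Lemma state_variationE t : q' 0 = q 0 /\ v' 0 = v 0 -> 0 <= t <= b ->
  lsubmx (d t) = mprim state_velocity t.
Proof.
move=> [q'0 v'0] tb; have /andP[t0 tb'] := tb.
pose X s := row_mx (q' s - q s) (v' s - v s).
have wc s (W : normedModType R) (g : R -> W) : s <= T -> C0_curve 0 T g -> {within `[0, s], continuous g}.
  by move=> sT cg; apply: continuous_subspaceW cg; apply: subset_itvl; rewrite bnd_simp.
have wc' s (W : normedModType R) (g : R -> W) : s <= b -> C0_curve 0 b g -> {within `[0, s], continuous g}.
  by move=> sT cg; apply: continuous_subspaceW cg; apply: subset_itvl; rewrite bnd_simp.
have tT : t <= T by exact: le_trans bT.
have -> : lsubmx (d t) = X t by rewrite variationE // row_mxKl.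
have := @mprim_unique R 1 (n + n) state_velocity X t continuous_state_velocity t0.
have X0 : X 0 = 0 by rewrite /X q'0 v'0 !subrr row_mx0.
rewrite X0 add0r; apply.
- have wB (g h : R -> 'rV[R]_n) : {within `[0, t], continuous g} -> {within `[0, t], continuous h} ->
      {within `[0, t], continuous (fun s => g s - h s)}.
    by move=> cg ch s; apply: continuousB; [exact: cg|exact: ch].
  have c1 := wB _ _ (wc' _ _ _ tb' (trajectory_cq tr')) (wc _ _ _ tT (trajectory_cq tr)).
  have c2 := wB _ _ (wc' _ _ _ tb' (trajectory_cv tr')) (wc _ _ _ tT (trajectory_cv tr)).
  by move=> s; exact: (continuous_row_mx (c1 s) (c2 s)).
- move=> s; rewrite in_itv /= => /andP[s0 st].
  have sb : 0 <= s <= b by rewrite ltW //= (le_trans (ltW st)).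
  have sT : 0 <= s <= T by rewrite ltW //= (le_trans (ltW st)).
  have sT' : s \in `]0, T[ by rewrite in_itv /= s0 (lt_le_trans st).
  have sb' : s \in `]0, b[ by rewrite in_itv /= s0 (lt_le_trans st).
  rewrite /state_velocity variationE // row_mxKl row_mxKr /competitor_curve !clamp_id // base_curve_id //.
  apply: is_derive_row_mx; apply: is_deriveB.
  + exact: quot_within_is_derive sb' (trajectory_q tr' sb).
  + exact: quot_within_is_derive sT' (trajectory_q tr sT).
  + exact: quot_within_is_derive sb' (trajectory_v tr' sb).
  + exact: quot_within_is_derive sT' (trajectory_v tr sT).
Qed.

(* Gronwall's inequality, in the short-time form [2 (1 + L) b <= 1]. *)
Lemma state_variation_bound L : 0 < L -> 2 * (1 + L) * b <= 1 ->
  (forall t, 0 <= t <= b -> `|f (z' t) - f (z t)| <= L * `|d t|) ->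
  q' 0 = q 0 /\ v' 0 = v 0 ->
  forall t, 0 <= t <= b -> `|lsubmx (d t)| <= 2 * (1 + L) * prim (fun s => `|rsubmx (d s)|) b.
Proof.
move=> L0 Lb fL e0.
have cd : continuous d := continuous_variation T0 foc b0 tr'.
have cx : continuous (fun s => `|lsubmx (d s)|).
  move=> t; apply: cvg_norm; apply: (continuous_comp (f := d)); first exact: cd.
  exact: continuous_lsubmx.
have cw : continuous (fun s => `|rsubmx (d s)|).
  move=> t; apply: cvg_norm; apply: (continuous_comp (f := d)); first exact: cd.
  exact: continuous_rsubmx.
have [t1 t1b Hm] := EVT_max (ltW b0) (continuous_subspaceT cx : {within `[0, b], continuous _}).
have {}t1b : 0 <= t1 <= b by rewrite in_itv in t1b.
set S := `|lsubmx (d t1)| in Hm.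
have HS t : 0 <= t <= b -> `|lsubmx (d t)| <= S by move=> tb; apply: Hm; rewrite in_itv.
have /andP[t10 t1b'] := t1b.
have S0 : 0 <= S := normr_ge0 _.
have ES : `|mprim state_velocity t1| = S by rewrite -state_variationE.
have cLw (c : R) : continuous (fun s => c * `|rsubmx (d s)|).
  by move=> t; apply: cvgM; [exact: cst_continuous|exact: cw].
suff SD : S <= 2 * (1 + L) * prim (fun s => `|rsubmx (d s)|) b.
  by move=> t /HS /le_trans; apply.
set W := prim _ b.
have W1 : prim (fun s => `|rsubmx (d s)|) t1 <= W.
  by apply: prim_nondecreasing => //; rewrite t10.
(* The velocity of the state variation is at most (1 + L) (S + |dw|): its first block is part of d
   and its second is at most L |d|. On a short interval the term in S is then at most S / 2 and
   moves to the left. *)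
have : S <= (1 + L) * S * t1 + (1 + L) * prim (fun s => `|rsubmx (d s)|) t1.
  rewrite -primZ // -prim_cst // -primD //; last by move=> t; exact: cst_continuous.
  rewrite -{1}ES ler_norm_mprim //.
  - exact: continuous_state_velocity.
  - by move=> t; apply: cvgD; [exact: cst_continuous|exact: cLw].
  move=> t /andP[t0 tt1]; have tb : 0 <= t <= b by rewrite t0 (le_trans tt1).
  have dxw : `|d t| <= S + `|rsubmx (d t)|.
    rewrite -[X in `|X| <= _]hsubmxK; apply: ler_norm_row_mx; first by rewrite addr_ge0.
      by rewrite ler_wpDr // HS.
    by rewrite ler_wpDl.
  rewrite /= -mulrDr mulrDl mul1r; apply: ler_norm_row_mx.
  - by rewrite !addr_ge0 // mulr_ge0 ?addr_ge0 // ltW.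
  - rewrite ler_wpDr ?mulr_ge0 ?addr_ge0 ?(ltW L0) //.
    by rewrite (le_trans (ler_norm_rsubmx _)) // ler_wpDr // HS.
  - rewrite clamp_id // ler_wpDl ?addr_ge0 // (le_trans (fL _ tb)) //.
    by rewrite ler_wpM2l // ltW.
move=> H1; have L1 : 0 <= 1 + L by rewrite addr_ge0 // ltW.
have H2 : (1 + L) * S * t1 <= S / 2.
  rewrite (@le_trans _ _ ((1 + L) * S * b)) // ?ler_wpM2l ?mulr_ge0 //.
  have H4 : 0 <= S * (1 - 2 * (1 + L) * b) by rewrite mulr_ge0 // subr_ge0.
  have H5 : (1 + L) * S * b = S * (2 * (1 + L) * b) / 2 by field.
  by rewrite mulrBr mulr1 in H4; rewrite H5; lra.
have H3 : (1 + L) * prim (fun s => `|rsubmx (d s)|) t1 <= (1 + L) * W by rewrite ler_wpM2l.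
lra.
Qed.

End competitor.

Lemma legendre_sufficient :
  (forall t, t \in `[0, T] -> neg_definite (control_hessian C f T q kappa u t)) ->
  exists eps : R, [/\ 0 < eps, eps <= T & locally_optimal Omega C f 0 eps q u].
Proof.
move=> neg.
have T00 : (0 : R) <= 0 <= T by rewrite lexx ltW.
have T00' : (0 : R) \in `[0, T] by rewrite in_itv.
have [a a0 Ha] := neg_definite_bound (neg 0 T00').
have {}Ha (w : 'rV[R]_m) : (row_mx 0 w *m H 0 *m (row_mx 0 w)^T) 0 0 <= - a * `|w| ^+ 2.
  by rewrite (hessian_mx_control oOmega hC hf T0 foc) //; exact: Ha.
have cH := continuous_hessian_mx oOmega hC hf T0 foc.
pose NN : R := (n + n + m)%:R ^+ 2.
have NN0 : 0 <= NN by rewrite exprn_ge0.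
(* Coercivity is known at t = 0; continuity of [H] keeps half of the constant for t < e1. *)
have [e1 e10 He1] : exists2 e1 : R, 0 < e1 & forall t, 0 <= t -> t < e1 -> NN * `|H t - H 0| <= a / 2.
  have a2 : 0 < a / 2 / (1 + NN) by rewrite !divr_gt0 // ltr_pwDl.
  have := cH 0 => /cvgrPdist_le/(_ _ a2)/nbhs_ballP[e1 /= e10 He1].
  exists e1 => // t t0 te; have := He1 t.
  rewrite /ball /= sub0r normrN ger0_norm // => /(_ te).
  exact: scaled_dist_le.
have {}Ha t (w : 'rV[R]_m) : 0 <= t -> t < e1 -> (row_mx 0 w *m H t *m (row_mx 0 w)^T) 0 0 <= - (a / 2) * `|w| ^+ 2.
  move=> t0 te.
  have nw : `|row_mx 0 w : 'rV[R]_N| <= `|w| by apply: ler_norm_row_mx => //; rewrite normr0.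
  have -> : (row_mx 0 w *m H t *m (row_mx 0 w)^T) 0 0 =
     (row_mx 0 w *m H 0 *m (row_mx 0 w)^T) 0 0 + (row_mx 0 w *m (H t - H 0) *m (row_mx 0 w)^T) 0 0.
    by rewrite mulmxBr mulmxBl [X in _ = _ + X]mxE [X in _ = _ + (_ + X)]mxE addrC subrK.
  have B := le_trans (ler_norm _) (bilinear_bound (H t - H 0) (row_mx 0 w) (row_mx 0 w)).
  have : NN * `|H t - H 0| * (`|row_mx 0 w : 'rV[R]_N| * `|row_mx 0 w : 'rV[R]_N|) <= (a / 2) * `|w| ^+ 2.
    by rewrite expr2 ler_pM ?mulr_ge0 ?He1 // ler_pM.
  by have := Ha w; rewrite -/NN in B *; lra.
have [K K0 HK] := continuous_bounded T0 cH.
have [L L0 nearL] := f_lipschitz oOmega hf T0 foc.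
(* The control block contributes -(a / 4) |w|^2. A Taylor error of a / 16 |d|^2 costs at most a / 8
   (S^2 + |w|^2) and leaves -(a / 8) |w|^2. *)
have a16 : 0 < a / 16 by rewrite divr_gt0.
have nearR := near_hamiltonian_remainder oOmega hC hf T0 foc a16.
have [r [r0 HL HR]] : exists r : R, [/\ 0 < r,
    forall t, 0 <= t <= T -> forall d : 'rV[R]_N, `|d| <= r ->
      `|f (z t + lincomb E d) - f (z t)| <= L * `|d| &
    forall b q' u', 0 < b -> b <= T -> forall t, 0 <= t <= b ->
      `|variation T q u b q' u' t| <= r ->
      `|hamiltonian_remainder C f T q kappa u b q' u' t
        - 2^-1 * (variation T q u b q' u' t *m H t *m (variation T q u b q' u' t)^T) 0 0|
      <= a / 16 * `|variation T q u b q' u' t| ^+ 2].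
  by have [r r0 [H1 H2]] := near_right_ex nearL nearR; exists r.
pose L1 := 2 * (1 + L).
have L10 : 0 < L1 by rewrite mulr_gt0 // ltr_pwDl // ltW.
pose KB := NN * K.
have KB0 : 0 <= KB by rewrite mulr_ge0.
(* Coefficient of W^2, W being the integral of |dw|, in the state terms once the state is bounded by
   S = L1 W. *)
pose K2 := L1 * KB + (KB / 2 + a / 8) * L1 ^+ 2.
have K20 : 0 <= K2 by rewrite addr_ge0 ?mulr_ge0 ?addr_ge0 ?divr_ge0 ?exprn_ge0 // ltW.
pose eps := Num.min (Num.min T (e1 / 2)) (Num.min (Num.min 1 (L1^-1)) (a / 8 / (1 + K2))).
have eps0 : 0 < eps.
  rewrite /eps !lt_min T0 invr_gt0 L10 ltr01 !divr_gt0 //; exact: ltr_pwDl.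
have epsT : eps <= T by rewrite /eps !ge_min lexx.
have epse : eps < e1.
  by rewrite (@le_lt_trans _ _ (e1 / 2)) // ?ltr_pdivrMr // ?ltr_pMr ?ltr1n // /eps !ge_min lexx !orbT.
have eps1 : eps <= 1 by rewrite /eps !ge_min lexx !orbT.
have epsL : L1 * eps <= 1.
  by rewrite mulrC -ler_pdivlMr // mul1r /eps !ge_min lexx !orbT.
have epsK : K2 * eps <= a / 8.
  have : eps <= a / 8 / (1 + K2) by rewrite /eps !ge_min lexx !orbT.
  by rewrite ler_pdivlMr ?ltr_pwDl // => h; have e0 := ltW eps0; lra.
exists eps; split => //; split; first by apply: (trajectory_restrict tr); rewrite eps0.
exists r => // q' u' tr' s0 s1 close.
have Ev t : 0 <= t <= eps -> derive_within 0 eps q t = v t.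
  by apply: (derive_within_restrict (b := T)) => [|s]; [rewrite eps0|exact: (trajectory_q tr)].
have {}s0 : q' 0 = q 0 /\ derive_within 0 eps q' 0 = v 0.
  by case: s0 => -> ->; rewrite Ev // lexx ltW.
have {}s1 : q' eps = q eps /\ derive_within 0 eps q' eps = v eps.
  by case: s1 => -> ->; rewrite Ev // lexx ltW.
rewrite -subr_ge0 (cost_difference oOmega hC hf T0 foc eps0 epsT tr' s0 s1) oppr_ge0.
pose d := variation T q u eps q' u'.
have cd : continuous d := continuous_variation T0 foc eps0 tr'.
have dr t : 0 <= t <= eps -> `|d t| <= r.
  move=> tb; have [] := close t; first by rewrite in_itv.
  rewrite Ev // /d (variationE epsT) // => /ltW h1 /ltW h2 /ltW h3.
  by do 2?apply: ler_norm_row_mx => //; exact: ltW.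
have sub t : 0 <= t <= eps -> 0 <= t <= T by case/andP => -> te /=; exact: le_trans epsT.
have xb := state_variation_bound eps0 epsT tr' L0 epsL.
have {}xb t : 0 <= t <= eps -> `|lsubmx (d t)| <= L1 * prim (fun s => `|rsubmx (d s)|) eps.
  apply: xb => // s se; have := HL s (sub _ se) _ (dr _ se).
  by rewrite -{1}(clamp_id se) -competitorE.
set W := prim (fun s => `|rsubmx (d s)|) eps in xb.
have cw : continuous (fun s => `|rsubmx (d s)|).
  move=> t; apply: cvg_norm; apply: (continuous_comp (f := d)); first exact: cd.
  exact: continuous_rsubmx.
have cw2 : continuous (fun s => `|rsubmx (d s)| ^+ 2).
  by move=> t; rewrite (_ : (fun s => _) = (fun s => `|rsubmx (d s)| * `|rsubmx (d s)|)) //; apply: cvgM; exact: cw.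
have W0 : 0 <= W by rewrite -(prim0 (fun s => `|rsubmx (d s)|)) prim_nondecreasing // lexx ltW.
set W2 := prim (fun s => `|rsubmx (d s)| ^+ 2) eps.
have WW2 : W ^+ 2 <= eps * W2 by exact: prim_square_le.
pose S := L1 * W.
have S0 : 0 <= S by rewrite mulr_ge0 // ltW.
have crem := continuous_hamiltonian_remainder oOmega hC hf T0 foc eps0 tr'.
have pw t : 0 <= t <= eps -> hamiltonian_remainder C f T q kappa u eps q' u' t <=
    ((fun s => (- (a / 8)) * `|rsubmx (d s)| ^+ 2) \+
    ((fun s => (KB * S) * `|rsubmx (d s)|) \+ (fun=> (KB / 2 + a / 8) * S ^+ 2))) t.
  move=> te; have /andP[t0 te'] := te.
  have := HR _ _ _ eps0 epsT t te (dr t te); rewrite -/(d t).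
  set w := rsubmx (d t) in xb *; set x := lsubmx (d t).
  have xS : `|x| <= S by exact: xb.
  have -> : d t = row_mx x w by rewrite hsubmxK.
  have := quadratic_split (H t) x w.
  have := Ha t w t0 (le_lt_trans te' epse).
  have nd : `|row_mx x w| <= S + `|w|.
    apply: ler_norm_row_mx; first by rewrite addr_ge0.
      by rewrite ler_wpDr.
    by rewrite ler_wpDl.
  set rm := hamiltonian_remainder _ _ _ _ _ _ _ _ _ _.
  set Q := (row_mx x w *m _ *m _) 0 0; set Qw := (row_mx 0 w *m _ *m _) 0 0.
  rewrite -/NN => HQw HQ Hrm.
  have nx := normr_ge0 x; have nw := normr_ge0 w.
  have HQ' : Q <= Qw + KB * (2 * S * `|w| + S ^+ 2).
    have := le_trans (ler_norm _) HQ; rewrite lerBlDl => /le_trans; apply.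
    rewrite lerD2l ler_pM ?mulr_ge0 ?addr_ge0 ?mulr_ge0 ?exprn_ge0 //.
      by rewrite ler_wpM2l // HK // sub.
    by rewrite lerD ?ler_wpM2r ?ler_wpM2l // ler_pXn2r.
  have Hrm' : rm <= 2^-1 * Q + a / 16 * (S + `|w|) ^+ 2.
    have := le_trans (ler_norm _) Hrm; rewrite lerBlDl => /le_trans; apply.
    by rewrite lerD2l ler_wpM2l ?ler_pXn2r // ?nnegrE ?addr_ge0 // ltW.
  have sq : (S + `|w|) ^+ 2 <= 2 * S ^+ 2 + 2 * `|w| ^+ 2.
    rewrite -subr_ge0 (_ : _ - _ = (S - `|w|) ^+ 2) ?sqr_ge0 //; ring.
  rewrite /=; have := ler_wpM2l (ltW a16) sq; lra.
have cA : continuous (fun s => (- (a / 8)) * `|rsubmx (d s)| ^+ 2).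
  by move=> t; apply: cvgM; [exact: cst_continuous|exact: cw2].
have cB : continuous (fun s => (KB * S) * `|rsubmx (d s)|).
  by move=> t; apply: cvgM; [exact: cst_continuous|exact: cw].
have cC' : continuous (fun _ : R => (KB / 2 + a / 8) * S ^+ 2) by move=> t; exact: cst_continuous.
have cBC : continuous ((fun s => (KB * S) * `|rsubmx (d s)|) \+ (fun=> (KB / 2 + a / 8) * S ^+ 2)).
  by move=> t; apply: cvgD; [exact: cB|exact: cC'].
have cABC : continuous ((fun s => (- (a / 8)) * `|rsubmx (d s)| ^+ 2) \+
    ((fun s => (KB * S) * `|rsubmx (d s)|) \+ (fun=> (KB / 2 + a / 8) * S ^+ 2))).
  by move=> t; apply: cvgD; [exact: cA|exact: cBC].
have eps0' := ltW eps0.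
rewrite (le_trans (prim_le crem cABC eps0' pw)) //.
rewrite primD // primD // prim_cst // primZ // primZ // -/W -/W2.
have : (KB / 2 + a / 8) * S ^+ 2 * eps <= (KB / 2 + a / 8) * S ^+ 2.
  by rewrite ler_piMr // mulr_ge0 ?exprn_ge0 // addr_ge0 ?divr_ge0 // ltW.
have : KB * S * W + (KB / 2 + a / 8) * S ^+ 2 = K2 * W ^+ 2 by rewrite /K2 /S; ring.
have : K2 * W ^+ 2 <= a / 8 * W2.
  rewrite (le_trans (ler_wpM2l K20 WW2)) // mulrA ler_wpM2r //.
  by rewrite -(prim0 (fun s => `|rsubmx (d s)| ^+ 2)) prim_nondecreasing ?lexx // => t _; rewrite exprn_ge0.
lra.
Qed.

End local_sufficiency.

(** * Necessity *)

Section continuous_matrix_functions.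
Context {R : realType} {p1 p2 : nat}.

Lemma cont_mulmx p3 (M : R -> 'M[R]_(p1, p2)) (M' : R -> 'M[R]_(p2, p3)) :
  continuous M -> continuous M' -> continuous (fun s => M s *m M' s).
Proof. by move=> c c' t; apply: continuous_mulmx; [exact: c|exact: c']. Qed.

Lemma cont_trmx (M : R -> 'M[R]_(p1, p2)) : continuous M -> continuous (fun t => (M t)^T).
Proof.
move=> cM t; apply/continuous_mxP => i j.
rewrite (_ : (fun s => (M s)^T i j) = (fun s => M s j i)).
  exact: (@continuous_entry R p1 p2 M j i cM t).
by apply: funext => s; rewrite mxE.
Qed.

Lemma cont_add (M M' : R -> 'M[R]_(p1, p2)) :
  continuous M -> continuous M' -> continuous (fun s => M s + M' s).
Proof. by move=> c c' t; apply: cvgD; [exact: c|exact: c']. Qed.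

Lemma cont_sub (M M' : R -> 'M[R]_(p1, p2)) :
  continuous M -> continuous M' -> continuous (fun s => M s - M' s).
Proof. by move=> c c' t; apply: cvgB; [exact: c|exact: c']. Qed.

Lemma cont_opp (M : R -> 'M[R]_(p1, p2)) : continuous M -> continuous (fun s => - M s).
Proof. by move=> c t; apply: cvgN; exact: c. Qed.

Lemma cont_cst (M : 'M[R]_(p1, p2)) : continuous (fun _ : R => M).
Proof. by move=> t; exact: cst_continuous. Qed.

End continuous_matrix_functions.

(** * Steering a linear system with a source term by means of its gramian *)

Section steering.
Context {R : realType} {p m : nat} (A : R -> 'M[R]_p) (B : R -> 'M[R]_(m, p)) (T : R).
Context (T0 : 0 < T) (cA : continuous A) (cB : continuous B).

(** [linear_ode] multiplies the unknown from the left, so [Psi] is obtained as the transpose of a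
    solution of the adjoint equation. The product [Phi *m Psi] has derivative 0 and starts at the
    identity. *)
Lemma resolvent (KA : R) : (forall t, `|A t| <= KA) ->
  exists Phi Psi : R -> 'M[R]_p, [/\ continuous Phi, continuous Psi,
    Phi 0 = 1%:M /\ Psi 0 = 1%:M,
    (forall t, t \in `]0, T[ -> is_derive t 1 Phi (Phi t *m A t) /\
       is_derive t 1 Psi (- (A t *m Psi t))) &
    (forall t, 0 <= t <= T -> Phi t *m Psi t = 1%:M)].
Proof.
move=> AK; have [Phi [cP P0 dP]] := linear_ode 1%:M (ltW T0) cA AK.
have cA' : continuous (fun t => - (A t)^T) := cont_opp (cont_trmx cA).
have AK' t : `|- (A t)^T| <= KA by rewrite normrN (le_trans (ler_norm_tr _)).
have [Y [cY Y0 dY]] := linear_ode 1%:M (ltW T0) cA' AK'.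
pose Psi t := (Y t)^T.
have cPsi : continuous Psi := cont_trmx cY.
have dPsi t : t \in `]0, T[ -> is_derive t 1 Psi (- (A t *m Psi t)).
  move=> /dY/is_derive_mxP dYt; apply/is_derive_mxP => i j; have := dYt j i.
  rewrite (_ : (fun s => Psi s i j) = (fun s => Y s j i)); last by apply: funext => s; rewrite mxE.
  by rewrite (_ : (- (A t *m Psi t)) i j = (Y t *m - (A t)^T) j i) // mulmxN -[A t]trmxK -trmx_mul trmxK !mxE.
exists Phi, Psi; split => //.
- by rewrite /Psi Y0 trmx1.
- by move=> t tT; split; [exact: dP|exact: dPsi].
move=> t /andP[t0 tT].
have cst0 : continuous (fun _ : R => 0 : 'M[R]_p) by move=> s; exact: cst_continuous.
have mp0 : mprim (fun=> 0) t = 0 :> 'M[R]_p by apply/matrixP => i j; rewrite !mxE prim_cst // mul0r.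
have Psi0 : Psi 0 = 1%:M by rewrite /Psi Y0 trmx1.
pose F s := Phi s *m Psi s.
have cF : {within `[0, t], continuous F} by exact: (continuous_subspaceT (cont_mulmx cP cPsi)).
have dF s : s \in `]0, t[ -> is_derive s 1 F 0.
  rewrite in_itv /= => /andP[s0 st].
  have sT : s \in `]0, T[ by rewrite in_itv /= s0 (lt_le_trans st).
  have -> : 0 = Phi s *m A s *m Psi s + Phi s *m - (A s *m Psi s) by rewrite mulmxN mulmxA subrr.
  by apply: is_derive_mulmx; [exact: dP|exact: dPsi].
by rewrite -[LHS]/(F t) (mprim_unique cst0 t0 cF dF) mp0 addr0 /F P0 Psi0 mulmx1.
Qed.

Context (Phi Psi : R -> 'M[R]_p) (cPhi : continuous Phi) (cPsi : continuous Psi)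
  (dPhi : forall t, t \in `]0, T[ -> is_derive t 1 Phi (Phi t *m A t))
  (PP : forall t, 0 <= t <= T -> Phi t *m Psi t = 1%:M).

(** The response to a control: starting from 0, w leads to (int_0^t w B Psi) Phi t. The gramian is
    the matrix of the form x -> int |x (B Psi)^T|^2. *)
Definition steer t : 'M[R]_(m, p) := B t *m Psi t.

Definition gramian t : 'M[R]_p := mprim (fun s => (steer s)^T *m steer s) t.

Lemma continuous_steer : continuous steer.
Proof. exact: (cont_mulmx cB cPsi). Qed.

Lemma continuous_steer_sqr : continuous (fun s => (steer s)^T *m steer s).
Proof. exact: (cont_mulmx (cont_trmx continuous_steer) continuous_steer). Qed.

(** The primitive is nondecreasing from 0 to 0, hence constant, so [h] vanishes in the interior;
    continuity excludes a positive value at an endpoint. *)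
Lemma prim_eq0 (h : R -> R) : continuous h -> (forall t, 0 <= t <= T -> 0 <= h t) ->
  prim h T = 0 -> forall t, 0 <= t <= T -> h t = 0.
Proof.
move=> ch h0 hT.
have P0 s : 0 <= s <= T -> prim h s = 0.
  move=> /andP[s0 sT]; have h1 : prim h s <= prim h T.
    apply: prim_nondecreasing; rewrite ?s0 // => r /andP[sr rT].
    by apply: h0; rewrite rT (le_trans s0).
  have h2 : prim h 0 <= prim h s.
    apply: prim_nondecreasing; rewrite ?lexx // => r /andP[r0 rs].
    by apply: h0; rewrite r0 (le_trans rs).
  by rewrite hT in h1; rewrite prim0 in h2; apply/eqP; rewrite eq_le h1.
have z s : s \in `]0, T[ -> h s = 0.
  move=> sT; have sT' : 0 <= s <= T by move: sT; rewrite in_itv /= => /andP[/ltW -> /ltW].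
  have dq : quot_within 0 T (fun=> 0) s --> h s.
    apply: (eq_quot_within (g := prim h)) => //.
    by apply: is_derive_quot_within; apply: is_derive_prim => //; case/andP: sT'.
  have [_ <-] := quot_within_is_derive sT dq; exact: derive_cst.
move=> t tT; apply/eqP; rewrite eq_le h0 // andbT leNgt; apply/negP => ht.
have /cvgrPdist_lt/(_ _ ht)/nbhs_ballP[e /= e0 He] := ch t.
(* A shift by e1 towards the middle of [0, T] lands in the open interval and stays within e of t. *)
pose e1 := Num.min (e / 2) (T / 4).
have e10 : 0 < e1 by rewrite lt_min !divr_gt0.
have e1e : e1 < e by rewrite (@le_lt_trans _ _ (e / 2)) ?ge_min ?lexx //; lra.
have e1T : e1 <= T / 4 by rewrite ge_min lexx orbT.
have contra s : s \in `]0, T[ -> `|t - s| < e -> False.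
  by move=> sT ts; have := He s ts; rewrite (z s sT) subr0 ger0_norm ?h0 // ltxx.
case/andP: tT => t0 tT; have [tT2|tT2] := leP t (T / 2).
  apply: (contra (t + e1)).
    by rewrite in_itv /=; apply/andP; split; lra.
  by rewrite opprD addrA subrr add0r normrN gtr0_norm.
apply: (contra (t - e1)); first by rewrite in_itv /=; apply/andP; split; lra.
by rewrite opprB addrC subrK gtr0_norm.
Qed.

(** For x in the kernel, x G x^T is the integral of |x steer^T|^2; it vanishes, so the continuous
    integrand does. *)
Lemma singular_gramian : gramian T \notin unitmx ->
  exists2 x : 'rV[R]_p, x != 0 & forall t, 0 <= t <= T -> x *m (steer t)^T = 0.
Proof.
rewrite -row_free_unit -kermx_eq0 => /rowV0Pn[x xk x0]; exists x => //.
move/sub_kermxP: xk => xG.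
pose y t := x *m (steer t)^T.
have cy : continuous y.
  exact: (@cont_mulmx R 1 p m (fun=> x) (fun t => (steer t)^T) (@cont_cst R 1 p x) (cont_trmx continuous_steer)).
have cyy : continuous (fun t => dotp (y t) (y t)).
  by move=> t; apply: continuous_dotp; exact: cy.
have yy0 t : 0 <= dotp (y t) (y t) by apply: sumr_ge0 => i _; rewrite -expr2 sqr_ge0.
have G0 : prim (fun t => dotp (y t) (y t)) T = 0.
  have -> : prim (fun t => dotp (y t) (y t)) T = (x *m gramian T *m x^T) 0 0.
    pose F (t : R) : R := (x *m gramian t *m x^T) 0 0.
    have F0 : F 0 = 0 by rewrite /F /gramian mprim0 mulmx0 mul0mx mxE.
    rewrite -[RHS]/(F T) -[RHS]subr0 -F0.
    have dF (t : R) : 0 <= t -> is_derive t 1 F (dotp (y t) (y t)).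
      move=> t0; have dG := is_derive_mprim continuous_steer_sqr t0.
      have D1 := is_derive_mulmx (is_derive_cst x t 1) dG.
      have /is_derive_mxP/(_ 0 0) := is_derive_mulmx D1 (is_derive_cst x^T t 1).
      rewrite mul0mx add0r mulmx0 addr0 (_ : (x *m _ *m x^T) 0 0 = dotp (y t) (y t)) //.
      by rewrite dotpE /y (trmx_mul x) trmxK !mulmxA.
    apply: prim_unique => //; first exact: ltW.
      apply: within_continuous => t; rewrite in_itv => /andP[t0 _]; have ? := dF t t0.
      by apply/differentiable_continuous/derivable1_diffP; exact: ex_derive.
    by move=> t; rewrite in_itv => /andP[/ltW t0 _]; exact: dF.
  by rewrite xG mul0mx mxE.
move=> t tT; have := prim_eq0 cyy (fun t _ => yy0 t) G0 tT => yt0.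
apply/rowP => i; rewrite [RHS]mxE -/(y t); apply/eqP; rewrite -sqrf_eq0 expr2.
have /eqP := yt0; rewrite psumr_eq0; last by move=> j _; rewrite -expr2 sqr_ge0.
by move/allP/(_ i); rewrite mem_index_enum => /(_ isT).
Qed.

Implicit Types (w : R -> 'rV[R]_m) (s : R -> 'rV[R]_p).

(** Variation of constants: times [Phi], this is the solution from 0 of x' = x A + w B + s. *)
Definition forced w s t : 'rV[R]_p := mprim (fun r => (w r *m B r + s r) *m Psi r) t.
Definition steering_coef w s : 'rV[R]_p := - (forced w s T *m invmx (gramian T)).
(* The control of least L^2 norm that brings the forced state back to 0 at time
   T is added to [w]. *)
Definition steering_control w s t : 'rV[R]_m := w t + steering_coef w s *m (steer t)^T.
Definition steering_state w s t : 'rV[R]_p :=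
  (forced w s t + steering_coef w s *m gramian t) *m Phi t.

Context (G1 : gramian T \in unitmx).

Lemma continuous_forcing w s : continuous w -> continuous s ->
  continuous (fun r => (w r *m B r + s r) *m Psi r).
Proof.
move=> cw cs; exact: (cont_mulmx (cont_add (cont_mulmx cw cB) cs) cPsi).
Qed.

Lemma steering_state0 w s : steering_state w s 0 = 0.
Proof. by rewrite /steering_state /forced /gramian !mprim0 mulmx0 addr0 mul0mx. Qed.

Lemma steering_stateT w s : steering_state w s T = 0.
Proof.
by rewrite /steering_state /steering_coef mulNmx -mulmxA mulVmx // mulmx1 subrr mul0mx.
Qed.

Lemma is_derive_steering_core w s (t : R) : continuous w -> continuous s -> 0 <= t ->
  is_derive t 1 (fun r => forced w s r + steering_coef w s *m gramian r)
    ((steering_control w s t *m B t + s t) *m Psi t).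
Proof.
move=> cw cs t0.
have D1 := is_derive_mprim (continuous_forcing cw cs) t0.
have D2 := is_derive_mulmx (is_derive_cst (steering_coef w s) t 1) (is_derive_mprim continuous_steer_sqr t0).
apply: (is_derive_eq (is_deriveD D1 D2)).
have E : (w t *m B t + s t) *m Psi t + steering_coef w s *m ((steer t)^T *m steer t)
    = (steering_control w s t *m B t + s t) *m Psi t.
  by rewrite /steering_control !mulmxDl -!mulmxA addrAC.
by rewrite mul0mx add0r.
Qed.

Lemma is_derive_steering_state w s (t : R) : continuous w -> continuous s -> t \in `]0, T[ ->
  is_derive t 1 (steering_state w s)
    (steering_state w s t *m A t + steering_control w s t *m B t + s t).
Proof.
move=> cw cs tT; have tT' : 0 <= t <= T by move: tT; rewrite in_itv /= => /andP[/ltW -> /ltW].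
have D1 := is_derive_mulmx (is_derive_steering_core cw cs (proj1 (andP tT'))) (dPhi tT).
apply: (is_derive_eq D1).
by rewrite -(mulmxA _ (Psi t)) (mulmx1C (PP tT')) mulmx1 mulmxA [LHS]addrC addrA.
Qed.

Lemma continuous_steering_state w s (t : R) : continuous w -> continuous s -> 0 <= t ->
  {for t, continuous (steering_state w s)}.
Proof.
move=> cw cs t0; apply: continuous_mulmx; last exact: cPhi.
have ? := is_derive_steering_core cw cs t0.
by apply/differentiable_continuous/derivable1_diffP; exact: ex_derive.
Qed.

Lemma continuous_steering_control w s : continuous w -> continuous s -> continuous (steering_control w s).
Proof.
move=> cw cs; apply: (cont_add cw).
exact: (@cont_mulmx R 1 p m (fun=> steering_coef w s) (fun t => (steer t)^T)
  (@cont_cst R 1 p (steering_coef w s)) (cont_trmx continuous_steer)).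
Qed.

(** The bound is by the integral of the majorant, not by its maximum: for a bump of height s and
    width h both the state and the correction of the control are then O(s h). The constant depends
    on the system alone. *)
Lemma steering_bound : exists2 M : R, 0 <= M & forall w s (mu : R -> R),
  continuous w -> continuous s -> continuous mu ->
  (forall t, 0 <= t <= T -> `|w t| + `|s t| <= mu t) ->
  forall t, 0 <= t <= T -> `|steering_state w s t| <= M * prim mu T /\
    `|steering_control w s t - w t| <= M * prim mu T.
Proof.
have [K1 K10 H1] := continuous_bounded T0 cB.
have [K2 K20 H2] := continuous_bounded T0 cPsi.
have [K3 K30 H3] := continuous_bounded T0 cPhi.
have [K4 K40 H4] := continuous_bounded T0 continuous_steer.
have cg : continuous (fun t => gramian (clamp T t)).
  move=> t; apply: (continuous_comp (f := clamp T)); first exact: continuous_clamp.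
  by apply: continuous_mprim; [exact: continuous_steer_sqr|case/andP: (clamp_itv t (ltW T0))].
have [K5 K50 H5] := continuous_bounded T0 cg.
(* Relative to the integral of mu, the constants a, b and c bound [forced], [steering_coef] and
   [steering_state] in turn. *)
pose a : R := p%:R * ((m%:R * K1 + 1) * K2).
pose b : R := p%:R * (a * `|invmx (gramian T)|).
pose c : R := p%:R * ((a + p%:R * (b * K5)) * K3).
have a0 : 0 <= a by rewrite !mulr_ge0 // addr_ge0 ?mulr_ge0.
have b0 : 0 <= b by rewrite /b mulr_ge0 // mulr_ge0.
have c0 : 0 <= c by rewrite /c mulr_ge0 // mulr_ge0 // addr_ge0 // mulr_ge0 // mulr_ge0.
exists (c + p%:R * (b * K4)); first by rewrite addr_ge0 // mulr_ge0 // mulr_ge0.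
move=> w s mu cw cs cmu wsmu.
have mu0 t : 0 <= t <= T -> 0 <= mu t by move=> /wsmu; apply: le_trans; rewrite addr_ge0.
have I0 : 0 <= prim mu T.
  by rewrite -(prim0 mu) prim_nondecreasing ?lexx ?ltW.
have If t : 0 <= t <= T -> `|forced w s t| <= a * prim mu T.
  move=> /andP[t0 tT]; apply: (@le_trans _ _ (prim (fun r => a * mu r) t)).
    apply: ler_norm_mprim => //; first exact: continuous_forcing.
      by move=> r; apply: cvgM; [exact: cst_continuous|exact: cmu].
    move=> r /andP[r0 rt]; have rT : 0 <= r <= T by rewrite r0 (le_trans rt).
    rewrite (le_trans (ler_norm_mulmx _ _)) // /a -[leRHS]mulrA ler_wpM2l // [leRHS]mulrAC.
    rewrite ler_pM // ?H2 // (le_trans (ler_normD _ _)) // mulrDl mul1r.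
    have := wsmu r rT; have nw := normr_ge0 (w r); have ns := normr_ge0 (s r) => ws.
    rewrite lerD //; last by rewrite (le_trans _ ws) // lerDr.
    rewrite (le_trans (ler_norm_mulmx _ _)) // -mulrA ler_wpM2l // mulrC ler_pM // ?H1 //.
    by rewrite (le_trans _ ws) // lerDl.
  by rewrite primZ // ler_wpM2l // prim_nondecreasing // ?t0 // => r /andP[tr rT]; apply: mu0; rewrite rT (le_trans t0).
have TT : 0 <= T <= T by rewrite lexx ltW.
have Ic : `|steering_coef w s| <= b * prim mu T.
  rewrite /steering_coef normrN (le_trans (ler_norm_mulmx _ _)) // /b -[leRHS]mulrA ler_wpM2l //.
  by rewrite [leRHS]mulrAC ler_wpM2r // If.
move=> t tT; split.
  apply: (@le_trans _ _ (c * prim mu T)); last by rewrite ler_wpM2r // lerDl mulr_ge0 // mulr_ge0.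
  rewrite /steering_state (le_trans (ler_norm_mulmx _ _)) // /c -[leRHS]mulrA ler_wpM2l //.
  rewrite [leRHS]mulrAC ler_pM ?H3 // mulrDl (le_trans (ler_normD _ _)) // lerD ?If //.
  rewrite (le_trans (ler_norm_mulmx _ _)) // -[leRHS]mulrA ler_wpM2l // [leRHS]mulrAC ler_pM //.
  by have := H5 t tT; rewrite clamp_id.
rewrite /steering_control addrAC subrr add0r (le_trans (ler_norm_mulmx _ _)) //.
apply: (@le_trans _ _ (p%:R * (b * K4) * prim mu T)); last by rewrite ler_wpM2r // lerDr.
rewrite -[leRHS]mulrA ler_wpM2l // [leRHS]mulrAC ler_pM //.
by rewrite (le_trans (ler_norm_tr _)) // H4.
Qed.

(** Steering is affine in the source and the control w cancels, so [steering_bound] with zero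
    control estimates differences. *)
Lemma steering_linear w s s' t : continuous w -> continuous s -> continuous s' -> 0 <= t <= T ->
  steering_state w s t - steering_state w s' t = steering_state (fun=> 0) (fun r => s r - s' r) t /\
  steering_control w s t - steering_control w s' t = steering_control (fun=> 0) (fun r => s r - s' r) t.
Proof.
move=> cw cs cs' /andP[t0 tT].
have F r : 0 <= r -> forced (fun=> 0) (fun r => s r - s' r) r = forced w s r - forced w s' r.
  move=> r0; rewrite /forced -mprimB //; try exact: continuous_forcing.
  congr (mprim _ r); apply: funext => x.
  by rewrite mul0mx add0r -mulmxBl opprD addrACA subrr add0r.
have Ec : steering_coef (fun=> 0) (fun r => s r - s' r) = steering_coef w s - steering_coef w s'.
  by rewrite /steering_coef F ?ltW // mulmxBl opprD.
split.
  rewrite /steering_state Ec F // -mulmxBl; congr (_ *m _).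
  by rewrite mulmxBl opprD addrACA.
by rewrite /steering_control Ec mulmxBl add0r opprD addrACA subrr add0r.
Qed.

(* The ball of radius [4 M W] around [row_mx 0 w], where [W = prim mu T], is
   invariant since [M ((1 + e) W + 4 e M W T) <= 4 M W]. *)
Lemma steering_fixed_point : exists2 M : R, 0 <= M &
  forall (g : R -> 'rV[R]_(p + m) -> 'rV[R]_p) (r e : R) (w : R -> 'rV[R]_m) (mu : R -> R),
  (forall y, continuous y -> (forall t, `|y t| <= r) -> continuous (fun t => g t (y t))) ->
  (forall t, 0 <= t <= T -> g t 0 = 0 /\ forall d d' : 'rV[R]_(p + m), `|d| <= r -> `|d'| <= r ->
     `|g t d - g t d'| <= e * `|d - d'|) ->
  0 <= e <= 1 -> 2 * M * e * T <= 1 -> continuous w -> continuous mu ->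
  (forall t, 0 <= t <= T -> `|w t| <= mu t /\ mu t + 4 * M * prim mu T <= r) ->
  exists2 y : R -> 'rV[R]_(p + m), continuous y /\ (forall t, `|y t| <= r) &
    forall t, 0 <= t <= T -> `|y t - row_mx 0 (w t)| <= 4 * M * prim mu T /\
      y t = row_mx (steering_state w (fun r => g r (y r)) t) (steering_control w (fun r => g r (y r)) t).
Proof.
have [M M0 HM] := steering_bound; exists M => // g r e w mu cg Hg /andP[e0 e1] MeT cw cmu wmu.
have T0' := ltW T0; have ct t := clamp_itv t T0'.
set W := prim mu T in wmu *.
have mu0 t : 0 <= t <= T -> 0 <= mu t by move=> /wmu[h _]; exact: le_trans h.
have W0 : 0 <= W by rewrite /W -(prim0 mu) prim_nondecreasing ?lexx.
pose c := 4 * M * W.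
have c0 : 0 <= c by rewrite !mulr_ge0.
pose y0 t : 'rV[R]_(p + m) := row_mx 0 (w (clamp T t)).
have ny0 t : `|y0 t| <= mu (clamp T t).
  by apply: ler_norm_row_mx; rewrite ?normr0 ?mu0 //; have [] := wmu _ (ct t).
have crow (x : R -> 'rV[R]_p) (x' : R -> 'rV[R]_m) : continuous x -> continuous x' ->
    continuous (fun t => row_mx (x t) (x' t)).
  by move=> cx cx' t; apply: continuous_row_mx; [exact: cx|exact: cx'].
have cwc : continuous (fun t => w (clamp T t)).
  by move=> t; apply: (continuous_comp (f := clamp T)); [exact: continuous_clamp|exact: cw].
have cy0 : continuous y0 by apply: crow => // t; exact: cst_continuous.
pose P (y : R -> 'rV[R]_(p + m)) := continuous y /\ forall t, `|y t - y0 t| <= c.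
have Pr y : P y -> forall t, `|y t| <= mu (clamp T t) + c.
  move=> [_ Py] t; rewrite -(subrK (y0 t) (y t)) (le_trans (ler_normD _ _)) // addrC.
  by rewrite lerD.
have Pr' y : P y -> forall t, `|y t| <= r.
  by move=> Py t; rewrite (le_trans (Pr _ Py t)) //; have [] := wmu _ (ct t).
have cs y : P y -> continuous (fun t => g t (y t)).
  by move=> Py; apply: cg; [case: Py|exact: Pr'].
pose S y (t : R) := g t (y t).
pose G (y : R -> 'rV[R]_(p + m)) t : 'rV[R]_(p + m) :=
  row_mx (steering_state w (S y) (clamp T t)) (steering_control w (S y) (clamp T t)).
have cG y : P y -> continuous (G y).
  move=> Py; apply: crow => t; apply: (continuous_comp (f := clamp T)).
  - exact: continuous_clamp.
  - by apply: continuous_steering_state; [exact: cw|exact: cs|case/andP: (ct t)].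
  - exact: continuous_clamp.
  - by apply: continuous_steering_control; [exact: cw|exact: cs].
have invar y : P y -> forall t, `|G y t - y0 t| <= c.
  move=> Py t.
  (* Majorant of |w| + |g(y)|: as g vanishes at 0, |g(y)| <= e |y| <= e (mu + c). *)
  have cmu' : continuous (fun t => (1 + e) * mu t + e * c).
    by move=> x; apply: cvgD; [apply: cvgM; [exact: cst_continuous|exact: cmu]|exact: cst_continuous].
  have ws x : 0 <= x <= T -> `|w x| + `|S y x| <= (1 + e) * mu x + e * c.
    move=> xT; have [g0 gl] := Hg x xT; have [wx _] := wmu x xT.
    have r0 : 0 <= r by exact: le_trans (Pr' _ Py x).
    have := gl (y x) 0 (Pr' _ Py x); rewrite normr0 g0 !subr0 => /(_ r0) gy.
    have := ler_wpM2l e0 (Pr _ Py x); rewrite clamp_id // /S.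
    move: `|w x| `|g x (y x)| `|y x| wx gy => a b d wx gy; lra.
  have [h1 h2] := HM w (S y) _ cw (cs _ Py) cmu' ws _ (ct t).
  have cemu : continuous (fun t => (1 + e) * mu t) by move=> x; apply: cvgM; [exact: cst_continuous|exact: cmu].
  have cec : continuous (fun _ : R => e * c) by move=> x; exact: cst_continuous.
  have pE : prim (fun t => (1 + e) * mu t + e * c) T = (1 + e) * W + e * c * T.
    by rewrite -[LHS]/(prim ((fun t => (1 + e) * mu t) \+ (fun=> e * c)) T) primD // primZ // prim_cst.
  (* Each term takes half of c = 4 M W: M (1 + e) W <= 2 M W because e <= 1, and M e c T <= c / 2
     because 2 M e T <= 1. *)
  have le_c : M * prim (fun t => (1 + e) * mu t + e * c) T <= c.
    rewrite pE; have MW : 0 <= M * W by rewrite mulr_ge0.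
    have H1 := ler_wpM2l MW e1; have H2 := ler_wpM2r c0 MeT.
    rewrite {2}/c; move: H2; rewrite /c; move: H1; lra.
  rewrite /G /y0 opp_row_mx add_row_mx subr0.
  by apply: ler_norm_row_mx => //; [exact: le_trans h1 le_c|exact: le_trans h2 le_c].
(* The weight is constant here: [MeT] alone makes the map contract by 1 / 2. *)
have [| | | | | | |y Py Gy] := @weighted_fixed_point R 1 (p + m) P G (fun=> 1) 1 c y0.
- by move=> t; rewrite ler01 lexx.
- by split=> // t; rewrite subrr normr0.
- by move=> y Py; split; [exact: cG|exact: invar].
- move=> y H; split.
    by apply: uniform_limit_continuous => a /H[y' [cy' _] yy']; exists y'.
  move=> t; apply/ler_addgt0Pr => a /H[y' [_ Py'] yy'].
  rewrite -(subrKA (y' t)) (le_trans (ler_normD _ _)) // addrC.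
  exact: lerD (Py' t) (yy' t).
- exact: c0.
- by move=> t; rewrite mulr1; apply: invar; split=> // x; rewrite subrr normr0.
- move=> y y' Py Py' K K0 yy' t; rewrite mulr1.
  have [E1 E2] := steering_linear cw (cs _ Py) (cs _ Py') (ct t).
  rewrite /G opp_row_mx add_row_mx E1 E2.
  have cw0 : continuous (fun _ : R => 0 : 'rV[R]_m) by move=> x; exact: cst_continuous.
  have css : continuous (fun x => S y x - S y' x) := cont_sub (cs _ Py) (cs _ Py').
  have ce : continuous (fun _ : R => e * K) by move=> x; exact: cst_continuous.
  have ws x : 0 <= x <= T -> `|0 : 'rV[R]_m| + `|S y x - S y' x| <= e * K.
    move=> xT; have [_ gl] := Hg x xT; rewrite normr0 add0r.
    rewrite (le_trans (gl _ _ (Pr' _ Py x) (Pr' _ Py' x))) // ler_wpM2l //.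
    by have := yy' x; rewrite mulr1.
  have [] := HM (fun=> 0) _ _ cw0 css ce ws _ (ct t).
  rewrite subr0 prim_cst // => h1 h2.
  have le_K : M * (e * K * T) <= K / 2.
    by have := ler_wpM2r K0 MeT; lra.
  by apply: ler_norm_row_mx; rewrite ?divr_ge0 //; [exact: le_trans h1 le_K|exact: le_trans h2 le_K].
exists y; first by split; [case: Py|exact: Pr'].
move=> t tT; split; first by have [_ /(_ t)] := Py; rewrite /y0 clamp_id.
by rewrite -[LHS]Gy /G clamp_id.
Qed.

End steering.

(** * Increments of primitives and absolute continuity *)

Section absolute_continuity.
Context {R : realType}.

Lemma prim_increment (h : R -> R) (a b c c' : R) : continuous h -> 0 <= a <= b ->
  (forall t, a <= t <= b -> c <= h t <= c') ->
  c * (b - a) <= prim h b - prim h a <= c' * (b - a).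
Proof.
move=> ch /andP[a0 ab] hc.
have dl (k t : R) : is_derive t 1 (fun s : R => k * s) k.
  by rewrite -[X in is_derive _ _ _ X]mulr1; exact: is_deriveZ.
have cl (k : R) : {within `[a, b], continuous (fun s : R => k * s)}.
  by apply: continuous_subspaceT => t; apply: cvgM; [exact: cst_continuous|exact: cvg_id].
have cp : {within `[a, b], continuous (prim h)}.
  apply: within_continuous => t; rewrite in_itv => /andP[at_ _].
  by apply: continuous_prim => //; exact: le_trans at_.
have dp t : t \in `]a, b[ -> is_derive t 1 (prim h) (h t).
  by rewrite in_itv => /andP[/ltW at_ _]; apply: is_derive_prim => //; exact: le_trans at_.
have sub t : t \in `]a, b[ -> a <= t <= b by rewrite in_itv /= => /andP[/ltW -> /ltW].
rewrite !mulrBr; apply/andP; split.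
  by apply: (derive_le_increment ab (cl c) cp (fun t _ => dl c t) dp) => t /sub/hc/andP[].
by apply: (derive_le_increment ab cp (cl c') dp (fun t _ => dl c' t)) => t /sub/hc/andP[].
Qed.

Lemma lipschitz_abs_continuous (V : normedModType R) (a b K : R) (g : R -> V) : 0 <= K ->
  (forall s t, a <= s -> s <= t -> t <= b -> `|g t - g s| <= K * (t - s)) ->
  abs_continuous a b g.
Proof.
move=> K0 gK e e0; exists (e / (K + 1)); first by rewrite divr_gt0 // ltr_wpDl.
move=> k s t st _ Hd; rewrite (@le_lt_trans _ _ (K * \sum_(i < k) (t i - s i))) //.
  by rewrite mulr_sumr ler_sum // => i _; have [? [? ?]] := st i; exact: gK.
have S0 : 0 <= \sum_(i < k) (t i - s i).
  by apply: sumr_ge0 => i _; have [? [? ?]] := st i; rewrite subr_ge0.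
rewrite ltr_pdivlMr ?ltr_wpDl // in Hd; move: (\sum_(i < k) _) S0 Hd => S S0 Hd.
by rewrite mulrDr mulr1 mulrC in Hd; lra.
Qed.

End absolute_continuity.

(** * The linearised system and the gradient of the abnormal Hamiltonian *)

Section linearization.
Context {R : realType} {n m : nat} (Omega : set 'rV[R]_n)
  (C : state_ctrl R n m -> R) (f : state_ctrl R n m -> 'rV[R]_n)
  (T : R) (q0 v0 qT vT : 'rV[R]_n) (q kappa : R -> 'rV[R]_n) (u : R -> 'rV[R]_m).
Local Notation N := (n + n + m)%N.
Local Notation E := state_ctrl_basis.
Local Notation D := [set z : state_ctrl R n m | Omega z.1.1].
Local Notation f_ j := (fun z => f z 0 j).
Context (oOmega : open Omega) (hC : Ck_on 2 D C) (hf : Ck_on 2 D f) (T0 : 0 < T)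
  (foc : first_order_conditions Omega C f T q0 v0 qT vT q kappa u).
Local Notation z := (base_curve T q u).
Local Notation v := (derive_within 0 T q).
Local Notation fj := (f_jacobian f T q u).

(* With row vectors, the linearised system is [x' = row_mx x w *m lin_mx t]. *)
Definition velocity_mx : 'M[R]_(N, n) := col_mx (col_mx 0 1%:M) 0.
Definition lin_mx t : 'M[R]_(N, n + n) := row_mx velocity_mx (fj t).
Definition state_mx t : 'M[R]_(n + n) := usubmx (lin_mx t).
Definition control_mx t : 'M[R]_(m, n + n) := dsubmx (lin_mx t).

Lemma mul_lin_mx (d : 'rV[R]_N) t : d *m lin_mx t = row_mx (rsubmx (lsubmx d)) (d *m fj t).
Proof.
rewrite /lin_mx mul_mx_row; congr row_mx.
by rewrite -{1}[d]hsubmxK mul_row_col mulmx0 addr0 -{1}[lsubmx d]hsubmxK mul_row_col mulmx0 mulmx1 add0r.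
Qed.

Lemma mul_lin_mx_split (x : 'rV[R]_(n + n)) (w : 'rV[R]_m) t :
  row_mx x w *m lin_mx t = x *m state_mx t + w *m control_mx t.
Proof. by rewrite -{1}[lin_mx t]vsubmxK mul_row_col. Qed.

Lemma continuous_lin_mx : continuous lin_mx.
Proof.
have cfj := continuous_f_jacobian oOmega hf T0 foc.
move=> t; apply/continuous_mxP => i j; case: (splitP j) => k jk.
  have -> : j = lshift n k by apply/val_inj.
  rewrite (_ : (fun s => _) = (fun=> velocity_mx i k)); first exact: cst_continuous.
  by apply: funext => s; rewrite row_mxEl.
have -> : j = rshift n k by apply/val_inj.
rewrite (_ : (fun s => _) = (fun s => fj s i k)).
  exact: (@continuous_entry R N n fj i k cfj t).
by apply: funext => s; rewrite row_mxEr.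
Qed.

Lemma continuous_state_mx : continuous state_mx.
Proof.
move=> t; apply/continuous_mxP => i j.
rewrite (_ : (fun s => _) = (fun s => lin_mx s (lshift m i) j)).
  exact: (@continuous_entry R N (n + n) lin_mx (lshift m i) j continuous_lin_mx t).
by apply: funext => s; rewrite mxE.
Qed.

Lemma continuous_control_mx : continuous control_mx.
Proof.
move=> t; apply/continuous_mxP => i j.
rewrite (_ : (fun s => _) = (fun s => lin_mx s (rshift (n + n) i) j)).
  exact: (@continuous_entry R N (n + n) lin_mx (rshift (n + n) i) j continuous_lin_mx t).
by apply: funext => s; rewrite mxE.
Qed.

(** The coefficient is frozen outside [0, T], which turns a bound on the segment into the global one
    that [linear_ode] requires. *)
Lemma state_mx_clamp t : state_mx (clamp T t) = state_mx t.
Proof.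
congr (usubmx (row_mx _ _)); apply/matrixP => k i; rewrite !mxE /base_curve.
by rewrite (clamp_id (clamp_itv t (ltW T0))).
Qed.

Section gradient.
Context (t : R) (tT : 0 <= t <= T) (lq lv : 'rV[R]_n).
Local Notation mu := (row_mx lq lv *m (lin_mx t)^T).

Let Dz : D (q t, v t, u t).
Proof. by have := base_curveD T0 foc t; rewrite base_curve_id. Qed.

Let Ez : z t = (q t, v t, u t). Proof. exact: base_curve_id. Qed.

(** Transposing the linearised system and applying it to the costate yields the gradient of <lq, v>
    + <lv, f> in (q, v, u): the adjoint equations and the stationarity condition for lambda^0 = 0
    are its three blocks. *)
Lemma costate_lin_mx k :
  mu 0 k = dotp lq (row k velocity_mx) + \sum_j lv 0 j * 'D_(E k) (f_ j) (q t, v t, u t).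
Proof.
rewrite tr_row_mx mul_row_col mxE; congr (_ + _).
  by rewrite mxE; apply: eq_bigr => j _; rewrite !mxE.
by rewrite mxE -Ez; apply: eq_bigr => j _; rewrite !mxE.
Qed.

Lemma row_velocity_q i : row (lshift m (lshift n i)) velocity_mx = 0.
Proof. by apply/rowP => j; rewrite mxE !col_mxEu !mxE. Qed.

Lemma row_velocity_v i : row (lshift m (rshift n i)) velocity_mx = delta_mx 0 i.
Proof. by apply/rowP => j; rewrite mxE col_mxEu col_mxEd !mxE eqxx eq_sym. Qed.

Lemma row_velocity_u i : row (rshift (n + n) i) velocity_mx = 0.
Proof. by apply/rowP => j; rewrite mxE col_mxEd !mxE. Qed.

Lemma dotp_delta p (a : 'rV[R]_p) i : dotp a (delta_mx 0 i) = a 0 i.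
Proof.
rewrite /dotp (bigD1 i) //= mxE !eqxx mulr1 big1 ?addr0 // => j ji.
by rewrite mxE (negbTE ji) andbF mulr0.
Qed.

Lemma dotp0 p (a : 'rV[R]_p) : dotp a 0 = 0.
Proof. by rewrite /dotp big1 // => i _; rewrite mxE mulr0. Qed.

Let dfz j : differentiable (f_ j) (q t, v t, u t).
Proof.
have hfj : Ck_on 2 D (f_ j) by apply: Ck_on_entry => //; exact: open_domain.
exact: (Ck_on_differentiable hfj Dz).
Qed.

(** Common to the three blocks: [pt] inserts the varying argument and [c] stands for <lq, v>, which
    varies in the v block only. *)
Lemma derive_hamiltonian p (pt : 'rV[R]_p -> state_ctrl R n m) (c : 'rV[R]_p -> R) x i k dc :
  pt x = (q t, v t, u t) -> differentiable pt x ->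
  is_derive x (delta_mx 0 i) c dc ->
  (forall j, 'D_(delta_mx 0 i) (fun y => f (pt y) 0 j) x = 'D_(E k) (f_ j) (q t, v t, u t)) ->
  'D_(delta_mx 0 i) (fun y => c y + dotp lv (f (pt y)) + 0 * C (pt y)) x
  = dc + \sum_j lv 0 j * 'D_(E k) (f_ j) (q t, v t, u t).
Proof.
move=> ptx dpt dcx Hj.
have dF j : is_derive x (delta_mx 0 i) (fun y => f (pt y) 0 j) ('D_(E k) (f_ j) (q t, v t, u t)).
  rewrite -Hj; apply: derivableP; apply: diff_derivable.
  have dfx : differentiable (f_ j) (pt x) by rewrite ptx; exact: dfz.
  exact: (differentiable_comp dpt dfx).
have dS : is_derive x (delta_mx 0 i) (\sum_(j < n) (fun y => lv 0 j * f (pt y) 0 j))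
   (\sum_j lv 0 j * 'D_(E k) (f_ j) (q t, v t, u t)).
  by apply: is_derive_sum => j; have ? := dF j; exact: is_deriveZ.
rewrite (_ : (fun y => _) = c + \sum_(j < n) (fun y => lv 0 j * f (pt y) 0 j)).
  by have [_ ->] := is_deriveD dcx dS.
by apply: funext => y; rewrite mul0r addr0 !fctE fct_sumE.
Qed.

Lemma is_derive_dotp_delta p (a x : 'rV[R]_p) i : is_derive x (delta_mx 0 i) (dotp a) (a 0 i).
Proof.
have dX j : is_derive x (delta_mx 0 i) (fun y : 'rV[R]_p => y 0 j) ((delta_mx 0 i : 'rV[R]_p) 0 j).
  have dI := @derivable_id R 'rV[R]_p x (delta_mx 0 i).
  split.
    exact: (proj1 (@derivable_mxP R 'rV[R]_p 1 p (fun y => y) x (delta_mx 0 i)) dI 0 j).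
  by have := derive_mx dI; rewrite derive_id => /matrixP/(_ 0 j); rewrite [in X in _ = X -> _]mxE => <-.
have dS : is_derive x (delta_mx 0 i) (\sum_(j < p) (fun y : 'rV[R]_p => a 0 j * y 0 j))
   (\sum_j a 0 j * (delta_mx 0 i : 'rV[R]_p) 0 j).
  by apply: is_derive_sum => j; have ? := dX j; exact: is_deriveZ.
have E : \sum_(j < p) (fun y : 'rV[R]_p => a 0 j * y 0 j) = dotp a.
  by apply: funext => y; rewrite fct_sumE.
by rewrite E in dS; apply: (is_derive_eq dS); exact: dotp_delta.
Qed.

Lemma grad_hamiltonian_q :
  grad (fun x => hamiltonian C f 0 x (v t) lq lv (u t)) (q t) = lsubmx (lsubmx mu).
Proof.
apply/rowP => i; rewrite [LHS]mxE [RHS]mxE [RHS]mxE costate_lin_mx row_velocity_q dotp0.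
have dpt : differentiable (fun x : 'rV[R]_n => (x, v t, u t)) (q t).
  by apply: differentiable_pair => //; apply: differentiable_pair.
apply: (derive_hamiltonian (erefl _) dpt (is_derive_cst (dotp lq (v t)) _ _)).
by move=> j; rewrite (@derive_partial_q R n m _ (f_ j)).
Qed.

Lemma grad_hamiltonian_v :
  grad (fun x => hamiltonian C f 0 (q t) x lq lv (u t)) (v t) = rsubmx (lsubmx mu).
Proof.
apply/rowP => i; rewrite [LHS]mxE [RHS]mxE [RHS]mxE costate_lin_mx row_velocity_v dotp_delta.
have dpt : differentiable (fun x : 'rV[R]_n => (q t, x, u t)) (v t).
  by apply: differentiable_pair => //; apply: differentiable_pair.
apply: (derive_hamiltonian (erefl _) dpt (is_derive_dotp_delta lq (v t) i)).
by move=> j; rewrite (@derive_partial_v R n m _ (f_ j)).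
Qed.

Lemma grad_hamiltonian_u :
  grad (fun x => hamiltonian C f 0 (q t) (v t) lq lv x) (u t) = rsubmx mu.
Proof.
apply/rowP => i; rewrite [LHS]mxE [RHS]mxE costate_lin_mx row_velocity_u dotp0.
have dpt : differentiable (fun x : 'rV[R]_m => (q t, v t, x)) (u t).
  by apply: differentiable_pair => //; apply: differentiable_pair.
apply: (derive_hamiltonian (erefl _) dpt (is_derive_cst (dotp lq (v t)) _ _)).
by move=> j; rewrite (@derive_partial_u R n m _ (f_ j)).
Qed.

End gradient.

End linearization.

(** * Tent functions supported in [0, T] *)

Section bump.
Context {R : realType}.

(** A tent of half-width rho = h / 2 whose centre tau is moved from t0 by at most rho, so that the
    support fits in [0, T] even when t0 is an endpoint. The integral is at most 2 rho = h; as eta >=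
    1 / 2 on a middle interval of length rho, that of eta^2 is at least rho / 4 = h / 8. *)
Lemma bump (T t0 h : R) : 0 < h -> h <= T -> 0 <= t0 <= T ->
  exists eta : R -> R, [/\ continuous eta, forall t, 0 <= eta t <= 1,
    forall t, h < `|t - t0| -> eta t = 0, prim eta T <= h &
    h / 8 <= prim (fun t => eta t ^+ 2) T].
Proof.
move=> h0 hT /andP[t00 t0T]; pose rho := h / 2.
have [tau [tau1 tau2 taut]] : exists tau : R, [/\ rho <= tau, tau + rho <= T & `|tau - t0| <= rho].
  have [h1|h1] := leP t0 rho.
    by exists rho; rewrite lexx ger0_norm ?subr_ge0 // /rho; split=> //; lra.
  have [h2|h2] := leP t0 (T - rho).
    by exists t0; rewrite subrr normr0 /rho; rewrite /rho in h1 h2; split; lra.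
  by exists (T - rho); rewrite distrC ger0_norm ?subr_ge0 ?(ltW h2) // /rho; rewrite /rho in h1 h2; split; lra.
have rho0 : 0 < rho by rewrite divr_gt0.
pose eta (t : R) := Num.max 0 (1 - `|t - tau| / rho).
have eta0 t : 0 <= eta t by rewrite le_max lexx.
have eta1 t : eta t <= 1.
  by rewrite ge_max ler01 gerBl divr_ge0 // ltW.
have etaz t : rho <= `|t - tau| -> eta t = 0.
  by move=> rt; apply/max_idPl; rewrite subr_le0 ler_pdivlMr // mul1r.
have ceta : continuous eta.
  move=> t; apply: (@continuous_max R R (fun=> 0) (fun t => 1 - `|t - tau| / rho)).
    exact: cst_continuous.
  apply: cvgB; first exact: cst_continuous.
  apply: cvgM; last exact: cst_continuous.
  by apply: cvg_norm; apply: cvgB; [exact: cvg_id|exact: cst_continuous].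
have ceta2 : continuous (fun t => eta t ^+ 2).
  by move=> t; rewrite (_ : (fun t => eta t ^+ 2) = (fun t => eta t * eta t)) //; apply: cvgM; exact: ceta.
have T0 : 0 <= T by exact: le_trans t0T.
exists eta; split => //.
- by move=> t; rewrite eta0 eta1.
- move=> t ht; apply: etaz; have := ler_distD tau t t0; rewrite /rho in taut *; lra.
- have b1 : (0 : R) <= 0 <= tau - rho by rewrite lexx subr_ge0.
  have b2 : 0 <= tau - rho <= tau + rho by rewrite subr_ge0 tau1; lra.
  have b3 : 0 <= tau + rho <= T by rewrite tau2 andbT; lra.
  have z1 t : 0 <= t <= tau - rho -> 0 <= eta t <= 0.
    by move=> /andP[_ tt]; rewrite etaz ?lexx // distrC ger0_norm; lra.
  have z3 t : tau + rho <= t <= T -> 0 <= eta t <= 0.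
    by move=> /andP[tt _]; rewrite etaz ?lexx // ger0_norm; lra.
  have z2 t : tau - rho <= t <= tau + rho -> 0 <= eta t <= 1 by rewrite eta0 eta1.
  have /andP[_ i1] := prim_increment ceta b1 z1.
  have /andP[_ i2] := prim_increment ceta b2 z2.
  have /andP[_ i3] := prim_increment ceta b3 z3.
  rewrite prim0 in i1; rewrite /rho in i1 i2 i3; lra.
- have b1 : (0 : R) <= 0 <= tau - rho / 2 by rewrite lexx subr_ge0; lra.
  have b2 : 0 <= tau - rho / 2 <= tau + rho / 2 by apply/andP; split; lra.
  have b3 : 0 <= tau + rho / 2 <= T by apply/andP; split; lra.
  have sq t : 0 <= eta t ^+ 2 <= 1 by rewrite exprn_ge0 ?exprn_ile1.
  have z2 t : tau - rho / 2 <= t <= tau + rho / 2 -> 1 / 4 <= eta t ^+ 2 <= 1.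
    move=> /andP[t1 t2]; have /andP[_ ->] := sq t; rewrite andbT.
    have tt : `|t - tau| <= rho / 2 by rewrite ler_norml; apply/andP; split; lra.
    have : 1 / 2 <= eta t.
      rewrite le_max; apply/orP; right.
      have : `|t - tau| / rho <= 1 / 2 by rewrite ler_pdivrMr //; lra.
      by move: (_ / rho) => x; lra.
    by move: (eta t) => x hx; rewrite expr2; nra.
  have /andP[i1 _] := prim_increment ceta2 b1 (fun t _ => sq t).
  have /andP[i2 _] := prim_increment ceta2 b2 z2.
  have /andP[i3 _] := prim_increment ceta2 b3 (fun t _ => sq t).
  rewrite prim0 in i1; rewrite /rho in i1 i2 i3 *; lra.
Qed.

End bump.

(** * Controllability from corank 1, admissible bumps and the Legendre condition *)

Section necessity.
Context {R : realType} {n m : nat} (Omega : set 'rV[R]_n)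
  (C : state_ctrl R n m -> R) (f : state_ctrl R n m -> 'rV[R]_n)
  (T : R) (q0 v0 qT vT : 'rV[R]_n) (q kappa : R -> 'rV[R]_n) (u : R -> 'rV[R]_m).
Local Notation N := (n + n + m)%N.
Local Notation E := state_ctrl_basis.
Local Notation D := [set z : state_ctrl R n m | Omega z.1.1].
Context (oOmega : open Omega) (hC : Ck_on 2 D C) (hf : Ck_on 2 D f) (T0 : 0 < T)
  (foc : first_order_conditions Omega C f T q0 v0 qT vT q kappa u).
Local Notation z := (base_curve T q u).
Local Notation v := (derive_within 0 T q).
Local Notation fj := (f_jacobian f T q u).
Local Notation lin_mx := (lin_mx f T q u).
Local Notation state_mx := (state_mx f T q u).
Local Notation control_mx := (control_mx f T q u).

Let continuous_state_mx := continuous_state_mx oOmega hf T0 foc.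
Let continuous_control_mx := continuous_control_mx oOmega hf T0 foc.

(* A kernel vector of the gramian propagates to a multiplier with [l0 = 0],
   independent of the normal one. *)
Lemma gramian_unit (Psi : R -> 'M[R]_(n + n)) : continuous Psi -> Psi 0 = 1%:M ->
  (forall t, t \in `]0, T[ -> is_derive t 1 Psi (- (state_mx t *m Psi t))) ->
  Psi T \in unitmx -> normal C f T q u -> has_corank C f T q u 1 ->
  gramian control_mx Psi T \in unitmx.
Proof.
move=> cPsi Psi0 dPsi PsiT [lq1 [lv1 [l0 [mult1 l0N]]]] [U [HU _] dimU].
apply: contraT => /(singular_gramian T0 continuous_control_mx cPsi)[x x0 Hx].
(* Solution of the adjoint equation lam' = - lam A^T with initial value x. *)
pose lam t := x *m (Psi t)^T.
pose lq t := lsubmx (lam t); pose lv t := rsubmx (lam t).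
have lamE t : lam t = row_mx (lq t) (lv t) by rewrite hsubmxK.
have cPT : continuous (fun t => (Psi t)^T) := cont_trmx cPsi.
have clam : continuous lam.
  exact: (@cont_mulmx R 1 (n + n) (n + n) (fun=> x) (fun t => (Psi t)^T) (@cont_cst R 1 (n + n) x) cPT).
pose h t := - (lam t *m (state_mx t)^T).
have ch : continuous h.
  exact: (cont_opp (cont_mulmx clam (cont_trmx continuous_state_mx))).
have hE t : x *m (- (state_mx t *m Psi t))^T = h t.
  by rewrite linearN /= trmx_mul mulmxN mulmxA.
have dlam t : t \in `]0, T[ -> is_derive t 1 lam (h t).
  move=> tT; have dPT : is_derive t 1 (fun s => (Psi s)^T) (- (state_mx t *m Psi t))^T.
    apply/is_derive_mxP => i j; have /is_derive_mxP/(_ j i) := dPsi t tT.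
    rewrite (_ : (fun s => (Psi s)^T i j) = (fun s => Psi s j i)); last by apply: funext => s; rewrite mxE.
    by rewrite [X in _ -> is_derive _ _ _ X]mxE.
  apply: (is_derive_eq (is_derive_mulmx (is_derive_cst x t 1) dPT)).
  by rewrite mul0mx add0r; exact: hE.
have lam0 : lam 0 = x by rewrite /lam Psi0 trmx1 mulmx1.
have lamP t : 0 <= t <= T -> lam t = x + mprim h t.
  move=> /andP[t0 tT]; have cl : {within `[0, t], continuous lam} := continuous_subspaceT clam.
  have dl s : s \in `]0, t[ -> is_derive s 1 lam (h s).
    by rewrite in_itv /= => /andP[s0 st]; apply: dlam; rewrite in_itv /= s0 (lt_le_trans st).
  by have := mprim_unique ch t0 cl dl; rewrite lam0.
have [K K0 HK] := continuous_bounded T0 ch.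
have lipl s t : 0 <= s -> s <= t -> t <= T -> `|lam t - lam s| <= K * (t - s).
  move=> s0 st tT; have tT' : 0 <= t <= T by rewrite (le_trans s0).
  have sT' : 0 <= s <= T by rewrite s0 (le_trans st).
  rewrite !lamP // opprD addrACA subrr add0r; apply/mx_normP.
    by rewrite mulr_ge0 // subr_ge0.
  move=> i j; rewrite !mxE ler_norml -mulNr.
  have s0t : 0 <= s <= t by rewrite s0.
  have ce : continuous (fun s => h s i j) := @continuous_entry R 1 (n + n) h i j ch.
  have hK r : s <= r <= t -> - K <= h r i j <= K.
    move=> /andP[sr rt]; rewrite -ler_norml (le_trans (ler_norm_entry _ _ _)) // HK //.
    by rewrite (le_trans s0) //= (le_trans rt).
  exact: (prim_increment ce s0t hK).
(* The u block of the gradient is x (B Psi)^T, which vanishes by the choice of x: this is the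
   stationarity condition. *)
have lam_mu t : 0 <= t <= T -> row_mx (lq t) (lv t) *m (lin_mx t)^T = row_mx (- h t) 0.
  move=> tT; rewrite -lamE -{1}[lin_mx t]vsubmxK tr_col_mx mul_mx_row /h opprK; congr row_mx.
  have := Hx t tT; rewrite /steer -/(control_mx t) trmx_mul mulmxA => <-.
  by [].
have M0 : multiplier C f T q u lq lv 0.
  split => //.
  - move=> [Z _]; case/negP: x0; rewrite -lam0 lamE.
    have T00 : (0 : R) \in `[0, T] by rewrite in_itv /= lexx ltW.
    by have [-> ->] := Z _ T00; rewrite row_mx0.
  - split; apply: (lipschitz_abs_continuous K0) => s t s0 st tT.
    + by rewrite /lq -linearB (le_trans (ler_norm_lsubmx _)) // lipl.
    + by rewrite /lv -linearB (le_trans (ler_norm_rsubmx _)) // lipl.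
  - apply: aeW => t tT.
    have tT' : 0 <= t <= T by move: tT; rewrite in_itv /= => /andP[/ltW -> /ltW].
    have Eq := grad_hamiltonian_q oOmega hf T0 foc tT' (lq t) (lv t).
    have Ev := grad_hamiltonian_v oOmega hf T0 foc tT' (lq t) (lv t).
    rewrite lam_mu // row_mxKl in Eq Ev; rewrite Eq Ev.
    have -> : - lsubmx (- h t) = lsubmx (h t) by apply/matrixP => i j; rewrite !mxE opprK.
    have -> : - rsubmx (- h t) = rsubmx (h t) by apply/matrixP => i j; rewrite !mxE opprK.
    have /is_derive_mxP dl := dlam t tT.
    split; apply/is_derive_mxP => i j; rewrite mxE.
    + by rewrite (_ : (fun s => _) = (fun s => lam s i (lshift n j))) //; apply: funext => s; rewrite mxE.
    + by rewrite (_ : (fun s => _) = (fun s => lam s i (rshift n j))) //; apply: funext => s; rewrite mxE.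
  - move=> t; rewrite in_itv /= => tT.
    by rewrite (grad_hamiltonian_u oOmega hf T0 foc tT) lam_mu // row_mxKr.
pose z1 := row_mx (row_mx (lq1 T) (lv1 T)) (const_mx l0) : 'rV[R]_(n + n + 1).
pose z0 := row_mx (row_mx (lq T) (lv T)) (const_mx 0) : 'rV[R]_(n + n + 1).
have z1U : z1 \in U by apply: HU; exists lq1, lv1, l0.
have z0U : z0 \in U by apply: HU; exists lq, lv, 0.
have z1N : z1 != 0.
  apply: contraNneq l0N => /(congr1 (fun M : 'rV_(n + n + 1) => M 0 (rshift (n + n) 0))).
  by rewrite row_mxEr !mxE => ->.
(* By corank 1 the abnormal value is a multiple of the normal one. Its last coordinate is 0 while l0
   is not, so the factor is 0, hence lam T = 0, and invertibility of [Psi T] gives x = 0. *)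
have UE : (<[z1]> = U)%VS.
  by apply/eqP; rewrite eqEdim -memvE z1U dimU dim_vline z1N.
move: z0U; rewrite -UE => /vlineP[k Ek].
have k0 : k = 0.
  have := congr1 (fun M : 'rV_(n + n + 1) => M 0 (rshift (n + n) 0)) Ek.
  rewrite row_mxEr mxE [RHS]mxE row_mxEr mxE => /esym/eqP.
  by rewrite mulf_eq0 (negbTE l0N) orbF => /eqP.
have lamT : lam T = 0.
  by have := congr1 lsubmx Ek; rewrite k0 scale0r row_mxKl -lamE linear0.
case/negP: x0; have := congr1 (mulmx^~ (invmx (Psi T)^T)) lamT.
by rewrite /lam /= -mulmxA mulmxV ?unitmx_tr // mulmx1 mul0mx => ->.
Qed.

Lemma quot_within_lsubmx p1 p2 (x : R -> 'rV[R]_(p1 + p2)) (b t : R) (d : 'rV[R]_(p1 + p2)) :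
  quot_within 0 b x t --> d -> quot_within 0 b (fun s => lsubmx (x s)) t --> lsubmx d.
Proof.
move=> /quot_withinP H; apply/quot_withinP => e /H[r r0 rH]; exists r => // s sb sr.
apply: le_trans (rH s sb sr); apply: le_trans (ler_norm_lsubmx _).
by rewrite le_eqVlt (_ : lsubmx _ - _ - _ = lsubmx (x s - x t - (s - t) *: d)) ?eqxx //;
  apply/matrixP => i j; rewrite !mxE.
Qed.

Lemma quot_within_rsubmx p1 p2 (x : R -> 'rV[R]_(p1 + p2)) (b t : R) (d : 'rV[R]_(p1 + p2)) :
  quot_within 0 b x t --> d -> quot_within 0 b (fun s => rsubmx (x s)) t --> rsubmx d.
Proof.
move=> /quot_withinP H; apply/quot_withinP => e /H[r r0 rH]; exists r => // s sb sr.
apply: le_trans (rH s sb sr); apply: le_trans (ler_norm_rsubmx _).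
by rewrite le_eqVlt (_ : rsubmx _ - _ - _ = rsubmx (x s - x t - (s - t) *: d)) ?eqxx //;
  apply/matrixP => i j; rewrite !mxE.
Qed.

Let tr : trajectory Omega f 0 T q u. Proof. by case: foc => -[]. Qed.
Let T0' : 0 <= T. Proof. exact: ltW. Qed.

Section perturbation.
Context (y : R -> 'rV[R]_N) (cy : continuous y) (yD : forall t, D (z t + lincomb E (y t))).
Local Notation zy t := (z t + lincomb E (y t)).
Context (dy : forall t, 0 <= t <= T -> quot_within 0 T (fun s => lsubmx (y s)) t -->
  row_mx (rsubmx (lsubmx (y t))) (f (zy t) - f (z t))).

Definition perturbed_state t := q t + lsubmx (lsubmx (y t)).
Definition perturbed_control t := u t + rsubmx (y t).
Local Notation q' := perturbed_state.
Local Notation u' := perturbed_control.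

Lemma continuous_perturbed_curve : continuous (fun t => zy t).
Proof.
move=> t; apply: continuousD; first exact: (continuous_base_curve T0 foc).
rewrite (_ : (fun s => lincomb E (y s)) = (fun s =>
  (lsubmx (lsubmx (y s)), rsubmx (lsubmx (y s)), rsubmx (y s)))); last first.
  by apply: funext => s; rewrite lincomb_basis.
have cl : continuous (fun s => lsubmx (y s)).
  by move=> s; apply: (continuous_comp (f := y)); [exact: cy|exact: continuous_lsubmx].
apply: continuous_pair3.
- by apply: (continuous_comp (f := fun s => lsubmx (y s))); [exact: cl|exact: continuous_lsubmx].
- by apply: (continuous_comp (f := fun s => lsubmx (y s))); [exact: cl|exact: continuous_rsubmx].
- by apply: (continuous_comp (f := y)); [exact: cy|exact: continuous_rsubmx].
Qed.

Lemma perturbed_velocityP t : 0 <= t <= T ->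
  quot_within 0 T q' t --> v t + rsubmx (lsubmx (y t)).
Proof.
move=> tT; apply: quot_withinD (trajectory_q tr tT) _.
by have := quot_within_lsubmx (dy tT); rewrite row_mxKl.
Qed.

Lemma perturbed_velocity t : 0 <= t <= T ->
  derive_within 0 T q' t = v t + rsubmx (lsubmx (y t)).
Proof. by move=> tT; apply: quot_within_unique => //; exact: perturbed_velocityP. Qed.

Lemma perturbed_along t : 0 <= t <= T -> along 0 T q' u' t = zy t.
Proof.
by move=> tT; rewrite base_curve_id // lincomb_basis /along perturbed_velocity.
Qed.

Lemma perturbed_accelerationP t : 0 <= t <= T ->
  quot_within 0 T (derive_within 0 T q') t --> f (zy t).
Proof.
move=> tT; apply: (eq_quot_within (g := fun s => v s + rsubmx (lsubmx (y s)))) => //.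
  by move=> s sT; rewrite perturbed_velocity.
have -> : f (zy t) = f (along 0 T q u t) + (f (zy t) - f (z t)).
  by rewrite base_curve_id // [RHS]addrC subrK.
apply: quot_withinD (trajectory_v tr tT) _.
by have := quot_within_rsubmx (dy tT); rewrite row_mxKr.
Qed.

(** [dy] is the exact variational equation, not its linearisation: its first block says that q' has
    velocity v + dv, its second that the acceleration is f at the perturbed point. *)
Lemma perturbed_trajectory : trajectory Omega f 0 T q' u'.
Proof.
have E2 t : 0 <= t <= T -> derive_within 0 T (derive_within 0 T q') t = f (zy t).
  by move=> tT; apply: quot_within_unique => //; exact: perturbed_accelerationP.
have cf : Ck_on 0 D f by do 2!apply: Ck_onW.
split.
- split.
  + by move=> t; rewrite in_itv => tT; apply: cvgP; exact: perturbed_velocityP.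
  + by move=> t; rewrite in_itv => tT; apply: cvgP; exact: perturbed_accelerationP.
  + apply: (clamp_C0_curve (h := fun t => f (zy t))) => //.
    exact: (continuous_comp_domain cf continuous_perturbed_curve yD).
- apply: (clamp_C0_curve (h := fun t => u (clamp T t) + rsubmx (y t))) => //.
    have [_ cu _ _] := tr; move=> t; apply: cvgD; first exact: (C0_curve_clamp T0' cu).
    by apply: (continuous_comp (f := y)); [exact: cy|exact: continuous_rsubmx].
  by move=> t tT; rewrite clamp_id.
- move=> t; rewrite in_itv => tT; have := yD t; rewrite -perturbed_along //.
- move=> t; rewrite in_itv => tT; rewrite E2 // perturbed_along //.
Qed.

Lemma perturbed_admissible : lsubmx (y 0) = 0 -> lsubmx (y T) = 0 ->
  admissible Omega f T q0 v0 qT vT q' u'.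
Proof.
move=> y0 yT; have [[_ [qE0 vE0] [qET vET]] _ _ _ _] := foc.
split; first exact: perturbed_trajectory.
- rewrite perturbed_velocity ?lexx // /q' y0 qE0 vE0.
  by split; apply/rowP => i; rewrite !mxE addr0.
- rewrite perturbed_velocity ?lexx ?T0' // /q' yT qET vET.
  by split; apply/rowP => i; rewrite !mxE addr0.
Qed.

Lemma perturbed_variation t : 0 <= t <= T -> variation T q u T q' u' t = y t.
Proof.
move=> tT; rewrite (variationE q u (lexx T)) // perturbed_velocity //.
have add x1 p (a b : 'M[R]_(x1, p)) : a + b - a = b by rewrite addrC addKr.
by rewrite !add !hsubmxK.
Qed.

End perturbation.

(** The nonlinear part of the increment of f is fed as a source into the steered linear system, so
    that a fixed point solves the exact equation with both endpoints kept. Any w under a small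
    enough majorant is thus realised up to a multiple of the integral of mu. *)
Lemma steerable_variation : normal C f T q u -> has_corank C f T q u 1 ->
  exists2 M : R, 0 <= M & \forall r \near 0^'+,
    forall (w : R -> 'rV[R]_m) (mu : R -> R), continuous w -> continuous mu ->
    (forall t, 0 <= t <= T -> `|w t| <= mu t /\ mu t + 4 * M * prim mu T <= r) ->
    exists q' u', [/\ admissible Omega f T q0 v0 qT vT q' u',
      forall t, 0 <= t <= T -> `|variation T q u T q' u' t| <= r &
      forall t, 0 <= t <= T ->
        `|variation T q u T q' u' t - row_mx 0 (w t)| <= 4 * M * prim mu T].
Proof.
move=> nrm cor; have cA := continuous_state_mx; have cB := continuous_control_mx.
have [K K0 HK] := continuous_bounded T0 cA.
have AK t : `|state_mx t| <= K.
  by rewrite -(state_mx_clamp f q u T0 t); apply: HK; exact: clamp_itv.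
have [Phi [Psi [cPhi cPsi [_ Psi0] dPP PP]]] := resolvent T0 cA AK.
have TT : 0 <= T <= T by rewrite T0' lexx.
have PsiT : Psi T \in unitmx by have [] := mulmx1_unit (PP T TT).
have G1 := gramian_unit cPsi Psi0 (fun t tT => proj2 (dPP t tT)) PsiT nrm cor.
have [M M0 HM] := steering_fixed_point T0 cB cPhi cPsi; exists M => //.
(* Makes both e <= 1 and 2 M e T <= 1. *)
pose e := (2 * M * T + 1)^-1.
have MT0 : 0 <= 2 * M * T by rewrite !mulr_ge0.
have e0 : 0 < e by rewrite invr_gt0 ltr_wpDl.
have e1 : 0 <= e <= 1 by rewrite ltW //= invf_le1 ?lerDr // ltr_wpDl.
have MeT : 2 * M * e * T <= 1.
  by rewrite mulrAC /e ler_pdivrMr ?ltr_wpDl // mul1r lerDl.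
have oD : open D := @open_domain R n m Omega oOmega.
have cz := continuous_base_curve T0 foc; have zD := base_curveD T0 foc.
have nD := near_uniform_domain oD T cz zD.
have nJ := near_f_jacobian oOmega hf T0 foc e0.
move: nD nJ; apply: filterS2 => r HD HJ w mu cw cmu wmu.
(* The first block is 0 because the equation for dq is already linear. *)
pose g t (d : 'rV[R]_N) : 'rV[R]_(n + n) :=
  row_mx 0 (f (z t + lincomb E d) - f (z t) - d *m fj t).
have z_clamp t : z (clamp T t) = z t by rewrite /base_curve (clamp_id (clamp_itv t T0')).
have yD y : (forall t, `|y t| <= r) -> forall t, D (z t + lincomb E (y t)).
  move=> yr t; rewrite -(z_clamp t); apply: (HD _ (clamp_itv t T0')).
  by rewrite addrAC subrr add0r (le_trans (ler_norm_lincomb_basis _)).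
have cf : Ck_on 0 D f by do 2!apply: Ck_onW.
have cfy y : continuous y -> (forall t, `|y t| <= r) ->
    continuous (fun t => f (z t + lincomb E (y t)) - f (z t)).
  move=> cy yr t; apply: cvgB.
    exact: (continuous_comp_domain cf (continuous_perturbed_curve cy) (yD y yr)).
  exact: (continuous_comp_domain cf cz zD).
have cg y : continuous y -> (forall t, `|y t| <= r) -> continuous (fun t => g t (y t)).
  move=> cy yr.
  have c1 : continuous (fun t => f (z t + lincomb E (y t)) - f (z t) - y t *m fj t).
    exact: (cont_sub (cfy y cy yr) (cont_mulmx cy (continuous_f_jacobian oOmega hf T0 foc))).
  have c0 : continuous (fun _ : R => 0 : 'rV[R]_n) := @cont_cst R 1 n 0.
  move=> t; exact: (continuous_row_mx (c0 t) (c1 t)).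
have Hg t : 0 <= t <= T -> g t 0 = 0 /\ forall d d' : 'rV[R]_N, `|d| <= r -> `|d'| <= r ->
    `|g t d - g t d'| <= e * `|d - d'|.
  move=> tT; split; first by rewrite /g lincomb0 addr0 subrr mul0mx subrr row_mx0.
  move=> d d' dr dr'; rewrite /g opp_row_mx add_row_mx subrr.
  apply: ler_norm_row_mx; rewrite ?normr0 ?mulr_ge0 //; try exact: ltW.
  have := HJ t tT d d' dr dr'; congr (`|_| <= _).
  rewrite mulmxBl; move: (f _) (f _) (f _) (_ *m _) (_ *m _) => a b c a' b'.
  by apply/rowP => i; rewrite !mxE; ring.
have [y [cy yr] Hy] := HM g r e w mu cg Hg e1 MeT cw cmu wmu.
set s := fun t => g t (y t) in Hy.
have cs : continuous s := cg y cy yr.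
have xE t : 0 <= t <= T -> steering_state control_mx T Phi Psi w s t = lsubmx (y t).
  by move=> /Hy[_ ->]; rewrite row_mxKl.
have dy t : 0 <= t <= T -> quot_within 0 T (fun r => lsubmx (y r)) t -->
    row_mx (rsubmx (lsubmx (y t))) (f (z t + lincomb E (y t)) - f (z t)).
  move=> tT; apply: (eq_quot_within tT xE).
  pose h (t : R) := row_mx (rsubmx (lsubmx (y t))) (f (z t + lincomb E (y t)) - f (z t)).
  have ch : continuous h.
    have c1 : continuous (fun s => rsubmx (lsubmx (y s))).
      move=> x; apply: (continuous_comp (f := fun s => lsubmx (y s))); last exact: continuous_rsubmx.
      by apply: (continuous_comp (f := y)); [exact: cy|exact: continuous_lsubmx].
    move=> x; exact: (continuous_row_mx (c1 x) (cfy y cy yr x)).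
  pose F := steering_state control_mx T Phi Psi w s.
  have cF' x : x \in `[0, T] -> {for x, continuous F}.
    rewrite in_itv /= => /andP[x0 _].
    exact: (continuous_steering_state cB cPhi cPsi cw cs x0).
  have cF : {within `[0, T], continuous F}.
    by apply: continuous_in_subspaceT => x; rewrite inE => xT; exact: cF'.
  have dF x : x \in `]0, T[ -> is_derive x 1 F (h x).
    move=> xT; have xT' : 0 <= x <= T by move: xT; rewrite in_itv /= => /andP[/ltW -> /ltW].
    have dx := is_derive_steering_state cB cPsi (fun t tT => proj1 (dPP t tT)) PP cw cs xT.
    apply: (is_derive_eq dx).
    (* By the fixed point equation the linear terms are [y *m lin_mx], and adding the source
       restores the full increment of f. *)
    rewrite -mul_lin_mx_split -(proj2 (Hy x xT')) mul_lin_mx /s /g add_row_mx addr0 /h.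
    by congr row_mx; rewrite addrC subrK.
  exact: (interior_quot_within ch cF dF tT).
have y0 : lsubmx (y 0) = 0 by rewrite -xE ?lexx // steering_state0.
have yT : lsubmx (y T) = 0 by rewrite -xE // steering_stateT.
have var := perturbed_variation dy.
exists (perturbed_state y), (perturbed_control y); split.
- exact: (perturbed_admissible cy (yD y yr) dy y0 yT).
- by move=> t tT; rewrite var.
- by move=> t tT; rewrite var //; have [] := Hy t tT.
Qed.

Local Notation H := (hessian_mx C f T q kappa u).

(* The bump [s eta w] has integral O(s h) and square integral of order s^2 h, so
   the correction, of size O(s h), perturbs the second variation by O(s^2 h^2). *)
Lemma legendre_necessary : normal C f T q u -> has_corank C f T q u 1 ->
  optimal Omega C f T q0 v0 qT vT q u ->
  forall t, t \in `[0, T] -> neg_semidefinite (control_hessian C f T q kappa u t).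
Proof.
move=> nrm cor [_ opt] t0; rewrite in_itv /= => t0T w0; rewrite leNgt; apply/negP => w0pos.
have w0N : w0 != 0 by apply: contraTneq w0pos => ->; rewrite !mul0mx mxE ltxx.
have nw0 : 0 < `|w0| by rewrite normr_gt0.
pose w := `|w0|^-1 *: w0.
have nw : `|w| = 1 by rewrite normrZ normfV normr_id mulVf // gt_eqF.
pose w1 : 'rV[R]_N := row_mx 0 w.
have nw1 : `|w1| <= 1 by apply: ler_norm_row_mx; rewrite ?normr0 ?nw.
pose Q t := (w1 *m H t *m w1^T) 0 0.
pose a := Q t0 / 2.
have a0 : 0 < a.
  rewrite divr_gt0 // /Q (hessian_mx_control oOmega hC hf T0 foc) // quadratic_scale.
  by rewrite mulr_gt0 // exprn_gt0 // invr_gt0.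
have cH := continuous_hessian_mx oOmega hC hf T0 foc.
pose NN : R := N%:R ^+ 2.
have NN0 : 0 <= NN by rewrite exprn_ge0.
have [h1 h10 HQ] : exists2 h1 : R, 0 < h1 & forall t, `|t - t0| < h1 -> a <= Q t.
  have a2 : 0 < a / (1 + NN) by rewrite divr_gt0 ?ltr_pwDl.
  have := cH t0 => /cvgrPdist_le/(_ _ a2)/nbhs_ballP[h1 /= h10 Hh1].
  exists h1 => // t th; have := Hh1 t; rewrite /ball /= distrC => /(_ th)/(scaled_dist_le NN0) dH.
  have -> : Q t = Q t0 + (w1 *m (H t - H t0) *m w1^T) 0 0.
    by rewrite /Q mulmxBr mulmxBl [X in _ = _ + X]mxE [X in _ = _ + (_ + X)]mxE addrC subrK.
  have := bilinear_bound (H t - H t0) w1 w1; rewrite -/NN ler_norml => /andP[B _].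
  have : NN * `|H t - H t0| * (`|w1| * `|w1|) <= a * 1.
    by rewrite ler_pM ?mulr_ge0 // mulr_ile1.
  by move: B; rewrite /a; lra.
clearbody a.
have [K K0 HK] := continuous_bounded T0 cH.
pose KB := NN * K.
have KB0 : 0 <= KB by rewrite mulr_ge0.
have [M M0 HM] := steerable_variation nrm cor.
(* Half of the form gives at least a / 2 (s eta)^2 on the bump; this Taylor error takes away at most
   a / 4 of it, besides terms of order (s h)^2. *)
have a8 : 0 < a / 8 by rewrite divr_gt0.
have [r r0 [HV HR]] := near_right_ex HM (near_hamiltonian_remainder oOmega hC hf T0 foc a8).
pose c := 4 * M.
have c0 : 0 <= c by rewrite mulr_ge0.
(* Coefficient of the loss s^2 h^2, to be compared with the gain s^2 h a / 32. The width below makes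
   K3 h <= a / 64 and keeps the window where the form is at least a. *)
pose K3 := KB * c + (KB / 2 + a / 4) * c ^+ 2 * T.
have K30 : 0 <= K3.
  by rewrite addr_ge0 ?mulr_ge0 ?addr_ge0 ?divr_ge0 ?exprn_ge0 // ltW.
pose h := Num.min (Num.min T (h1 / 2)) (a / 64 / (1 + K3)).
have h0 : 0 < h by rewrite /h !lt_min T0 !divr_gt0 // ltr_pwDl.
have hT : h <= T by rewrite /h !ge_min lexx.
have hh1 : h < h1.
  by rewrite (@le_lt_trans _ _ (h1 / 2)) // ?ltr_pdivrMr // ?ltr_pMr ?ltr1n // /h !ge_min lexx !orbT.
have hK : K3 * h <= a / 64.
  have : h <= a / 64 / (1 + K3) by rewrite /h !ge_min lexx !orbT.
  by rewrite ler_pdivlMr ?ltr_pwDl // => hh; have := ltW h0; lra.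
have [eta [ceta eta01 etaz eta_le eta_ge]] := bump h0 hT t0T.
have ch0 : 0 < 1 + c * h by rewrite ltr_pwDl // mulr_ge0 // ltW.
(* The bump and its correction together have size at most s (1 + c h) = r, the radius of the
   tube. *)
pose s := r / (1 + c * h).
have s0 : 0 < s by rewrite divr_gt0.
pose mu t := s * eta t.
have cmu : continuous mu by move=> t; apply: cvgM; [exact: cst_continuous|exact: ceta].
pose W t : 'rV[R]_m := mu t *: w.
have cW : continuous W by move=> t; apply: cvgZr_tmp; exact: cmu.
have mu0 t : 0 <= mu t by have /andP[e0 _] := eta01 t; rewrite mulr_ge0 // ltW.
have pmu : prim mu T <= s * h by rewrite primZ // ler_wpM2l // ltW.
have Wmu t : 0 <= t <= T -> `|W t| <= mu t /\ mu t + 4 * M * prim mu T <= r.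
  move=> _; split; first by rewrite normrZ nw mulr1 ger0_norm.
  have -> : r = s * 1 + c * (s * h) by rewrite /s; field; rewrite gt_eqF.
  have /andP[_ e1] := eta01 t.
  by rewrite lerD //; [rewrite ler_wpM2l // ltW|rewrite -/c ler_wpM2l].
clearbody s.
have [q' [u' [adm dr dW]]] := HV W mu cW cmu Wmu.
have [tr' [q'0 v'0] [q'T v'T]] := adm.
have [[_ [qE0 vE0] [qET vET]] _ _ _ _] := foc.
have s0' : q' 0 = q 0 /\ derive_within 0 T q' 0 = v 0 by rewrite q'0 v'0 qE0 vE0.
have s1' : q' T = q T /\ derive_within 0 T q' T = v T by rewrite q'T v'T qET vET.
have := opt q' u' adm.
rewrite -subr_ge0 (cost_difference oOmega hC hf T0 foc T0 (lexx T) tr' s0' s1') oppr_ge0 leNgt.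
move/negP; apply.
have crem := continuous_hamiltonian_remainder oOmega hC hf T0 foc T0 tr'.
(* Lower bound of the remainder as a polynomial in eta, from d = xi + s eta w1 with |xi| <= c s h:
   b1 is the gain, b2 the cross term, b3 the square of the correction together with its Taylor
   error. *)
pose b1 := s ^+ 2 * (a / 4); pose b2 := - (s ^+ 2 * (KB * c * h)).
pose b3 := - (s ^+ 2 * ((KB / 2 + a / 4) * (c * h) ^+ 2)).
have ceta2 : continuous (fun t => eta t ^+ 2).
  by move=> t; rewrite (_ : (fun t => eta t ^+ 2) = (fun t => eta t * eta t)) //; apply: cvgM; exact: ceta.
have pw t : 0 <= t <= T -> ((fun t => b1 * eta t ^+ 2) \+ ((fun t => b2 * eta t) \+ (fun=> b3))) t
    <= hamiltonian_remainder C f T q kappa u T q' u' t.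
  move=> tT; have := HR _ q' u' T0 (lexx T) t tT (dr t tT).
  have := dW t tT; set d := variation T q u T q' u' t; set rm := hamiltonian_remainder _ _ _ _ _ _ _ _ _ _.
  move=> dWt Hrm; pose xi := d - row_mx 0 (W t).
  have WE : row_mx 0 (W t) = mu t *: w1 by rewrite /W /w1 scale_row_mx scaler0.
  have dE : d = xi + mu t *: w1 by rewrite -WE subrK.
  have nxi : `|xi| <= c * (s * h) by rewrite (le_trans dWt) // -/c ler_wpM2l.
  have nmu : `|mu t *: w1| <= s * eta t.
    by rewrite normrZ ger0_norm // ler_piMr.
  have /andP[e0 e1] := eta01 t.
  have QE : mu t ^+ 2 * Q t >= s ^+ 2 * (a * eta t ^+ 2).
    (* Outside the window eta vanishes; inside it the form is at least a. *)
    have [th|th] := ltP h `|t - t0|; first by rewrite /mu (etaz _ th) mulr0 expr0n /= !mulr0 mul0r.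
    have := HQ t (le_lt_trans th hh1) => aQ.
    rewrite /mu exprMn -(mulrA (s ^+ 2)) (mulrC a).
    by rewrite (ler_wpM2l (exprn_ge0 2 (ltW s0))) // (ler_wpM2l (exprn_ge0 2 e0)).
  have := quadratic_perturbation (H t) xi (mu t *: w1); rewrite -dE quadratic_scale -/(Q t) -/NN.
  move: Hrm; rewrite -/d; set QQ := (d *m _ *m _) 0 0 => Hrm HQQ.
  have nd : `|d| <= c * (s * h) + s * eta t by rewrite dE (le_trans (ler_normD _ _)) // lerD.
  have X0 : 0 <= c * (s * h) by rewrite !mulr_ge0 // ltW.
  have Y0 : 0 <= s * eta t by rewrite mulr_ge0 // ltW.
  have B1 : NN * `|H t| * (2 * `|xi| * `|mu t *: w1| + `|xi| ^+ 2) <=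
      KB * (2 * (c * (s * h)) * (s * eta t) + (c * (s * h)) ^+ 2).
    apply: ler_pM; rewrite ?addr_ge0 ?mulr_ge0 ?exprn_ge0 //.
      by rewrite ler_wpM2l // HK.
    have mono (x y X Y : R) : 0 <= x -> 0 <= y -> x <= X -> y <= Y ->
        2 * x * y + x ^+ 2 <= 2 * X * Y + X ^+ 2.
      move=> x0 y0 xX yY; rewrite lerD //; last by rewrite lerXn2r // nnegrE (le_trans x0).
      by apply: ler_pM => //; [exact: mulr_ge0|exact: ler_wpM2l].
    exact: mono.
  have B2 : a / 8 * `|d| ^+ 2 <= a / 8 * (2 * (c * (s * h)) ^+ 2 + 2 * (s * eta t) ^+ 2).
    rewrite ler_wpM2l ?(ltW a8) // (@le_trans _ _ ((c * (s * h) + s * eta t) ^+ 2)) //.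
      by rewrite ler_pXn2r // nnegrE ?addr_ge0.
    rewrite -subr_ge0 (_ : _ - _ = (c * (s * h) - s * eta t) ^+ 2) ?sqr_ge0 //; ring.
  have /ler_normlP[HQ1 _] := le_trans HQQ B1.
  have /ler_normlP[HR1 _] := le_trans Hrm B2.
  rewrite /= /b1 /b2 /b3; move: HQ1 HR1 QE; move: (mu t ^+ 2 * Q t) => QQ'.
  have arith (k x y e : R) : KB * (2 * (c * (s * h)) * (s * e) + (c * (s * h)) ^+ 2)
     = s ^+ 2 * (2 * (KB * c * h) * e + KB * (c * h) ^+ 2) by ring.
  have arith2 (e : R) : a / 8 * (2 * (c * (s * h)) ^+ 2 + 2 * (s * e) ^+ 2)
     = s ^+ 2 * (a / 4 * (c * h) ^+ 2 + a / 4 * e ^+ 2) by field.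
  by rewrite arith // arith2; clear; lra.
have cf1 : continuous (fun t => b1 * eta t ^+ 2).
  by move=> t; apply: cvgM; [exact: cst_continuous|exact: ceta2].
have cf2 : continuous (fun t => b2 * eta t).
  by move=> t; apply: cvgM; [exact: cst_continuous|exact: ceta].
have cf3 : continuous (fun _ : R => b3) by move=> t; exact: cst_continuous.
have cf23 : continuous ((fun t => b2 * eta t) \+ (fun=> b3)) by move=> t; apply: cvgD; [exact: cf2|exact: cf3].
have cf : continuous ((fun t => b1 * eta t ^+ 2) \+ ((fun t => b2 * eta t) \+ (fun=> b3))).
  by move=> t; apply: cvgD; [exact: cf1|exact: cf23].
apply: lt_le_trans (prim_le cf crem T0' pw).
rewrite primD // primD // prim_cst // !primZ //.
have s2 : 0 < s ^+ 2 by rewrite exprn_gt0.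
have I1 : b1 * (h / 8) <= b1 * prim (fun t => eta t ^+ 2) T.
  by rewrite ler_wpM2l // /b1 mulr_ge0 ?divr_ge0 // ltW.
have I2 : b2 * h <= b2 * prim eta T.
  by rewrite /b2 !mulNr lerN2 ler_wpM2l // !mulr_ge0 // ltW.
apply: lt_le_trans (lerD I1 (lerD I2 (lexx _))).
have -> : b1 * (h / 8) + (b2 * h + b3 * T) = s ^+ 2 * h * (a / 32 - K3 * h).
  by rewrite /b1 /b2 /b3 /K3; field.
by rewrite !mulr_gt0 // subr_gt0 (le_lt_trans hK) // ltr_pM2l // ltf_pV2 ?posrE ?ltr_nat.
Qed.

End necessity.

Theorem theorem4p2 (R : realType) (n m : nat) (Omega : set 'rV[R]_n)
    (C : state_ctrl R n m -> R)
    (f : state_ctrl R n m -> 'rV[R]_n)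
    (T : R) (q0 v0 qT vT : 'rV[R]_n)
    (q kappa : R -> 'rV[R]_n) (u : R -> 'rV[R]_m) :
  open Omega ->
  Ck_on 2 [set z : state_ctrl R n m | Omega z.1.1] C ->
  Ck_on 2 [set z : state_ctrl R n m | Omega z.1.1] f ->
  0 < T ->
  first_order_conditions Omega C f T q0 v0 qT vT q kappa u ->
  normal C f T q u ->
  has_corank C f T q u 1 ->
  let L_uu t := hessian
    (Ltilde C f (q t) (kappa t)
       (derive_within 0 T q t) (derive_within 0 T kappa t)) (u t) in
  (optimal Omega C f T q0 v0 qT vT q u ->
     forall t, t \in `[0, T] -> neg_semidefinite (L_uu t)) /\
  ((forall t, t \in `[0, T] -> neg_definite (L_uu t)) ->
     exists eps : R, [/\ 0 < eps, eps <= T &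
       locally_optimal Omega C f 0 eps q u]).
Proof.
move=> oOmega hC hf T0 foc nrm cor L_uu; split.
  exact: (legendre_necessary oOmega hC hf T0 foc nrm cor).
exact: (legendre_sufficient oOmega hC hf T0 foc).
Qed.
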